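(* Let $m\ge 1$ be an integer and let $\Phi$ be a finite root system of rank at most four. Then the generalized cluster complex $\mathcal C(m,\Phi)$ is pure-EKR. In particular, for all integers $m\ge 1$ and $2\le n\le 5$, the complex of $(m+2)$-angulations of a convex $(mn+2)$-gon is pure-EKR.
   Context: A simplicial complex is a family of subsets (faces) of a finite ground set closed under taking subsets; facets are inclusion-maximal faces; the complex is pure if all facets have the same size. A family of facets is intersecting if no two members are disjoint. A pure complex is pure-EKR if the maximum size of an intersecting family of facets is attained by the family of all facets containing $v$, for some vertex $v$. Generalized cluster complex (Fomin--Reading). Let $\Phi$ be a finite (reduced) root system with simple roots $\alpha_i$ $(i\in I)$, positive roots $\Phi_{>0}$ and simple reflections $s_i$; its rank is $|I|\ge 1$. First let $\Phi$ be irreducible. Put $\Phi_{\ge -1}=\Phi_{>0}\cup\{-\alpha_i: i\in I\}$. Since the Coxeter diagram is a tree, choose a bipartition $I=I_+\sqcup I_-$ such that neither part contains two adjacent nodes. For $\varepsilon\in\{+,-\}$ define $\tau_\varepsilon:\Phi_{\ge -1}\to\Phi_{\ge -1}$ by $\tau_\varepsilon(\alpha)=\alpha$ if $\alpha=-\alpha_i$ with $i\in I_{-\varepsilon}$, and $\tau_\varepsilon(\alpha)=\left(\prod_{i\in I_\varepsilon}s_i\right)(\alpha)$ otherwise, and let $R=\tau_-\tau_+$. The colored almost positive roots are $$\Phi^m_{\ge -1}=\{\beta^k:\beta\in\Phi_{>0},\,1\le k\le m\}\cup\{(-\alpha_i)^1:i\in I\},$$ where $\beta^k$ is a formal copy of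 $\beta$ with color $k$. Define $R_m:\Phi^m_{\ge -1}\to\Phi^m_{\ge -1}$ by $R_m(\beta^k)=\beta^{k+1}$ if $\beta\in\Phi_{>0}$ and $k<m$, and $R_m(\beta^k)=(R(\beta))^1$ otherwise. There is a unique symmetric binary relation on $\Phi^m_{\ge -1}$, called compatibility, such that (i) $x$ and $y$ are compatible if and only if $R_m(x)$ and $R_m(y)$ are compatible; (ii) for $i\in I$ and a colored root $\beta^k\neq(-\alpha_i)^1$, $(-\alpha_i)^1$ and $\beta^k$ are compatible if and only if $\alpha_i$ has coefficient zero in the expansion of $\beta$ in simple roots, or $\beta$ is a negative simple root. The complex $\mathcal C(m,\Phi)$ has vertex set $\Phi^m_{\ge -1}$, and its faces are the sets of pairwise compatible elements. If $\Phi$ is reducible, $\mathcal C(m,\Phi)$ is the simplicial join of the complexes $\mathcal C(m,\Phi_j)$ over the irreducible components $\Phi_j$ of $\Phi$. It is a pure flag complex whose dimension is the rank of $\Phi$ minus one. Complex of $(m+2)$-angulations. An $(m+2)$-angulation of a convex $(mn+2)$-gon is a set of $n-1$ pairwise non-crossing diagonals subdividing the polygon into $n$ polygons with $m+2$ vertices each. The complex of $(m+2)$-angulations has as facets exactly these sets of diagonals; its faces are all their subsets. It equals $\mathcal C(m,\Phi)$ for $\Phi$ of type $A_{n-1}$. *)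

(* Defs.v *)
From mathcomp Require Import all_boot all_order all_algebra.
From mathcomp Require Import finmap.
From mathcomp Require Import reals.

Set Implicit Arguments.
Unset Strict Implicit.
Unset Printing Implicit Defensive.

Import Order.TTheory GRing.Theory Num.Theory.

Local Open Scope fset_scope.

Section Complexes.
Context {K : choiceType}.
Implicit Types (C F : {fset {fset K}}) (S T : {fset K}) (v : K).

Definition simplicial_complex C : Prop :=
  forall S T, S \in C -> T `<=` S -> T \in C.

Definition facets C : {fset {fset K}} :=
  [fset S in C | all (fun T : {fset K} => (S `<=` T) ==> (T == S)) C].

Definition pure_complex C : Prop :=
  simplicial_complex C /\ {in facets C &, forall S T, #|` S| = #|` T|}.

Definition intersecting F : Prop :=
  {in F &, forall S T, S `&` T != fset0}.

Definition star C v : {fset {fset K}} := [fset S in facets C | v \in S].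

Definition pure_EKR C : Prop :=
  pure_complex C /\
  exists2 v, [fset v] \in C &
    forall F, F `<=` facets C -> intersecting F -> #|` F| <= #|` star C v|.

(* The simplicial join, for complexes on disjoint vertex sets. *)
Definition simplicial_join C1 C2 : {fset {fset K}} :=
  [fset S `|` T | S in C1, T in C2].

Definition flag_complex (X : {fset K}) (c : rel K) : {fset {fset K}} :=
  [fset S in fpowerset X |
    all (fun x => all (fun y => (x != y) ==> c x y) S) S].

End Complexes.

Section RootSystems.
Local Open Scope ring_scope.
Context {R : realType} {d : nat}.
Local Notation V := 'rV[R]_d.
Implicit Types (a b v : V) (Phi : {fset V}).

Definition dot a b : R := (a *m b^T) 0 0.

Definition reflection a v : V := v - (2 * dot v a / dot a a) *: a.

(* No integrality condition: non-crystallographic systems, such as those of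
   types H_3, H_4 and I_2(k), are included. *)
Definition root_system Phi : Prop :=
  [/\ 0 \notin Phi,
      {in Phi &, forall a b, reflection a b \in Phi}
    & {in Phi, forall a (t : R), t *: a \in Phi -> t = 1 \/ t = -1}].

Section SimpleRoots.
Context {r : nat}.
Variables (Phi : {fset V}) (alpha : r.-tuple V).
Local Notation simple i := (tnth alpha i).

Definition simple_system : Prop :=
  [/\ free alpha,
      forall i, simple i \in Phi
    & {in Phi, forall b, b \in <<alpha>>%VS /\
        ((forall i, 0 <= coord alpha i b) \/ (forall i, coord alpha i b <= 0))}].

Definition positive_roots : {fset V} :=
  [fset b in Phi | [forall i, 0 <= coord alpha i b]].

Definition adjacent : rel 'I_r :=
  fun i j => (i != j) && (dot (simple i) (simple j) != 0).

Definition is_bipartition (Ip : {set 'I_r}) : Prop :=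
  forall i j, adjacent i j -> (i \in Ip) != (j \in Ip).

Definition negative_simple (b : V) : bool := [exists i, b == - simple i].

(* [tau J] is $\tau_\varepsilon$ for $J = I_\varepsilon$; the reflections
   indexed by $J$ commute, so their order is immaterial. *)
Definition tau (J : {set 'I_r}) (b : V) : V :=
  if [exists i in ~: J, b == - simple i] then b
  else foldr (fun i => reflection (simple i)) b (enum J).

Definition rotation (Ip : {set 'I_r}) (b : V) : V := tau (~: Ip) (tau Ip b).

(* The pair [(b, k)] is the root [b] with colour [k]. *)
Definition colored_roots (m : nat) : {fset V * nat} :=
  [fset (b, k) | b : V in positive_roots, k : nat in iota 1 m]
  `|` [fset (- simple i, 1%N) | i : 'I_r].

Definition colored_rotation (m : nat) (Ip : {set 'I_r}) (x : V * nat) :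
    V * nat :=
  if (x.1 \in positive_roots) && (x.2 < m)%N then (x.1, x.2.+1)
  else (rotation Ip x.1, 1%N).

(* The values of [c] on the diagonal are irrelevant. *)
Definition compatibility (m : nat) (Ip : {set 'I_r}) (c : rel (V * nat)) :
    Prop :=
  [/\ {in colored_roots m &, symmetric c},
      {in colored_roots m &, forall x y,
         c x y = c (colored_rotation m Ip x) (colored_rotation m Ip y)}
    & forall i, {in colored_roots m, forall x, x != (- simple i, 1%N) ->
         c (- simple i, 1%N) x = (coord alpha i x.1 == 0) || negative_simple x.1}].

Definition components : {set {set 'I_r}} :=
  [set [set j | connect adjacent i j] | i : 'I_r].

(* The simple roots, and the roots, of the subsystem spanned by the simple
   roots with index in [J]. *)
Definition sub_simple (J : {set 'I_r}) : #|J|.-tuple V :=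
  [tuple simple (enum_val k) | k < #|J|].

Definition sub_roots (J : {set 'I_r}) : {fset V} :=
  [fset b in Phi | b \in <<sub_simple J>>%VS].

End SimpleRoots.

Definition irreducible_cluster_complex {r : nat} (m : nat) Phi
    (alpha : r.-tuple V) (c : rel (V * nat)) : {fset {fset V * nat}} :=
  flag_complex (colored_roots Phi alpha m) c.

(* [c J] is the compatibility relation of the irreducible component [J]. *)
Definition cluster_complex {r : nat} (m : nat) Phi (alpha : r.-tuple V)
    (c : {set 'I_r} -> rel (V * nat)) : {fset {fset V * nat}} :=
  \big[simplicial_join/[fset fset0]]_(J in components alpha)
    irreducible_cluster_complex m (sub_roots Phi alpha J)
      (sub_simple alpha J) (c J).

End RootSystems.

(* The vertices of the convex N-gon are 0, ..., N - 1 in cyclic order, and the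
   segment with end points i < j is the pair (i, j). *)
Section Polygons.
Context {N : nat}.
Implicit Types (e f : 'I_N * 'I_N) (D : {fset 'I_N * 'I_N}) (P : {set 'I_N}).

Definition side e : bool :=
  (e.2 == e.1.+1 :> nat) || ((e.1 == 0 :> nat) && (e.2 == N.-1 :> nat)).

Definition diagonals : {fset 'I_N * 'I_N} :=
  [fset e | e : 'I_N * 'I_N & (e.1 < e.2) && ~~ side e].

Definition crossing e f : bool :=
  (e.1 < f.1 < e.2) && (e.2 < f.2) || (f.1 < e.1 < f.2) && (f.2 < e.2).

Definition noncrossing D : bool :=
  all (fun e => all (fun f => ~~ crossing e f) D) D.

(* For i < j in P: i and j are neighbours on the boundary of the convex hull
   of P. *)
Definition consecutive P (i j : 'I_N) : bool :=
  [forall k in P, ~~ (i < k < j)] || [forall k in P, i <= k <= j].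

(* P is the vertex set of a region cut out by D: each side of the convex hull
   of P is a side of the polygon or a member of D, and no member of D is a
   diagonal of that hull. *)
Definition region D P : bool :=
  (2 < #|P|) &&
  [forall i in P, forall j in P, (i < j) ==>
     (consecutive P i j == (side (i, j) || ((i, j) \in D)))].

End Polygons.

Definition is_angulation (m n : nat)
    (D : {fset 'I_(m * n + 2) * 'I_(m * n + 2)}) : bool :=
  [&& #|` D| == n.-1, noncrossing D, #|region D| == n
    & [forall P, region D P ==> (#|P| == m.+2)]].

Definition angulations (m n : nat) :
    {fset {fset 'I_(m * n + 2) * 'I_(m * n + 2)}} :=
  [fset D in fpowerset diagonals | @is_angulation m n D].

Definition angulation_complex (m n : nat) :
    {fset {fset 'I_(m * n + 2) * 'I_(m * n + 2)}} :=
  \bigcup_(D <- angulations m n) fpowerset D.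

(* Main.v *)
Require Import Defs.
From Stdlib Require Import BinNat.
From mathcomp Require Import all_boot all_order all_algebra.
From mathcomp Require Import finmap zify boolp.
From mathcomp Require Import ring lra.
From mathcomp Require Import reals.

(** Both families of complexes are instances of one notion. Let adj be a graph on a finite set X, and
consider the flag complex of its cliques. Call it k-regular of rank n if it is pure of rank n and
every ridge lies in exactly k facets ([regular]). The generalized cluster complex of a root system
of rank n and the complex of (m+2)-angulations of an (m(n+1)+2)-gon are (m+1)-regular of rank n. So
the theorem follows from an Erdos-Ko-Rado theorem, [pure_EKR_regular]: for k > 1 and rank at most
four, the largest intersecting families of facets of a k-regular flag complex include a star.

For its proof, note that a star has at least k^(n-1) members ([star_ge]). If some edge ab meets all
members of an intersecting family, the family is compared with a star by exchanging vertices: a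
vertex x of a facet can be replaced by another vertex completing the same ridge, which is never a
neighbour of x, so this is an injection from the facets through x into the facets off x that
preserves membership of the neighbours of x ([swap_le]). Together with an analysis of the traces on
the link of ab this gives [pair_star]. If no edge meets all members, the family is small: choosing
members that avoid the vertices already fixed, and branching over their vertices, gives the bounds 4
in rank three and k^3 in rank four if k > 2 ([rank3_bound], [rank4_bound]). In rank four with k = 2,
the bound 8 is the outcome of an exhaustive search, run and proved sound below ([degree2_bound]).

For the (mn+2)-gon, the facets are the (n-1)-sets of noncrossing diagonals whose length is congruent to 1
modulo m, and the link of such a diagonal is the join of the complexes of the two polygons that it
cuts off ([regular_mdiags]). That the angulations are exactly these sets is proved by attaching to
each diagonal, and to the outermost edge, the region just below it ([angulationsE]).

For cluster complexes, compatibility is written down explicitly with the Euler form E of the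
bipartite orientation, which satisfies E(y, Cx) = - E(x, y) for the bipartite Coxeter element C.
This relation satisfies the axioms of compatibility, and it is the only one that does, because the
rotation takes every root to a negative simple root ([compat_unique]). The Euler form restricts to
subsystems, so the link of a negative simple root is the complex of the subsystem without this root;
by rotation all links have this form, and regularity follows by induction on the rank
([regular_colored_roots]). Roots of different irreducible components are orthogonal, hence
compatible, so that the join over the components is the complex of the whole system. *)

Set Implicit Arguments.
Unset Strict Implicit.
Unset Printing Implicit Defensive.

Local Open Scope fset_scope.
Local Open Scope nat_scope.

Lemma in_sep (T : choiceType) (A : {fset T}) (P : pred T) u :
  (u \in [fset v in A | P v]) = (u \in A) && P u.
Proof. by rewrite !inE. Qed.

(** * Regular flag complexes *)

Section FlagGraphs.
Context {K : choiceType} (adj : rel K).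
Hypotheses (adj_sym : symmetric adj) (adj_irr : irreflexive adj).
Implicit Types (X S T : {fset K}) (F : {fset {fset K}}) (a b c x y : K).

Definition nbr X x : {fset K} := [fset y in X | adj x y].

Definition clique S : bool :=
  all (fun x => all (fun y => (x != y) ==> adj x y) S) S.

Lemma cliqueP S :
  reflect {in S &, forall x y, x != y -> adj x y} (clique S).
Proof.
apply: (iffP allP) => [h x y xS yS | h x xS].
  by move/implyP: (allP (h x xS) y yS).
by apply/allP => y yS; apply/implyP; apply: h.
Qed.

Definition cliques n X : {fset {fset K}} :=
  [fset S in fpowerset X | clique S && (#|` S| == n)].

Lemma in_cliques n X S :
  (S \in cliques n X) = [&& S `<=` X, clique S & #|` S| == n].
Proof. by rewrite !inE fpowersetE. Qed.

Lemma facetP n X S : S \in cliques n X -> [/\ S `<=` X, clique S & #|` S| = n].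
Proof. by rewrite in_cliques => /and3P[? ? /eqP]. Qed.

Lemma facet_adj n X S x y : S \in cliques n X -> x \in S -> y \in S -> x != y -> adj x y.
Proof. by move=> /facetP[_ /cliqueP cS _]; apply: cS. Qed.

(** A recursive description of: the cliques in X are the faces of a nonempty pure complex of rank
n in which every ridge lies in exactly k facets. Going through vertex links makes inductions on
the rank immediate. *)
Fixpoint regular k n X : Prop :=
  if n is n'.+1 then
    [/\ X != fset0, n' = 0 -> #|` X| = k & {in X, forall x, regular k n' (nbr X x)}]
  else X = fset0.

Lemma in_nbr X x y : (y \in nbr X x) = (y \in X) && adj x y.
Proof. by rewrite !inE. Qed.

Lemma nbr_sub X x : nbr X x `<=` X.
Proof. by apply/fsubsetP => y; rewrite in_nbr => /andP[]. Qed.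

Lemma sub_clique S T : T `<=` S -> clique S -> clique T.
Proof.
move=> /fsubsetP TS /cliqueP cS; apply/cliqueP => x y xT yT.
by apply: cS; apply: TS.
Qed.

Lemma clique0 : clique fset0.
Proof. by apply/cliqueP => x y; rewrite inE. Qed.

Lemma cliqueU1 x S :
  clique S -> {in S, forall y, x != y -> adj x y} -> clique (x |` S).
Proof.
move=> /cliqueP cS h; apply/cliqueP => y z.
rewrite !in_fset1U => /orP[/eqP->|yS] /orP[/eqP->|zS]; rewrite ?eqxx //.
- exact: h.
- by move=> nyx; rewrite adj_sym; apply: h; rewrite // eq_sym.
- exact: cS.
Qed.

Lemma clique_nbr X S x : S `<=` X -> clique S -> x \in S -> S `\ x `<=` nbr X x.
Proof.
move=> /fsubsetP SX /cliqueP cS xS; apply/fsubsetP => y.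
rewrite in_fsetD1 in_nbr => /andP[nyx yS]; rewrite SX //=.
by apply: cS; rewrite // eq_sym.
Qed.

Lemma clique_nbrU X x S : x \in X -> S `<=` nbr X x -> clique S ->
  [/\ x |` S `<=` X, clique (x |` S) & x \notin S].
Proof.
move=> xX /fsubsetP SN cS; split.
- by rewrite fsubUset fsub1set xX /=; apply/fsubsetP => y /SN; rewrite in_nbr => /andP[].
- by apply: cliqueU1 => // y /SN; rewrite in_nbr => /andP[].
- by apply/negP => /SN; rewrite in_nbr adj_irr andbF.
Qed.

Lemma clique_size k n X S : regular k n X -> S `<=` X -> clique S -> #|` S| <= n.
Proof.
elim: n X S => [|n IH] X S /=.
  by move=> -> /fsubset_leq_card; rewrite cardfs0 leqn0.
move=> [_ _ reg] SX cS; have [->|[x xS]] := fset_0Vmem S; first by rewrite cardfs0.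
rewrite (cardfsD1 x) xS add1n ltnS; apply: (IH (nbr X x)).
- exact/reg/(fsubsetP SX).
- exact: clique_nbr.
- exact: sub_clique (fsubD1set _ _) cS.
Qed.

Lemma clique_extend k n X S : regular k n X -> S `<=` X -> clique S ->
  exists2 S', S' \in cliques n X & S `<=` S'.
Proof.
elim: n X S => [|n IH] X S /=.
  move=> -> SX cS; exists fset0 => //.
  by rewrite in_cliques fsub0set clique0 cardfs0.
move=> [X0 _ reg] SX cS.
have [x [xX Sx]] : exists x, x \in X /\ S `\ x `<=` nbr X x.
  have [->|[x xS]] := fset_0Vmem S.
    by have [x xX] := fset0Pn _ X0; exists x; rewrite xX fset0D fsub0set.
  by exists x; split; [apply: (fsubsetP SX) | apply: clique_nbr].
have [S'] := IH _ _ (reg x xX) Sx (sub_clique (fsubD1set _ _) cS).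
rewrite in_cliques => /and3P[S'N cS' /eqP sS'] SS'.
have [h1 h2 h3] := clique_nbrU xX S'N cS'.
exists (x |` S'); first by rewrite in_cliques h1 h2 cardfsU1 h3 sS' add1n eqxx.
apply/fsubsetP => y yS; rewrite in_fset1U; case: eqVneq => //= nyx.
by apply: (fsubsetP SS'); rewrite in_fsetD1 nyx.
Qed.

Definition common X T : {fset K} := [fset y in X | all (adj y) T].

Lemma in_common X T y : (y \in common X T) = (y \in X) && all (adj y) T.
Proof. by rewrite !inE. Qed.

(** In the link of a vertex of T the vertices completing T are those completing a smaller ridge;
in rank one they are the k vertices of the complex. *)
Lemma ridge_degree k n X T : regular k n.+1 X -> T \in cliques n X ->
  #|` common X T| = k.
Proof.
elim: n X T => [|n IH] X T.
  move=> /= [_ cX _]; rewrite in_cliques => /and3P[_ _ /eqP/cardfs0_eq->].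
  rewrite -(cX erefl); apply: (congr1 (fun A : {fset K} => #|` A|)).
  by apply/fsetP => y; rewrite in_common andbT.
move=> /= [_ _ reg]; rewrite in_cliques => /and3P[TX cT /eqP sT].
have [T0|[x xT]] := fset_0Vmem T; first by move: sT; rewrite T0 cardfs0.
rewrite -(IH (nbr X x) (T `\ x)); first last.
- rewrite in_cliques (clique_nbr TX cT xT) (sub_clique (fsubD1set _ _) cT) /=.
  by move: sT; rewrite (cardfsD1 x) xT add1n => -[->].
- exact/reg/(fsubsetP TX).
apply: (congr1 (fun A : {fset K} => #|` A|)); apply/fsetP => y.
rewrite !in_common in_nbr -andbA; congr (_ && _).
apply/allP/andP => [h|[xy /allP h] z zT].
  split; first by rewrite adj_sym h.
  by apply/allP => z /fsetD1P[_]; apply: h.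
by have [->|nzx] := eqVneq z x; [rewrite adj_sym | apply: h; rewrite in_fsetD1 nzx].
Qed.

Lemma card_inj_le (T1 T2 : choiceType) (A : {fset T1}) (B : {fset T2}) (f : T1 -> T2) :
  {in A, forall u, f u \in B} -> {in A &, injective f} -> #|` A| <= #|` B|.
Proof.
move=> fB finj; rewrite -(size_map f A).
apply: uniq_leq_size; first by rewrite map_inj_in_uniq.
by move=> y /mapP[x xA ->]; apply: fB.
Qed.

(** A boolean count, so that inequalities between sums of counts can be checked on one facet at a
time. *)
Definition facet_count n X (P : pred {fset K}) : nat := count P (cliques n X).

Lemma eq_facet_count n X (P Q : pred {fset K}) : P =1 Q -> facet_count n X P = facet_count n X Q.
Proof. by move=> PQ; apply: eq_count. Qed.

Lemma facet_count_sum n X P : facet_count n X P = \sum_(S <- cliques n X) P S.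
Proof. by rewrite /facet_count -sum1_count big_mkcond; apply: eq_bigr => S _; case: (P S). Qed.

Lemma facet_count_card n X (P : pred {fset K}) :
  facet_count n X P = #|` [fset S in cliques n X | P S]|.
Proof.
rewrite /facet_count -size_filter; apply: perm_size; apply: uniq_perm.
- by rewrite filter_uniq ?fset_uniq.
- exact: fset_uniq.
- by move=> S; rewrite mem_filter [RHS]in_sep andbC.
Qed.

Lemma leq_facet_count n X (P Q : pred {fset K}) :
  {in cliques n X, forall S, P S -> Q S} -> facet_count n X P <= facet_count n X Q.
Proof.
move=> PQ; rewrite !facet_count_sum !big_seq; apply: leq_sum => S SF.
by case: (P S) (PQ S SF) => // ->.
Qed.

Lemma leq_facet_count_inj n X n' X' (P Q : pred {fset K}) f :
  {in cliques n X, forall S, P S -> (f S \in cliques n' X') && Q (f S)} ->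
  {in cliques n X &, forall S S', P S -> P S' -> f S = f S' -> S = S'} ->
  facet_count n X P <= facet_count n' X' Q.
Proof.
move=> fQ finj; rewrite !facet_count_card; apply: (card_inj_le (f := f)) => /=.
  by move=> S; rewrite in_sep => /andP[SF PS]; rewrite in_sep; exact: fQ.
by move=> S S'; rewrite in_sep => /andP[? ?]; rewrite in_sep => /andP[? ?]; apply: finj.
Qed.

Lemma facet_count_star k n X x : regular k n.+1 X -> x \in X ->
  facet_count n (nbr X x) xpredT <= facet_count n.+1 X (fun S => x \in S).
Proof.
move=> reg xX; apply: (leq_facet_count_inj (f := fun S => x |` S)).
  move=> S; rewrite !in_cliques => /and3P[SN cS /eqP sS] _.
  have [h1 h2 h3] := clique_nbrU xX SN cS.
  by rewrite h1 h2 cardfsU1 h3 sS fset1U1 !eqxx.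
move=> S S'; rewrite !in_cliques => /and3P[SN cS _] /and3P[SN' cS' _] _ _ e.
have [_ _ h] := clique_nbrU xX SN cS; have [_ _ h'] := clique_nbrU xX SN' cS'.
by rewrite -(fsetU1K h) e fsetU1K.
Qed.

Lemma facet_degree k n X T : regular k n.+1 X -> T \in cliques n X ->
  facet_count n.+1 X (fun S => T `<=` S) = k.
Proof.
move=> reg TF; rewrite -(ridge_degree reg TF).
move: TF; rewrite in_cliques => /and3P[TX cT /eqP sT].
have nT y : y \in common X T -> y \notin T.
  by rewrite in_common => /andP[_ /allP h]; apply/negP => /h; rewrite adj_irr.
rewrite facet_count_card.
rewrite (_ : [fset _ in _ | _] = [fset y |` T | y in common X T]).
  rewrite card_in_imfset //= => y z yC zC /fsetP/(_ y).
  by rewrite fset1U1 in_fset1U (negPf (nT y yC)) orbF => /esym/eqP.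
apply/fsetP => S; apply/idP/imfsetP => /=.
  rewrite in_sep in_cliques -!andbA => /and4P[SX cS /eqP sS TS].
  have : 0 < #|` S `\` T| by rewrite cardfsDS // sS sT subSn // subnn.
  rewrite cardfs_gt0 => /fset0Pn[y]; rewrite in_fsetD => /andP[nyT yS].
  exists y.
    rewrite in_common (fsubsetP SX) //=; apply/allP => z zT.
    move/cliqueP: cS; apply=> //; first exact: (fsubsetP TS).
    by apply: contra nyT => /eqP->.
  apply/eqP; rewrite eq_sym eqEfcard fsubUset fsub1set yS TS /=.
  by rewrite cardfsU1 nyT sS sT.
move=> [y yC ->]; rewrite in_sep in_cliques -!andbA.
move: (nT y yC) (yC); rewrite in_common => nyT /andP[yX /allP ya].
rewrite fsubUset fsub1set yX TX /= cardfsU1 nyT sT eqxx fsubsetUr !andbT.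
by apply: cliqueU1 => // z zT _; apply: ya.
Qed.

(** Otherwise x could be added to the facet, giving a clique larger than the rank allows. *)
Lemma sub_nbr_facet k n X x S : regular k n.+1 X -> x \in X ->
  S \in cliques n.+1 X -> ~~ (S `<=` nbr X x).
Proof.
move=> reg xX; rewrite in_cliques => /and3P[SX cS /eqP sS]; apply/negP => SN.
have [h1 h2 h3] := clique_nbrU xX SN cS.
by have := clique_size reg h1 h2; rewrite cardfsU1 h3 sS ltnn.
Qed.

(** Count the pairs of a ridge contained in the link of a vertex x and a facet above it: every
ridge lies in k facets, and a facet S' has at most one ridge in the link, its trace there, as S'
itself is not contained in the link. *)
Lemma facet_count_ge k n X : regular k n X -> k ^ n <= facet_count n X xpredT.
Proof.
elim: n X => [|n IH] X reg.
  rewrite expn0 /facet_count count_predT cardfs_gt0; apply/fset0Pn; exists fset0.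
  by rewrite in_cliques fsub0set clique0 cardfs0.
have [X0 _ regN] := reg; have [x xX] := fset0Pn _ X0.
apply: leq_trans (_ : k * facet_count n (nbr X x) xpredT <= _).
  by rewrite expnS leq_mul2l IH ?orbT //; apply: regN.
rewrite [facet_count n _ _]facet_count_sum big_distrr /=.
have -> : \sum_(S <- cliques n (nbr X x)) k * 1 =
          \sum_(S <- cliques n (nbr X x)) \sum_(S' <- cliques n.+1 X) (S `<=` S').
  rewrite !big_seq; apply: eq_bigr => S; rewrite in_cliques => /and3P[SN cS sS].
  rewrite -facet_count_sum (facet_degree reg) ?muln1 // in_cliques cS sS !andbT.
  exact: fsubset_trans SN (nbr_sub _ _).
rewrite exchange_big facet_count_sum /= big_seq [in leqRHS]big_seq.
apply: leq_sum => S' S'F; rewrite -facet_count_sum facet_count_card.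
rewrite -(cardfs1 (S' `&` nbr X x)); apply/fsubset_leq_card/fsubsetP => S.
rewrite in_sep in_cliques in_fset1 -!andbA => /and4P[SN _ /eqP sS SS'].
rewrite eqEfcard fsubsetI SS' SN /= sS -ltnS.
move: (S'F); rewrite in_cliques => /and3P[_ _ /eqP<-].
apply: fproper_ltn_card; rewrite fproperE fsubsetIl fsubsetI fsubset_refl /=.
exact: (sub_nbr_facet reg).
Qed.

End FlagGraphs.

(** * Exchanging a vertex of a facet *)

Section PairTransversal.
Context {K : choiceType} (adj : rel K).
Hypotheses (adj_sym : symmetric adj) (adj_irr : irreflexive adj).
Implicit Types (X S T : {fset K}) (F : {fset {fset K}}) (a b c x y : K).
Local Notation cliques := (cliques adj).
Local Notation facet_count := (facet_count adj).
Local Notation regular := (regular adj).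

Variables (k n : nat) (X : {fset K}).
Hypotheses (k2 : 1 < k) (reg : regular k n.+1 X).
Local Notation facets := (cliques n.+1 X).
Local Notation "# P" := (facet_count n.+1 X P) (at level 10, P at level 8).

(** Exchanges x for another vertex that completes the same ridge. There is one because k > 1, so
the default x is never used. *)
Definition swap x S : {fset K} :=
  odflt x (ohead (enum_fset (common adj X (S `\ x) `\ x))) |` (S `\ x).

(** The new vertex w is not adjacent to x: otherwise the new facet would lie in the link of x. *)
Lemma swapP x S : S \in facets -> x \in S ->
  exists w, [/\ w != x, ~~ adj x w, S `\ x `<=` nbr adj X x,
    swap x S = w |` (S `\ x) & w |` (S `\ x) \in facets].
Proof.
move=> SF xS; have [SX cS sS] := facetP SF.
have xX : x \in X by apply: (fsubsetP SX).
have sub := clique_nbr SX cS xS.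
have TF : S `\ x \in cliques n X.
  rewrite in_cliques (fsubset_trans (fsubD1set _ _) SX) (sub_clique (fsubD1set _ _) cS) /=.
  by move: sS; rewrite (cardfsD1 x) xS add1n => -[->].
have xC : x \in common adj X (S `\ x).
  rewrite in_common xX; apply/allP => y /(fsubsetP sub).
  by rewrite in_nbr => /andP[].
have := ridge_degree adj_sym reg TF; rewrite (cardfsD1 x) xC add1n.
rewrite /swap; case E : (enum_fset _) => [|w s] /= ck; first by lia.
have : w \in common adj X (S `\ x) `\ x by rewrite -[_ \in _]/(w \in enum_fset _) E mem_head.
rewrite in_fsetD1 in_common => /and3P[nwx wX /allP wT].
have nwT : w \notin S `\ x by apply/negP => /wT; rewrite adj_irr.
have WF : w |` (S `\ x) \in facets.
  rewrite in_cliques fsubUset fsub1set wX (fsubset_trans (fsubD1set _ _) SX) /=.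
  rewrite cliqueU1 ?(sub_clique (fsubD1set _ _) cS) //=; last by move=> z /wT.
  rewrite cardfsU1 nwT; move: TF; rewrite in_cliques => /and3P[_ _ /eqP->].
  by rewrite eqxx.
exists w; split => //; apply/negP => axw.
case/negP: (sub_nbr_facet adj_sym adj_irr reg xX WF).
by rewrite fsubUset fsub1set sub andbT in_nbr wX.
Qed.

Lemma swap_facet x S : S \in facets -> x \in S -> swap x S \in facets.
Proof. by move=> SF /(swapP SF)[w [_ _ _ ->]]. Qed.

Lemma notin_swap x S : S \in facets -> x \in S -> x \notin swap x S.
Proof.
move=> SF /(swapP SF)[w [nwx _ _ -> _]].
by rewrite in_fset1U eq_sym (negPf nwx) fsetD11.
Qed.

Lemma in_swap x S y : S \in facets -> x \in S -> adj x y -> (y \in swap x S) = (y \in S).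
Proof.
move=> SF xS axy; have [w [nwx nxw _ -> _]] := swapP SF xS.
rewrite in_fset1U in_fsetD1 (_ : y == w = false); last first.
  by apply: contraNF nxw => /eqP<-.
by rewrite (_ : y != x) //; apply: contraTneq axy => ->; rewrite adj_irr.
Qed.

Lemma swap_inj x : {in facets &, forall S S', x \in S -> x \in S' ->
  swap x S = swap x S' -> S = S'}.
Proof.
move=> S S' SF SF' xS xS' e.
have h T : T \in facets -> x \in T -> T = x |` (swap x T `&` nbr adj X x).
  move=> TF xT; have [w [nwx nxw sub -> _]] := swapP TF xT.
  rewrite -{1}(fsetD1K xT); congr (_ |` _).
  rewrite fsetIUl (fsetIidPl sub) (_ : [fset w] `&` _ = fset0) ?fset0U //.
  apply/fsetP => z; rewrite in_fsetI in_fset1 in_nbr inE.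
  by case: eqVneq => //= ->; rewrite (negPf nxw) andbF.
by rewrite (h S) // (h S') // e.
Qed.

(** The exchange of x is injective and preserves membership of all neighbours of x, because the
new vertex is not one of them. So a condition on these neighbours holds at least as often off x
as through x. *)
Lemma swap_le x (P Q : pred {fset K}) :
  {in facets &, forall S S', x \in S -> x \notin S' ->
     (forall y, adj x y -> (y \in S') = (y \in S)) -> P S -> Q S'} ->
  #(fun S => (x \in S) && P S) <= #(fun S => (x \notin S) && Q S).
Proof.
move=> PQ; apply: (leq_facet_count_inj (f := swap x)) => [S SF|S S' SF SF'].
  case/andP=> xS PS; rewrite swap_facet ?notin_swap //=.
  by apply: (PQ S); rewrite ?swap_facet ?notin_swap // => y; apply: in_swap.
by case/andP=> xS _ /andP[xS' _]; apply: swap_inj.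
Qed.

Lemma count_add (P Q R T : pred {fset K}) :
  {in facets, forall S, P S + Q S <= R S + T S} -> #P + #Q <= #R + #T.
Proof.
move=> h; rewrite !facet_count_sum -!big_split /= !big_seq.
by apply: leq_sum => S; apply: h.
Qed.

Section Patterns.
Variables (a b x y : K).
Hypothesis ab : [&& adj a b, adj a x, adj a y, adj b x, adj b y & adj x y].

Definition pattern p q r s : pred {fset K} := fun S =>
  [&& (a \in S) == p, (b \in S) == q, (x \in S) == r & (y \in S) == s].

(** Vertices are removed from the pattern one at a time; the three others are neighbours of the
one exchanged. *)
Lemma pattern_anti p q r s p' q' r' s' : p' ==> p -> q' ==> q -> r' ==> r -> s' ==> s ->
  #(pattern p q r s) <= #(pattern p' q' r' s').
Proof.
have ab' : [&& adj b a, adj x a, adj y a, adj x b, adj y b & adj y x].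
  by rewrite !(adj_sym b a, adj_sym x a, adj_sym y a, adj_sym x b, adj_sym y b, adj_sym y x).
case/and5P: ab ab' => ? ? ? ? /andP[? ?] /and5P[? ? ? ? /andP[? ?]].
have step v (P T T' : pred {fset K}) :
    (forall S S', (forall u, adj v u -> (u \in S') = (u \in S)) -> P S -> P S') ->
    T =1 (fun S => (v \in S) && P S) -> T' =1 (fun S => (v \notin S) && P S) -> #T <= #T'.
  move=> h eT eT'; rewrite (eq_facet_count _ _ _ eT) (eq_facet_count _ _ _ eT').
  by apply: swap_le => S S' _ _ _ _; apply: h.
have ha q1 r1 s1 : #(pattern true q1 r1 s1) <= #(pattern false q1 r1 s1).
  apply: (step a (fun S => [&& (b \in S) == q1, (x \in S) == r1 & (y \in S) == s1])).
  - by move=> S S' e; rewrite !e.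
  - by move=> S; rewrite /pattern eqb_id.
  - by move=> S; rewrite /pattern eqbF_neg.
have hb p1 r1 s1 : #(pattern p1 true r1 s1) <= #(pattern p1 false r1 s1).
  apply: (step b (fun S => [&& (a \in S) == p1, (x \in S) == r1 & (y \in S) == s1])).
  - by move=> S S' e; rewrite !e.
  - by move=> S; rewrite /pattern eqb_id andbCA.
  - by move=> S; rewrite /pattern eqbF_neg andbCA.
have hx p1 q1 s1 : #(pattern p1 q1 true s1) <= #(pattern p1 q1 false s1).
  apply: (step x (fun S => [&& (a \in S) == p1, (b \in S) == q1 & (y \in S) == s1])).
  - by move=> S S' e; rewrite !e.
  - by move=> S; rewrite /pattern eqb_id; do 3!case: (_ \in S); case: p1; case: q1.
  - by move=> S; rewrite /pattern eqbF_neg; do 3!case: (_ \in S); case: p1; case: q1.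
have hy p1 q1 r1 : #(pattern p1 q1 r1 true) <= #(pattern p1 q1 r1 false).
  apply: (step y (fun S => [&& (a \in S) == p1, (b \in S) == q1 & (x \in S) == r1])).
  - by move=> S S' e; rewrite !e.
  - by move=> S; rewrite /pattern eqb_id; do 4!case: (_ \in S); case: p1; case: q1; case: r1.
  - by move=> S; rewrite /pattern eqbF_neg; do 4!case: (_ \in S); case: p1; case: q1; case: r1.
have l1 : p' ==> p -> #(pattern p q r s) <= #(pattern p' q r s).
  by case: p; case: p'.
have l2 : q' ==> q -> #(pattern p' q r s) <= #(pattern p' q' r s).
  by case: q {l1}; case: q'.
have l3 : r' ==> r -> #(pattern p' q' r s) <= #(pattern p' q' r' s).
  by case: r {l1 l2}; case: r'.
have l4 : s' ==> s -> #(pattern p' q' r' s) <= #(pattern p' q' r' s').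
  by case: s {l1 l2 l3}; case: s'.
move=> /l1 m1 /l2 m2 /l3 m3 /l4 m4.
exact: leq_trans m1 (leq_trans m2 (leq_trans m3 m4)).
Qed.

Variable F : pred {fset K}.
Hypotheses (Fab : {in facets, forall S, F S -> (a \in S) || (b \in S)})
  (Fb : {in facets, forall S, F S -> a \notin S -> (x \in S) && (y \in S)})
  (Fa : {in facets, forall S, F S -> b \notin S -> (x \in S) || (y \in S)}).

Let FE S : S \in facets -> F S ==> [&& (a \in S) || (b \in S),
  (a \in S) || (x \in S) && (y \in S) & [|| b \in S, x \in S | y \in S]].
Proof.
move=> SF; apply/implyP => FS; rewrite Fab //=.
by apply/andP; split; rewrite -implyNb; apply/implyP => ?; [apply: Fb | apply: Fa].
Qed.

(** Write traces on the clique abxy as words. Members of F outside the star of a have trace bxy.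
If these are at most as many as the facets of trace a, none of which is in F, then the star of a
is as large as F. Otherwise the members outside the star of x have traces aby, ab and ay, each at
most as frequent as a, hence less frequent than bxy and than each of bx, xy and x. The last three
are traces of facets in the star of x that are not in F. *)
Lemma upset_star : #F <= #(fun S => a \in S) \/ #F <= #(fun S => x \in S).
Proof.
have [le|lt] := leqP (#(pattern false true true true)) (#(pattern true false false false)).
  left; rewrite -(leq_add2r (#(pattern true false false false))).
  apply: leq_trans (_ : _ <= #(fun S => a \in S) + #(pattern false true true true)) _.
    apply: count_add => S SF; rewrite /pattern.
    by move: (FE SF); case: (F S); do 4!case: (_ \in S).
  by rewrite leq_add2l.
right.
have : #F + (#(pattern false true true false) + #(pattern false false true true) +
             #(pattern false false true false)) <=
       #(fun S => x \in S) + (#(pattern true true false true) + #(pattern true true false false) +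
             #(pattern true false false true)).
  rewrite !facet_count_sum -!big_split /= !big_seq; apply: leq_sum => S SF.
  rewrite /pattern.
  by move: (FE SF); case: (F S); do 4!case: (_ \in S).
have := @pattern_anti true true false true true false false false isT isT isT isT.
have := @pattern_anti true true false false true false false false isT isT isT isT.
have := @pattern_anti true false false true true false false false isT isT isT isT.
have := @pattern_anti false true true true false true true false isT isT isT isT.
have := @pattern_anti false true true true false false true true isT isT isT isT.
have := @pattern_anti false true true true false false true false isT isT isT isT.
move: lt; clear; lia.
Qed.

End Patterns.
End PairTransversal.

(** * Families met by an edge *)

Section PairStar.
Context {K : choiceType} (adj : rel K).
Hypotheses (adj_sym : symmetric adj) (adj_irr : irreflexive adj).
Implicit Types (X S T : {fset K}) (a b c x y : K).
Local Notation cliques := (cliques adj).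
Local Notation facet_count := (facet_count adj).
Local Notation regular := (regular adj).
Variables (k n : nat) (X : {fset K}).
Hypotheses (k2 : 1 < k) (reg : regular k n.+1 X).
Local Notation facets := (cliques n.+1 X).
Local Notation "# P" := (facet_count n.+1 X P) (at level 10, P at level 8).

(** Members avoiding b contain both a and x, and exchanging x yields as many other facets through
a that avoid b. *)
Lemma common_half (F : pred {fset K}) a b x : adj x a -> adj x b ->
  {in facets, forall S, F S -> (a \in S) || (b \in S)} ->
  {in facets, forall S, F S -> b \notin S -> x \in S} ->
  2 * #(fun S => F S && (b \notin S)) <= #(fun S => (a \in S) && (b \notin S)).
Proof.
move=> xa xb Fab Fx.
have sw : #(fun S => (x \in S) && ((a \in S) && (b \notin S))) <=
          #(fun S => (x \notin S) && ((a \in S) && (b \notin S))).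
  by apply: (swap_le adj_sym adj_irr k2 reg) => S S' _ _ _ _ e; rewrite !e.
have e1 : #(fun S => F S && (b \notin S)) <=
          #(fun S => (x \in S) && ((a \in S) && (b \notin S))).
  apply: leq_facet_count => S SF /andP[FS bS]; rewrite bS (Fx S) //=.
  by have := Fab S SF FS; rewrite (negPf bS) orbF => ->.
have : #(fun S => (x \in S) && ((a \in S) && (b \notin S))) +
       #(fun S => (x \notin S) && ((a \in S) && (b \notin S))) <=
       #(fun S => (a \in S) && (b \notin S)) + #(fun _ => false).
  apply: count_add => S _; by do 3!case: (_ \in S).
rewrite [#(fun _ => false)]facet_count_sum big1 //; lia.
Qed.

(** Exchanging x in the members through x and y, and w in those through w and z, yields new
facets through a avoiding b; the two kinds differ in which one of y, z is present. *)
Lemma cycle_half (F : pred {fset K}) a b x y z w :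
  adj x a -> adj x b -> adj x y -> adj x z ->
  adj w a -> adj w b -> adj w y -> adj w z ->
  {in facets, forall S, F S -> b \notin S -> (a \in S) &&
     ([&& x \in S, y \in S & z \notin S] || [&& w \in S, z \in S & y \notin S])} ->
  2 * #(fun S => F S && (b \notin S)) <= #(fun S => (a \in S) && (b \notin S)).
Proof.
move=> xa xb xy xz wa wb wy wz FA.
pose P S := [&& a \in S, b \notin S, y \in S & z \notin S].
pose Q S := [&& a \in S, b \notin S, z \in S & y \notin S].
have sx : #(fun S => (x \in S) && P S) <= #(fun S => (x \notin S) && P S).
  by apply: (swap_le adj_sym adj_irr k2 reg) => S S' _ _ _ _ e; rewrite /P !e.
have sw : #(fun S => (w \in S) && Q S) <= #(fun S => (w \notin S) && Q S).
  by apply: (swap_le adj_sym adj_irr k2 reg) => S S' _ _ _ _ e; rewrite /Q !e.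
have : #(fun S => F S && (b \notin S)) + #(fun _ => false) <=
       #(fun S => (x \in S) && P S) + #(fun S => (w \in S) && Q S).
  apply: count_add => S SF; rewrite addn0; case: (boolP (F S && _)) => // /andP[FS bS].
  move: (FA S SF FS bS); rewrite /P /Q (negPf bS) /=.
  by do 5!case: (_ \in S).
have : (#(fun S => (x \in S) && P S) + #(fun S => (w \in S) && Q S)) +
       (#(fun S => (x \notin S) && P S) + #(fun S => (w \notin S) && Q S)) <=
       #(fun S => (a \in S) && (b \notin S)).
  rewrite !facet_count_sum -!big_split /=; apply: leq_sum => S _; rewrite /P /Q.
  by do 6!case: (_ \in S).
rewrite [#(fun _ => false)]facet_count_sum big1 //; lia.
Qed.

(** The members containing only one of a, b are at most half of the facets containing only a plus
half of those containing only b, hence at most the larger of these two numbers. *)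
Lemma half_star (F : pred {fset K}) a b :
  {in facets, forall S, F S -> (a \in S) || (b \in S)} ->
  2 * #(fun S => F S && (b \notin S)) <= #(fun S => (a \in S) && (b \notin S)) ->
  2 * #(fun S => F S && (a \notin S)) <= #(fun S => (b \in S) && (a \notin S)) ->
  #F <= #(fun S => a \in S) \/ #F <= #(fun S => b \in S).
Proof.
move=> Fab ha hb.
have h1 : #F <= #(fun S => (a \in S) && (b \in S)) +
  (#(fun S => F S && (b \notin S)) + #(fun S => F S && (a \notin S))).
  rewrite !facet_count_sum -!big_split /= !big_seq; apply: leq_sum => S SF.
  by have := Fab S SF; case: (F S) => [/(_ erefl)|_]; do 2!case: (_ \in S).
have h2 : #(fun S => (a \in S) && (b \in S)) + #(fun S => (a \in S) && (b \notin S)) <=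
          #(fun S => a \in S).
  rewrite !facet_count_sum -!big_split /=; apply: leq_sum => S _.
  by do 2!case: (_ \in S).
have h3 : #(fun S => (a \in S) && (b \in S)) + #(fun S => (b \in S) && (a \notin S)) <=
          #(fun S => b \in S).
  rewrite !facet_count_sum -!big_split /=; apply: leq_sum => S _.
  by do 2!case: (_ \in S).
lia.
Qed.

Section Traces.
Variables (F : pred {fset K}).
Hypothesis Fint : {in facets &, forall S S', F S -> F S' -> S `&` S' != fset0}.

Definition link2 a b u := adj a u && adj b u.

Definition side_of a b S := [&& S \in facets, F S, a \in S & b \notin S].

Lemma link2C a b u : link2 a b u = link2 b a u.
Proof. exact: andbC. Qed.

Definition triangle_free a b := forall x y z, link2 a b x -> link2 a b y -> link2 a b z ->
  adj x y -> adj x z -> adj y z -> False.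

Lemma triangle_freeC a b : triangle_free a b -> triangle_free b a.
Proof. by move=> h x y z; rewrite ![link2 b a _]link2C; apply: h. Qed.

Lemma side_adj a b S x y : side_of a b S -> x \in S -> y \in S -> x != y -> adj x y.
Proof. by case/and4P=> SF _ _ _; apply: (facet_adj SF). Qed.

(** The two members avoid b and a respectively, so a common vertex differs from a and b and is
adjacent to both. *)
Lemma side_cross a b S S' : side_of a b S -> side_of b a S' ->
  exists u, [/\ u \in S, u \in S' & link2 a b u].
Proof.
case/and4P=> SF FS aS bS /and4P[SF' FS' bS' aS'].
have /fset0Pn[u] := Fint SF SF' FS FS'; rewrite in_fsetI => /andP[uS uS'].
exists u; split=> //; apply/andP; split.
  by apply: (facet_adj SF) => //; apply: contraNneq aS' => ->.
by apply: (facet_adj SF') => //; apply: contraNneq bS => ->.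
Qed.

Definition spread a b := forall x y, link2 a b x -> link2 a b y -> adj x y ->
  exists2 S, side_of a b S & ~~ ((x \in S) && (y \in S)).

Definition no_apex a b := forall x, link2 a b x ->
  exists2 S, side_of a b S || side_of b a S & x \notin S.

End Traces.

Section Spread.
Variables (F : pred {fset K}).
Hypothesis Fint : {in facets &, forall S S', F S -> F S' -> S `&` S' != fset0}.
Local Notation side_of := (side_of F).
Local Notation spread := (spread F).
Local Notation no_apex := (no_apex F).

Lemma no_apexC a b : no_apex a b -> no_apex b a.
Proof.
move=> h x; rewrite link2C => /h[S h1 h2]; exists S => //.
by rewrite orbC.
Qed.

(** If u were the only vertex of S in the link of ab, every member of the opposite side would
contain u. A member avoiding u and one separating u from a second vertex y of the link then
produce a triangle u, y, z in the link. *)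
Lemma trace_two a b S u S0 : triangle_free a b -> spread a b -> no_apex a b -> side_of a b S0 ->
  side_of b a S -> u \in S -> link2 a b u ->
  exists2 y, y \in S & (y != u) && link2 a b y.
Proof.
move=> tf sp na A0 BS uS Lu; apply: contrapT => no.
have only v : v \in S -> link2 a b v -> v = u.
  move=> vS Lv; apply/eqP; apply: contra_notT no => vu.
  by exists v => //; rewrite vu.
have Au A : side_of a b A -> u \in A.
  by move=> hA; have [v [vA vS Lv]] := side_cross Fint hA BS; rewrite -(only v).
have [B] := na u Lu; case/orP=> [/Au -> //|hB uB].
have [y [yA yB Ly]] := side_cross Fint A0 hB.
have uy : u != y by apply: contraNneq uB => ->.
have auy := side_adj A0 (Au _ A0) yA uy.
have [A1 hA1] := sp u y Lu Ly auy; rewrite Au //= => yA1.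
have [z [zA zB Lz]] := side_cross Fint hA1 hB.
have yz : y != z by apply: contraNneq yA1 => ->.
have uz : u != z by apply: contraNneq uB => ->.
exact: (tf u y z) auy (side_adj hA1 (Au _ hA1) zA uz) (side_adj hB yB zB yz).
Qed.

Lemma trace_le2 a b S x y z : triangle_free a b -> side_of a b S ->
  x \in S -> y \in S -> z \in S -> link2 a b x -> link2 a b y -> link2 a b z ->
  x != y -> z = x \/ z = y.
Proof.
move=> tf hS xS yS zS Lx Ly Lz xy.
have [->|zx] := eqVneq z x; first by left.
have [->|zy] := eqVneq z y; first by right.
by case: (tf x y z) => //; apply: (side_adj hS); rewrite // eq_sym.
Qed.

(** Traces on one side are edges of the link of ab, which has no triangles. If two of them shared
exactly one vertex y, every member of the opposite side would contain y, and the hypotheses would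
again produce a triangle. *)
Lemma trace_disjoint a b S S' B0 x y :
  triangle_free a b -> spread b a -> no_apex a b -> side_of b a B0 -> spread a b ->
  side_of a b S -> side_of a b S' -> x \in S -> y \in S -> link2 a b x -> link2 a b y ->
  x != y -> y \in S' -> x \in S'.
Proof.
move=> tf spb na hB0 spa hS hS' xS yS Lx Ly xy yS'.
apply: contraT => xS'.
have tfC := triangle_freeC tf.
have [z zS' /andP[zy Lz]] := trace_two tfC spb (no_apexC na) hB0 hS' yS' (etrans (link2C _ _ _) Ly).
rewrite link2C in Lz.
have ayx := side_adj hS xS yS xy.
have Bb B : side_of b a B -> y \in B.
  move=> hB; apply: contraT => yB.
  have [u [uS uB Lu]] := side_cross Fint hS hB.
  have [v [vS vB Lv]] := side_cross Fint hS' hB.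
  have {uS Lu}xB : x \in B.
    by case: (trace_le2 tf hS xS yS uS Lx Ly Lu xy) => e; rewrite e in uB; rewrite // uB in yB.
  have {vS Lv}zB : z \in B.
    by case: (trace_le2 tf hS' zS' yS' vS Lz Ly Lv zy) => e; rewrite e in vB; rewrite // vB in yB.
  have xz : x != z by apply: contraNneq xS' => ->.
  case: (tf x y z Lx Ly Lz ayx); first exact: side_adj hB xB zB xz.
  by rewrite adj_sym; apply: (side_adj hS').
have [A2] := na y Ly; case/orP=> [hA2 yA2|/Bb -> //].
have nyA u : u \in A2 -> y != u by move=> uA; apply: contraNneq yA2 => ->.
have [u [uA uB Lu]] := side_cross Fint hA2 hB0.
have yB0 := Bb _ hB0.
have ayu := side_adj hB0 yB0 uB (nyA _ uA).
have [B1 hB1] := spb y u (etrans (link2C _ _ _) Ly) (etrans (link2C _ _ _) Lu) ayu.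
rewrite Bb //= => uB1.
have [v [vA vB Lv]] := side_cross Fint hA2 hB1.
have uv : u != v by apply: contraNneq uB1 => ->.
case: (tf y u v Ly Lu Lv ayu); first exact: side_adj hB1 (Bb _ hB1) vB (nyA _ vA).
exact: (side_adj hA2).
Qed.

(** Let ab be an edge meeting all members. The members avoiding b and those avoiding a have
cross-intersecting traces on the link of ab, which has no triangle. If there are members of both
kinds, either all traces share a vertex, or the traces of one side share an edge, or both sides
have exactly two disjoint edges, forming a four-cycle. The first and the last configuration allow
exchanges that double both sides ([half_star]); the middle one is [upset_star]. *)
Theorem pair_star a b : adj a b -> triangle_free a b ->
  {in facets, forall S, F S -> (a \in S) || (b \in S)} ->
  exists v, #F <= #(fun S => v \in S).
Proof.
move=> ab tf Fab; have ba : adj b a by rewrite adj_sym.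
have Fba : {in facets, forall S, F S -> (b \in S) || (a \in S)}.
  by move=> S SF FS; rewrite orbC Fab.
have tfC := triangle_freeC tf.
have sideE c d S : {in facets, forall S, F S -> (c \in S) || (d \in S)} ->
    S \in facets -> F S -> d \notin S -> side_of c d S.
  move=> h SF FS dS; have := h S SF FS; rewrite (negPf dS) orbF => cS.
  by apply/and4P; split; rewrite ?cS.
(* The case in which all members of one side contain a common edge xy of the link. *)
have edge c d x y S0 : adj c d -> triangle_free c d ->
    {in facets, forall S, F S -> (c \in S) || (d \in S)} ->
    link2 c d x -> link2 c d y -> adj x y -> side_of d c S0 ->
    (forall S, side_of d c S -> (x \in S) && (y \in S)) ->
    exists v, #F <= #(fun S => v \in S).
  move=> cd tfcd Fcd Lx Ly xy hS0 all_xy.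
  have [h|h] : #F <= #(fun S => c \in S) \/ #F <= #(fun S => x \in S).
  - apply: (upset_star adj_sym adj_irr k2 reg (b := d) (y := y)).
    + by case/andP: Lx Ly => -> -> /andP[-> ->]; rewrite cd xy.
    + exact: Fcd.
    + move=> S SF FS cS; apply: all_xy; apply: sideE => //.
      by move=> S' SF' FS'; rewrite orbC Fcd.
    + move=> S SF FS dS; have hS := sideE _ _ _ Fcd SF FS dS.
      have [u [uS uS0 Lu]] := side_cross Fint hS hS0.
      have /andP[xS0 yS0] := all_xy _ hS0.
      have nxy : x != y by apply: contraTneq xy => ->; rewrite adj_irr.
      have Lr v : link2 c d v -> link2 d c v by rewrite link2C.
      have [<-|<-] := trace_le2 (triangle_freeC tfcd) hS0 xS0 yS0 uS0 (Lr _ Lx) (Lr _ Ly)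
        (Lr _ Lu) nxy; by rewrite uS ?orbT.
  - by exists c.
  - by exists x.
have [[A0 hA0]|noA] := EM (exists S, side_of a b S); last first.
  exists b; apply: leq_facet_count => S SF FS; apply: contraT => bS.
  by case: noA; exists S; apply: sideE.
have [[B0 hB0]|noB] := EM (exists S, side_of b a S); last first.
  exists a; apply: leq_facet_count => S SF FS; apply: contraT => aS.
  by case: noB; exists S; apply: sideE.
have [spa|] := EM (spread a b); last first.
  move/existsNP => [x /existsNP[y /not_implyP[Lx /not_implyP[Ly /not_implyP[xy h]]]]].
  apply: (edge b a x y A0); rewrite ?[link2 b a _]link2C // => S hS.
  by apply: contraT => nS; case: h; exists S.
have [spb|] := EM (spread b a); last first.
  move/existsNP => [x /existsNP[y /not_implyP[Lx /not_implyP[Ly /not_implyP[xy h]]]]].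
  rewrite ![link2 b a _]link2C in Lx Ly.
  apply: (edge a b x y B0) => // S hS.
  by apply: contraT => nS; case: h; exists S.
suff [ha hb] : 2 * #(fun S => F S && (b \notin S)) <= #(fun S => (a \in S) && (b \notin S)) /\
       2 * #(fun S => F S && (a \notin S)) <= #(fun S => (b \in S) && (a \notin S)).
  by case: (half_star Fab ha hb) => h; [exists a | exists b].
(* From here on, no edge of the link is common to a whole side. *)
have [na|] := EM (no_apex a b); last first.
  move/existsNP => [x /not_implyP[Lx h]].
  have hx S : side_of a b S || side_of b a S -> x \in S.
    by move=> hS; apply: contraT => xS; case: h; exists S.
  case/andP: Lx; rewrite ![adj _ x]adj_sym => xa xb.
  split; [apply: (common_half xa xb) => // | apply: (common_half xb xa) => //].
    by move=> S SF FS bS; apply: hx; rewrite sideE.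
  by move=> S SF FS aS; apply: hx; rewrite (sideE b a) ?orbT.
(* What is left: the traces are xy, zw on one side and xz, yw on the other, so that x, w are both
   adjacent to y, z and every trace holds exactly one of x, w. *)
have naC := no_apexC na.
have Lr v : link2 a b v -> link2 b a v by rewrite link2C.
have [x [xA xB Lx]] := side_cross Fint hA0 hB0.
have [y yA /andP[yx Ly]] := trace_two tfC spb naC hB0 hA0 xA (Lr _ Lx).
rewrite link2C in Ly.
have [z zB /andP[zx Lz]] := trace_two tf spa na hA0 hB0 xB Lx.
have xy := side_adj hA0 xA yA; rewrite eq_sym yx in xy; have {}xy := xy erefl.
have xz := side_adj hB0 xB zB; rewrite eq_sym zx in xz; have {}xz := xz erefl.
have [A1 hA1] := spa x y Lx Ly xy => nA1.
have disjA S S' u v : side_of a b S -> side_of a b S' -> u \in S -> v \in S ->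
    link2 a b u -> link2 a b v -> u != v -> v \in S' -> u \in S'.
  exact: (trace_disjoint tf spb na hB0 spa).
have disjB S S' u v : side_of b a S -> side_of b a S' -> u \in S -> v \in S ->
    link2 a b u -> link2 a b v -> u != v -> v \in S' -> u \in S'.
  move=> h1 h2 h3 h4 /Lr Lu /Lr Lv; exact: (trace_disjoint tfC spa naC hA0 spb h1 h2 h3 h4 Lu Lv).
have nxy : x != y by rewrite eq_sym.
have nxz : x != z by rewrite eq_sym.
have xA1 : x \notin A1.
  by apply: contra nA1 => xA1; rewrite xA1; apply: (disjA A0 A1 y x).
have yA1 : y \notin A1.
  by apply: contra nA1 => yA1; rewrite yA1 andbT; apply: (disjA A0 A1 x y).
have zA1 : z \in A1.
  have [u [uA uB Lu]] := side_cross Fint hA1 hB0.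
  have [e|e] := trace_le2 tfC hB0 xB zB uB (Lr _ Lx) (Lr _ Lz) (Lr _ Lu) nxz; last by rewrite -e.
  by rewrite e (negPf xA1) in uA.
have [B1 hB1 nB1] := spb x z (Lr _ Lx) (Lr _ Lz) xz.
have xB1 : x \notin B1.
  by apply: contra nB1 => xB1; rewrite xB1; apply: (disjB B0 B1 z x).
have zB1 : z \notin B1.
  by apply: contra nB1 => zB1; rewrite zB1 andbT; apply: (disjB B0 B1 x z).
have yB1 : y \in B1.
  have [u [uA uB Lu]] := side_cross Fint hA0 hB1.
  have [e|e] := trace_le2 tf hA0 xA yA uA Lx Ly Lu nxy; last by rewrite -e.
  by rewrite e (negPf xB1) in uB.
have [w [wA wB Lw]] := side_cross Fint hA1 hB1.
have wy : w != y by apply: contraNneq yA1 => <-.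
have wz : w != z by apply: contraNneq zB1 => <-.
have awz := side_adj hA1 wA zA1 wz.
have awy := side_adj hB1 wB yB1 wy.
have nyz : y != z by apply: contraNneq yA1 => ->.
have not_yz S c d : side_of c d S -> ~~ ((y \in S) && (z \in S)).
  move=> hS; apply/negP => /andP[yS zS].
  exact: (tf x y z) xy xz (side_adj hS yS zS nyz).
move: (Lx) (Lw); rewrite /link2 ![adj _ x]adj_sym ![adj _ w]adj_sym => /andP[xa xb] /andP[wa wb].
split.
  apply: (cycle_half xa xb xy xz wa wb awy awz) => S SF FS bS.
  have hS := sideE _ _ _ Fab SF FS bS; have /and4P[_ _ -> _] := hS.
  have [u [uS uB Lu]] := side_cross Fint hS hB0; have := not_yz _ _ _ hS.
  have [e|e] := trace_le2 tfC hB0 xB zB uB (Lr _ Lx) (Lr _ Lz) (Lr _ Lu) nxz; rewrite {}e in uS.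
    by rewrite uS (disjA A0 S y x) //= => /negPf->.
  by rewrite uS (disjA A1 S w z) //= andbT => ->; rewrite orbT.
apply: (cycle_half xb xa xz xy wb wa awz awy) => S SF FS aS.
have hS := sideE _ _ _ Fba SF FS aS; have /and4P[_ _ -> _] := hS.
have [u [uA uS Lu]] := side_cross Fint hA0 hS; have := not_yz _ _ _ hS.
have [e|e] := trace_le2 tf hA0 xA yA uA Lx Ly Lu nxy; rewrite {}e in uS.
  by rewrite uS (disjB B0 S z x) //= andbT => /negPf->.
by rewrite uS (disjB B1 S w y) //= => ->; rewrite orbT.
Qed.

End Spread.
End PairStar.

(** * Branching *)

Section Spanning.
Context {K : choiceType} (adj : rel K).
Hypotheses (adj_sym : symmetric adj) (adj_irr : irreflexive adj).
Implicit Types (X S T : {fset K}) (a b c x y : K) (s : seq K).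
Variables (k n : nat) (X : {fset K}).
Hypothesis reg : regular adj k n X.
Hypothesis adjX : forall x y, adj x y -> x \in X.
Local Notation facets := (cliques adj n X).
Local Notation "# P" := (facet_count adj n X P) (at level 10, P at level 8).

Lemma pairwise_uniq_adj s : pairwise adj s -> uniq s.
Proof.
rewrite uniq_pairwise; apply: sub_pairwise => x y /= xy.
by apply: contraTneq xy => ->; rewrite adj_irr.
Qed.

Lemma pairwise_clique s : pairwise adj s -> clique adj [fset x in s].
Proof.
move=> ps; apply/cliqueP => x y; rewrite !in_fset /= => xs ys nxy.
have [i [j [si sj ex ey]]] : exists i j, [/\ i < size s, j < size s, x = nth x s i & y = nth x s j].
  by exists (index x s), (index y s); rewrite !index_mem !nth_index.
have nij : i != j by apply: contraNneq nxy => e; rewrite ex ey e.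
rewrite ex ey; have /pairwiseP h := ps.
case: (ltngtP i j) nij => // ij _; first exact: h.
by rewrite adj_sym; apply: h.
Qed.

Lemma pairwise_sub s : pairwise adj s -> 1 < size s -> [fset x in s] `<=` X.
Proof.
move=> ps s1; apply/fsubsetP => x; rewrite in_fset /= => xs.
suff [y ys xy] : exists2 y, y \in s & x != y.
  by apply: (adjX (y := y)); move/cliqueP: (pairwise_clique ps); apply; rewrite ?in_fset.
have us := pairwise_uniq_adj ps.
case: s s1 us xs {ps} => [|u [|v s]] //= _ /andP[]; rewrite in_cons negb_or => /andP[uv _] _ _.
have [->|xu] := eqVneq x u; first by exists v; rewrite ?in_cons ?eqxx ?orbT.
by exists u; rewrite ?mem_head.
Qed.

(** Lists of pairwise adjacent vertices serve as explicit small cliques. *)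
Lemma pairwise_size s : pairwise adj s -> 1 < size s -> size s <= n.
Proof.
move=> ps s1; have := clique_size reg (pairwise_sub ps s1) (pairwise_clique ps).
by rewrite card_fseq undup_id ?pairwise_uniq_adj.
Qed.

Lemma pairwise_cliques s : pairwise adj s -> 1 < size s ->
  [fset x in s] \in cliques adj (size s) X.
Proof.
move=> ps s1; rewrite in_cliques pairwise_sub // pairwise_clique // card_fseq.
by rewrite undup_id ?pairwise_uniq_adj //= eqxx.
Qed.

Lemma count_nonadj x y (P : pred {fset K}) : x != y -> ~~ adj x y ->
  (forall S, P S -> (x \in S) && (y \in S)) -> #P = 0.
Proof.
move=> xy nxy h; rewrite facet_count_sum big1_seq // => S /= SF.
case: (boolP (P S)) => // /h /andP[xS yS].
by rewrite (facet_adj SF xS yS xy) in nxy.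
Qed.

End Spanning.

Section Intersecting.
Context {K : choiceType} (adj : rel K).
Hypotheses (adj_sym : symmetric adj) (adj_irr : irreflexive adj).
Implicit Types (X S T : {fset K}) (a b c x y : K) (s : seq K).
Variables (k n : nat) (X : {fset K}).
Hypothesis reg : regular adj k n.+1 X.
Hypothesis adjX : forall x y, adj x y -> x \in X.
Local Notation facets := (cliques adj n.+1 X).
Local Notation "# P" := (facet_count adj n.+1 X P) (at level 10, P at level 8).

Variable (F : pred {fset K}).
Hypothesis FF : forall S, F S -> S \in facets.
Hypothesis Fint : forall S S', F S -> F S' -> exists2 x, x \in S & x \in S'.
Hypothesis no_pair : forall a b, adj a b -> exists S, [/\ F S, a \notin S & b \notin S].

Definition deg T := #(fun S => F S && (T `<=` S)).

Lemma degE T : deg T = \sum_(S <- facets) (F S && (T `<=` S)).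
Proof. exact: facet_count_sum. Qed.

(** Every member through T meets S0, in a vertex adjacent to all of T. These vertices of S0 form
a clique together with T, so that there are at most q of them. *)
Lemma deg_branch T S0 m q : n.+1 = #|` T| + q -> T `<=` X -> clique adj T ->
  F S0 -> [disjoint S0 & T]%fset ->
  {in S0 `&` common adj X T, forall x, deg (x |` T) <= m} ->
  deg T <= q * m.
Proof.
move=> eq_q TX cT FS0 dis bound.
have [S0X cS0 _] := facetP (FF FS0).
set U := S0 `&` common adj X T.
have sU : #|` U| + #|` T| <= n.+1.
  have dUT : U `&` T = fset0.
    apply/eqP; rewrite -[_ == _]/(fdisjoint U T); apply: fdisjointWl dis.
    exact: fsubsetIl.
  have cUT : clique adj (U `|` T).
    apply/cliqueP => x y; rewrite !in_fsetU.
    have UT u v : u \in U -> v \in T -> adj u v.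
      by rewrite in_fsetI in_common => /and3P[_ _ /allP]; apply.
    have inS0 := fsubsetP (fsubsetIl S0 (common adj X T)).
    case/orP=> hx /orP[] hy nxy.
    - by move/cliqueP: cS0; apply; rewrite ?inS0.
    - exact: UT.
    - by rewrite adj_sym UT.
    - by move/cliqueP: cT; apply.
  have := clique_size reg _ cUT; rewrite fsubUset TX (fsubset_trans (fsubsetIl _ _) S0X).
  by move=> /(_ erefl); rewrite cardfsU dUT cardfs0 subn0.
apply: leq_trans (_ : \sum_(x <- U) deg (x |` T) <= _).
  rewrite /deg facet_count_sum.
  rewrite (eq_bigr (fun x => \sum_(S <- facets) (F S && (x |` T `<=` S)))); last first.
    by move=> x _; rewrite facet_count_sum.
  rewrite exchange_big /= !big_seq; apply: leq_sum => S SF.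
  case: (boolP (F S && _)) => //= /andP[FS TS].
  have [x xS xS0] := Fint FS FS0.
  have xU : x \in U.
    rewrite in_fsetI xS0 in_common (fsubsetP S0X) //=; apply/allP => y yT.
    apply: (facet_adj SF) => //; first exact: (fsubsetP TS).
    by apply: contraTneq yT => <-; apply: (fdisjointP dis).
  by rewrite (big_fsetD1 x) //= FS fsubUset fsub1set xS TS.
apply: leq_trans (_ : \sum_(x <- U) m <= _).
  by rewrite !big_seq; apply: leq_sum => x /bound.
rewrite big_const_seq count_predT iter_addn_0 mulnC leq_mul2r; apply/orP; right.
by move: sU; rewrite eq_q addnC leq_add2l.
Qed.

Lemma deg_facet T : #|` T| = n.+1 -> deg T <= 1.
Proof.
move=> sT; rewrite /deg facet_count_card -(cardfs1 T); apply/fsubset_leq_card/fsubsetP => S.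
rewrite in_sep in_fset1 => /and3P[/facetP[_ _ sS] _ TS].
by rewrite eq_sym eqEfcard TS sS sT leqnn.
Qed.

Lemma deg_notin T : ~~ ((T `<=` X) && clique adj T) -> deg T = 0.
Proof.
move=> h; rewrite /deg facet_count_sum big1_seq // => S /= SF.
case: (boolP (F S && _)) => // /andP[_ TS]; have [SX cS _] := facetP SF.
by rewrite (fsubset_trans TS SX) (sub_clique TS cS) in h.
Qed.

(** A member avoiding a exists, because no edge through a meets all members. *)
Lemma deg1_branch m : 0 < n -> (forall x y, adj x y -> deg [fset x; y] <= m) ->
  forall a, deg [fset a] <= n * m.
Proof.
move=> n0 bound a.
have [aX|] := boolP (a \in X); last first.
  by move=> aX; rewrite deg_notin // fsub1set (negPf aX).
have [_ _ regN] := reg.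
have /fset0Pn[b] : nbr adj X a != fset0.
  by have := regN a aX; case: n n0 => // n1 _ [].
rewrite in_nbr => /andP[bX ab].
have [S [FS aS bS]] := no_pair ab.
have c1 : clique adj [fset a].
  by apply/cliqueP => x y; rewrite !in_fset1 => /eqP-> /eqP->; rewrite eqxx.
apply: (deg_branch (T := [fset a]) _ _ c1 FS).
- by rewrite cardfs1.
- by rewrite fsub1set.
- by rewrite fdisjointX1.
move=> x; rewrite in_fsetI in_common /= => /and3P[_ _ /allP h].
by apply: bound; apply: h; rewrite in_fset1.
Qed.

End Intersecting.

Lemma cube_bound k : 2 < k -> 10 * k - 3 <= k ^ 3.
Proof. by move=> k3; rewrite !expnS expn0 muln1; nia. Qed.

(** * Families met by no edge, in rank three and in rank four *)

Section Branching.
Context {K : choiceType} (adj : rel K).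
Hypotheses (adj_sym : symmetric adj) (adj_irr : irreflexive adj).
Implicit Types (X S T : {fset K}) (a b c x y : K) (s : seq K).
Variables (k n : nat) (X : {fset K}).
Hypotheses (k2 : 1 < k) (reg : regular adj k n.+1 X).
Hypothesis adjX : forall x y, adj x y -> x \in X.
Local Notation facets := (cliques adj n.+1 X).
Local Notation "# P" := (facet_count adj n.+1 X P) (at level 10, P at level 8).

(** The facets through v correspond to those of the link of v, to which [facet_count_ge] applies.
*)
Lemma star_ge v : v \in X -> k ^ n <= #(fun S => v \in S).
Proof.
move=> vX; apply: leq_trans (facet_count_star adj_sym adj_irr reg vX).
by apply: facet_count_ge => //; case: reg => _ _; apply.
Qed.

Variable (F : pred {fset K}).
Hypothesis FF : forall S, F S -> S \in facets.
Hypothesis Fint : forall S S', F S -> F S' -> exists2 x, x \in S & x \in S'.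
Hypothesis no_pair : forall a b, adj a b -> exists S, [/\ F S, a \notin S & b \notin S].
Local Notation deg := (deg adj n X F).

Lemma seq3 (z x y : K) : [fset u in [:: z; x; y]] = z |` [fset x; y].
Proof. by apply/fsetP => u; rewrite in_fset /= !in_fsetU !in_fset1 !inE. Qed.

Lemma seq2 (x y : K) : [fset u in [:: x; y]] = [fset x; y].
Proof. by apply/fsetP => u; rewrite in_fset /= !in_fsetU !in_fset1 !inE. Qed.

Lemma deg_pair_branch m x y : 0 < n -> adj x y ->
  (forall z, adj z x -> adj z y -> deg (z |` [fset x; y]) <= m) ->
  deg [fset x; y] <= n.-1 * m.
Proof.
move=> n0 xy bound; have [S [FS xS yS]] := no_pair xy.
have ps : pairwise adj [:: x; y] by rewrite /= xy.
have /facetP[sX cl sz] := pairwise_cliques adj_sym adj_irr adjX ps erefl.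
rewrite seq2 /= in sX cl sz.
apply: (deg_branch adj_sym reg FF Fint _ sX cl FS); first by rewrite sz -{1}(prednK n0).
  by rewrite fdisjointXU !fdisjointX1 xS yS.
move=> z; rewrite in_fsetI in_common => /and3P[_ _ /allP h].
by apply: bound; apply: h; rewrite !inE eqxx ?orbT.
Qed.

Lemma deg_triple_branch x y z : n = 3 -> pairwise adj [:: x; y; z] ->
  (exists S, [/\ F S, x \notin S, y \notin S & z \notin S]) ->
  deg (x |` [fset y; z]) <= 1.
Proof.
move=> n3 ps [S [FS xS yS zS]].
have /facetP[sX cl sz] := pairwise_cliques adj_sym adj_irr adjX ps erefl.
rewrite seq3 /= in sX cl sz.
rewrite -[1]muln1; apply: (deg_branch adj_sym reg FF Fint _ sX cl FS); first by rewrite sz n3.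
  by rewrite !fdisjointXU !fdisjointX1 xS yS zS.
move=> u; rewrite in_fsetI in_common => /and3P[_ _ /allP h].
apply: deg_facet; rewrite cardfsU1 sz n3 -seq3 in_fset /=.
rewrite (_ : u \in _ = false) //; apply/negP => /= ut.
by have := h u; rewrite -seq3 in_fset adj_irr => /(_ ut).
Qed.

(** Branching twice shows that a vertex lies in at most two members, so the three vertices of a
member Q account for at most six incidences with members. Every member is incident with Q, and Q
itself is counted three times. *)
Lemma rank3_bound : n = 2 -> #F <= 4.
Proof.
move=> n2.
have pair1 x y : adj x y -> deg [fset x; y] <= 1.
  move=> xy; have n0 : 0 < n by rewrite n2.
  apply: leq_trans (deg_pair_branch (m := 1) n0 xy _) _ => [z zx zy|]; last by rewrite n2.
  apply: deg_facet; rewrite n2.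
  have ps : pairwise adj [:: z; x; y] by rewrite /= zx zy xy.
  by have /facetP[_ _] := pairwise_cliques adj_sym adj_irr adjX ps erefl; rewrite seq3.
have single a : deg [fset a] <= 2.
  have := deg1_branch adj_sym reg FF Fint no_pair _ pair1 a.
  by rewrite n2 muln1; apply.
have [[Q FQ]|noF] := EM (exists Q, F Q); last first.
  rewrite facet_count_sum big1_seq // => S _; case: (boolP (F S)) => // FS.
  by case: noF; exists S.
have QF := FF FQ; have [QX cQ sQ] := facetP QF.
suff : #F + 2 <= \sum_(a <- Q) deg [fset a].
  move=> h; rewrite -(leq_add2r 2); apply: leq_trans h _.
  apply: leq_trans (_ : \sum_(a <- Q) 2 <= _); first by apply: leq_sum => a _; apply: single.
  by rewrite big_const_seq count_predT iter_addn_0 sQ n2.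
have -> : #F + 2 = \sum_(S <- facets) (F S + 2 * (S == Q)).
  rewrite big_split /= -facet_count_sum -big_distrr /= (big_fsetD1 Q) //= eqxx.
  rewrite big1_seq // => S /= /fsetD1P[/negPf-> _] //.
rewrite (eq_bigr (fun a => \sum_(S <- facets) (F S && ([fset a] `<=` S)))); last first.
  by move=> x _; rewrite degE.
rewrite exchange_big /= !big_seq; apply: leq_sum => S SF.
have [->|nSQ] := eqVneq S Q.
  rewrite FQ (eq_big_seq (fun _ => 1)) => [|a aQ]; last by rewrite fsub1set aQ.
  by rewrite sum1_size sQ n2.
case: (boolP (F S)) => //= FS; have [a aS aQ] := Fint FS FQ.
by rewrite (big_fsetD1 a) //= fsub1set aS.
Qed.

Section Rank4.
Hypothesis n3 : n = 3.

Lemma pairwise_le4 s : pairwise adj s -> size s <= 4.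
Proof.
move=> ps; case: (leqP (size s) 1) => [/leq_trans|s1]; first by apply.
by have := pairwise_size adj_sym adj_irr reg adjX ps s1; rewrite n3.
Qed.

(** The rank is four. *)
Lemma no_five a b c d e : pairwise adj [:: a; b; c; d; e] -> False.
Proof. by move/pairwise_le4. Qed.

Lemma count_triple x y z : pairwise adj [:: x; y; z] ->
  #(fun S => [&& x \in S, y \in S & z \in S]) = k.
Proof.
move=> ps; have := pairwise_cliques adj_sym adj_irr adjX ps erefl => /= TF.
have TF' : [fset u in [:: x; y; z]] \in cliques adj n X by rewrite n3.
rewrite -(facet_degree adj_sym adj_irr reg TF'); apply: eq_count => S.
by rewrite seq3 !fsubUset !fsub1set.
Qed.

Lemma count_triple_le x y z : uniq [:: x; y; z] ->
  #(fun S => [&& x \in S, y \in S & z \in S]) <= k.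
Proof.
rewrite /= !inE !andbT negb_or => /andP[/andP[xy xz] yz].
have [axy|naxy] := boolP (adj x y); last first.
  by rewrite (count_nonadj _ _ xy naxy) // => S /and3P[-> ->].
have [axz|naxz] := boolP (adj x z); last first.
  by rewrite (count_nonadj _ _ xz naxz) // => S /and3P[-> _ ->].
have [ayz|nayz] := boolP (adj y z); last first.
  by rewrite (count_nonadj _ _ yz nayz) // => S /and3P[_ -> ->].
by rewrite count_triple //= axy axz ayz.
Qed.

Lemma count_quad x y z u : pairwise adj [:: x; y; z; u] ->
  0 < #(fun S => [&& x \in S, y \in S, z \in S & u \in S]).
Proof.
move=> ps; have TF := pairwise_cliques adj_sym adj_irr adjX ps erefl.
rewrite /= in TF; have TF' : [fset u in [:: x; y; z; u]] \in facets by rewrite n3.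
rewrite -has_count; apply/hasP; exists [fset u in [:: x; y; z; u]] => //.
by rewrite !in_fset /= !inE !eqxx ?orbT.
Qed.

(** A member avoiding x and y meets every member through x and y in a common neighbour of x and
y. It has at most two such vertices u and v, there being no five-clique, and xyu and xyv lie in k
facets each, of which xyuv is common. *)
Lemma deg2_bound x y : adj x y -> #(fun S => [&& F S, x \in S & y \in S]) <= 2 * k - 1.
Proof.
move=> xy; have [S0 [FS0 xS0 yS0]] := no_pair xy; have S0F := FF FS0.
pose good u := [&& u \in S0, adj x u & adj y u].
have hit S : S \in facets -> F S -> x \in S -> y \in S -> exists2 u, u \in S & good u.
  move=> SF FS xS yS; have [u uS uS0] := Fint FS FS0; exists u => //.
  rewrite /good uS0 !(facet_adj SF) //.
    by apply: contraNneq yS0 => ->.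
  by apply: contraNneq xS0 => ->.
have [[u gu]|nog] := EM (exists u, good u); last first.
  rewrite facet_count_sum big1_seq // => S /= SF.
  case: (boolP [&& _, _ & _]) => // /and3P[FS xS yS].
  by have [u _ gu] := hit S SF FS xS yS; case: nog; exists u.
have /and3P[uS0 xu yu] := gu.
have tri_u : pairwise adj [:: x; y; u] by rewrite /= xy xu yu.
have ck := count_triple tri_u.
have [[v [gv uv]]|onlyu] := EM (exists v, good v /\ u != v); last first.
  apply: leq_trans (_ : k <= _); last by move: k2; clear; lia.
  rewrite -ck; apply: leq_facet_count => S SF /and3P[FS xS yS].
  have [v vS gv] := hit S SF FS xS yS; rewrite xS yS /=.
  by have [->|uv] := eqVneq u v => //; case: onlyu; exists v.
have /and3P[vS0 xv yv] := gv.
have auv := facet_adj S0F uS0 vS0 uv.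
have tri_v : pairwise adj [:: x; y; v] by rewrite /= xy xv yv.
have cv := count_triple tri_v.
have quad : pairwise adj [:: x; y; u; v] by rewrite /= xy xu yu xv yv auv.
have c4 := count_quad quad.
suff : #(fun S => [&& F S, x \in S & y \in S]) +
       #(fun S => [&& x \in S, y \in S, u \in S & v \in S]) <=
       #(fun S => [&& x \in S, y \in S & u \in S]) + #(fun S => [&& x \in S, y \in S & v \in S]).
  by rewrite ck cv; move: c4; clear; lia.
apply: count_add => S SF.
case: (boolP (x \in S)) => xS; last by rewrite !andbF.
case: (boolP (y \in S)) => yS; last by rewrite !andbF.
case: (boolP (F S)) => FS /=; last by do 2!case: (_ \in S).
have [w wS gw] := hit S SF FS xS yS.
have : (u \in S) || (v \in S).
  have [->|uw] := eqVneq u w; first by rewrite wS.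
  have [->|vw] := eqVneq v w; first by rewrite wS orbT.
  case/and3P: gw => wS0 xw yw.
  case: (@no_five x y u v w).
  by rewrite /= xy xu yu xv yv xw yw auv (facet_adj S0F uS0 wS0 uw) (facet_adj S0F vS0 wS0 vw).
by do 2!case: (_ \in S).
Qed.

(** Repeated branching: four vertices of a first member, then three, two and one, as no clique
with fewer than four vertices meets all members. *)
Lemma no_triple_bound :
  (forall x y z, pairwise adj [:: x; y; z] ->
     exists S, [/\ F S, x \notin S, y \notin S & z \notin S]) -> #F <= 24.
Proof.
move=> no3.
have tri x y z : pairwise adj [:: x; y; z] -> deg (x |` [fset y; z]) <= 1.
  by move=> ps; apply: deg_triple_branch => //; apply: no3.
have pair x y : adj x y -> deg [fset x; y] <= 2.
  move=> xy; have n0 : 0 < n by rewrite n3.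
  apply: leq_trans (deg_pair_branch (m := 1) n0 xy _) _ => [z zx zy|]; last by rewrite n3.
  by apply: tri; rewrite /= zx zy xy.
have single a : deg [fset a] <= 6.
  by have := deg1_branch adj_sym reg FF Fint no_pair _ pair a; rewrite n3; apply.
have [[Q FQ]|noF] := EM (exists Q, F Q); last first.
  rewrite facet_count_sum big1_seq // => S _; case: (boolP (F S)) => // FS.
  by case: noF; exists S.
have -> : #F = deg fset0.
  by apply: eq_count => S; rewrite fsub0set andbT.
apply: (deg_branch (q := 4) (m := 6) adj_sym reg FF Fint _ (fsub0set X) (clique0 adj) FQ).
- by rewrite cardfs0 n3.
- exact: fdisjointX0.
- by move=> x _; rewrite fsetU0.
Qed.

(** Suppose that S is a member whose trace on abc is bc. The members of trace a all meet S in a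
common neighbour of a, b, c, which is unique as there are no five-cliques, and [deg2_bound]
applies. Likewise the members of trace bc share a vertex u, and one of the k facets through bcu
contains a. If there is no such S, only members of trace a are counted. They meet a member B
avoiding a, c in one of at most two vertices p, p', and a member C avoiding a, b in one of at
most two vertices q, q'. In every case they all contain one vertex besides a, or else a certain
pair of other vertices. *)
Lemma transversal_part a b c : pairwise adj [:: a; b; c] ->
  (forall S, F S -> [|| a \in S, b \in S | c \in S]) ->
  #(fun S => [&& F S, b \in S, c \in S & a \notin S]) +
  #(fun S => [&& F S, a \in S, b \notin S & c \notin S]) <= 3 * k - 1.
Proof.
move=> /= /and3P[/and3P[ab ac _] /andP[bc _] _] trans.
have ba : adj b a by rewrite adj_sym. have ca : adj c a by rewrite adj_sym.
have cb : adj c b by rewrite adj_sym.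
have [[S [FS bS cS aS]]|none] := EM (exists S, [/\ F S, b \in S, c \in S & a \notin S]).
  have SF := FF FS.
  have le1 : #(fun S => [&& F S, a \in S, b \notin S & c \notin S]) <= 2 * k - 1.
    have hit A : A \in facets -> F A -> a \in A -> b \notin A -> c \notin A ->
        exists u, [/\ u \in A, u \in S, adj a u, adj b u & adj c u].
      move=> AF FA aA bA cA; have [u uA uS] := Fint FA FS; exists u; split=> //.
      - by apply: (facet_adj AF) => //; apply: contraNneq aS => ->.
      - by apply: (facet_adj SF) => //; apply: contraNneq bA => ->.
      - by apply: (facet_adj SF) => //; apply: contraNneq cA => ->.
    have [[A [AF FA aA bA cA]]|noA] :=
      EM (exists A, [/\ A \in facets, F A, a \in A, b \notin A & c \notin A]); last first.
      rewrite facet_count_sum big1_seq // => A /= AF.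
      by case: (boolP [&& _, _, _ & _]) => // /and4P[FA aA bA cA]; case: noA; exists A.
    have [u [uA uS au bu cu]] := hit A AF FA aA bA cA.
    apply: leq_trans (deg2_bound au); apply: leq_facet_count => B BF /and4P[FB aB bB cB].
    have [v [vB vS av bv cv]] := hit B BF FB aB bB cB; rewrite FB aB /=.
    have [->|uv] := eqVneq u v => //.
    case: (@no_five a b c u v).
    by rewrite /= ab ac bc au bu cu av bv cv (facet_adj SF uS vS uv).
  have le2 : #(fun S => [&& F S, b \in S, c \in S & a \notin S]) <= k - 1.
    have [S' [FS' bS' cS']] := no_pair bc; have S'F := FF FS'.
    have aS' : a \in S' by have := trans _ FS'; rewrite (negPf bS') (negPf cS') !orbF.
    have hit A : A \in facets -> F A -> b \in A -> c \in A -> a \notin A ->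
        exists u, [/\ u \in A, u \in S', adj a u, adj b u & adj c u].
      move=> AF FA bA cA aA; have [u uA uS] := Fint FA FS'; exists u; split=> //.
      - by apply: (facet_adj S'F) => //; apply: contraNneq aA => ->.
      - by apply: (facet_adj AF) => //; apply: contraNneq bS' => ->.
      - by apply: (facet_adj AF) => //; apply: contraNneq cS' => ->.
    have [u [uS uS' au bu cu]] := hit S SF FS bS cS aS.
    have t3 : pairwise adj [:: b; c; u] by rewrite /= bc bu cu.
    have t4 : pairwise adj [:: b; c; u; a] by rewrite /= bc bu cu ba ca adj_sym au.
    have := count_triple t3; have := count_quad t4.
    suff : #(fun S => [&& F S, b \in S, c \in S & a \notin S]) +
           #(fun S => [&& b \in S, c \in S, u \in S & a \in S]) <=
           #(fun S => [&& b \in S, c \in S & u \in S]) + #(fun _ => false).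
      rewrite [#(fun _ => false)]facet_count_sum big1 // => + h1 h2.
      by rewrite h2; move: h1; clear; lia.
    apply: count_add => A AF.
    case: (boolP (b \in A)) => bA; last by rewrite !andbF.
    case: (boolP (c \in A)) => cA; last by rewrite !andbF.
    case: (boolP (a \in A)) => aA; first by rewrite !andbF andbT /=; case: (u \in A).
    rewrite !andbF; case: (boolP (F A)) => FA //=.
    have [v [vB vS av bv cv]] := hit A AF FA bA cA aA.
    have [->|uv] := eqVneq u v => //; first by rewrite vB.
    case: (@no_five a b c u v).
    by rewrite /= ab ac bc au bu cu av bv cv (facet_adj S'F uS' vS uv).
  by move: k2 le2 le1; clear; lia.
rewrite [X in X + _](_ : _ = 0) ?add0n; last first.
  rewrite facet_count_sum big1_seq // => A /= AF.
  by case: (boolP [&& _, _, _ & _]) => // /and4P[FA bA cA aA]; case: none; exists A.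
have [B [FB aB cB]] := no_pair ac; have BF := FF FB.
have bB : b \in B by have := trans _ FB; rewrite (negPf aB) (negPf cB) !orbF.
have [C [FC aC bC]] := no_pair ab; have CF := FF FC.
have cC : c \in C by have := trans _ FC; rewrite (negPf aC) (negPf bC).
pose Pb u := [&& u \in B, adj a u & adj b u].
pose Pc u := [&& u \in C, adj a u & adj c u].
have hit A : A \in facets -> F A -> a \in A -> b \notin A -> c \notin A ->
    (exists2 p, p \in A & Pb p) /\ (exists2 q, q \in A & Pc q).
  move=> AF FA aA bA cA; split.
    have [u uA uB] := Fint FA FB; exists u => //; apply/and3P; split=> //.
      by apply: (facet_adj AF) => //; apply: contraNneq aB => ->.
    by apply: (facet_adj BF) => //; apply: contraNneq bA => ->.
  have [u uA uC] := Fint FA FC; exists u => //; apply/and3P; split=> //.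
    by apply: (facet_adj AF) => //; apply: contraNneq aC => ->.
  by apply: (facet_adj CF) => //; apply: contraNneq cA => ->.
have nab : a != b by apply: contraNneq aB => ->.
have two e B0 p p' p'' : B0 \in facets -> adj a e ->
    [&& p \in B0, adj a p & adj e p] -> [&& p' \in B0, adj a p' & adj e p'] ->
    [&& p'' \in B0, adj a p'' & adj e p''] -> p != p' -> p'' = p \/ p'' = p'.
  move=> B0F ae /and3P[pB ap ep] /and3P[pB' ap' ep'] /and3P[pB'' ap'' ep''] npp.
  have [->|n1] := eqVneq p'' p; first by left.
  have [->|n2] := eqVneq p'' p'; first by right.
  case: (@no_five a e p p' p'').
  rewrite /= ae ap ep ap' ep' ap'' ep'' (facet_adj B0F pB pB') //.
  by rewrite (facet_adj B0F pB pB'') ?(facet_adj B0F pB' pB'') // eq_sym.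
(* Pb and Pc hold for at most two vertices each. *)
have two_b p p' p'' : Pb p -> Pb p' -> Pb p'' -> p != p' -> p'' = p \/ p'' = p'.
  exact: two BF ab.
have two_c p p' p'' : Pc p -> Pc p' -> Pc p'' -> p != p' -> p'' = p \/ p'' = p'.
  exact: two CF ac.
(* Members through p are counted by the edge ap, the others by the triple a, p', q'. *)
have final p p' q' : adj a p -> uniq [:: a; p'; q'] ->
    (forall A, A \in facets -> F A -> a \in A -> b \notin A -> c \notin A ->
       p \in A \/ (p' \in A /\ q' \in A)) ->
    #(fun S => [&& F S, a \in S, b \notin S & c \notin S]) <= 3 * k - 1.
  move=> ap un h; have := deg2_bound ap; have := count_triple_le un.
  suff : #(fun S => [&& F S, a \in S, b \notin S & c \notin S]) + #(fun _ => false) <=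
         #(fun S => [&& F S, a \in S & p \in S]) + #(fun S => [&& a \in S, p' \in S & q' \in S]).
    by rewrite [#(fun _ => false)]facet_count_sum big1 //; move: k2; clear; lia.
  apply: count_add => A AF; case: (boolP [&& _, _, _ & _]) => //= /and4P[FA aA bA cA].
  by rewrite FA aA; have [->|[-> ->]] := h A AF FA aA bA cA; rewrite // addn1.
have single p : adj a p ->
    (forall A, A \in facets -> F A -> a \in A -> b \notin A -> c \notin A -> p \in A) ->
    #(fun S => [&& F S, a \in S, b \notin S & c \notin S]) <= 3 * k - 1.
  move=> ap h; apply: leq_trans (_ : 2 * k - 1 <= _); last by rewrite leq_sub2r // leq_mul2r orbT.
  apply: leq_trans (deg2_bound ap); apply: leq_facet_count => A AF /and4P[FA aA bA cA].
  by rewrite FA aA h.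
have nadj u v : adj u v -> u != v by apply: contraTneq => ->; rewrite adj_irr.
have [[A0 [AF FA aA bA cA]]|noA] :=
  EM (exists A, [/\ A \in facets, F A, a \in A, b \notin A & c \notin A]); last first.
  rewrite facet_count_sum big1_seq // => A /= AF.
  by case: (boolP [&& _, _, _ & _]) => // /and4P[FA aA bA cA]; case: noA; exists A.
have [[p _ Pp] [q _ Pq]] := hit A0 AF FA aA bA cA.
have [[p' [Pp' npp]]|onlyp] := EM (exists p', Pb p' /\ p != p'); last first.
  have /and3P[_ ap _] := Pp; apply: (single p) => // A hA hF haA hbA hcA.
  have [[p' p'A Pp'] _] := hit A hA hF haA hbA hcA.
  by have [->|npp] := eqVneq p p' => //; case: onlyp; exists p'.
have [[q' [Pq' nqq]]|onlyq] := EM (exists q', Pc q' /\ q != q'); last first.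
  have /and3P[_ ap _] := Pq; apply: (single q) => // A hA hF haA hbA hcA.
  have [_ [q' q'A Pq']] := hit A hA hF haA hbA hcA.
  by have [->|nqq] := eqVneq q q' => //; case: onlyq; exists q'.
(* If B and C share such a vertex r, members avoid r only by containing the two others. *)
have shared r u v : Pb r -> Pc r -> Pb u -> Pc v -> r != u -> r != v ->
    #(fun S => [&& F S, a \in S, b \notin S & c \notin S]) <= 3 * k - 1.
  move=> Pbr Pcr Pbu Pcv ru rv.
  have /and3P[rB ar br] := Pbr; have /and3P[rC _ cr] := Pcr.
  have /and3P[uB au bu] := Pbu; have /and3P[vC av cv] := Pcv.
  have uv : u != v.
    apply: contraTneq cv => uv; rewrite -uv; apply/negP => cu.
    case: (@no_five a b c r u).
    by rewrite /= ab ac bc ar br cr au bu cu (facet_adj BF rB uB).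
  apply: (final r u v) => //; first by rewrite /= !inE negb_or !(nadj a) //= uv.
  move=> A hA hF haA hbA hcA; have [[s sA Ps] [t tA Pt]] := hit A hA hF haA hbA hcA.
  have [es|es] := two_b r u s Pbr Pbu Ps ru; first by left; rewrite -es.
  have [et|et] := two_c r v t Pcr Pcv Pt rv; first by left; rewrite -et.
  by right; rewrite -es -et.
have [epq|npq] := eqVneq p q; first by apply: (shared p p' q'); rewrite // epq.
have [epq'|npq'] := eqVneq p q'.
  by apply: (shared p p' q); rewrite // epq' // eq_sym.
have [ep'q|np'q] := eqVneq p' q.
  by apply: (shared p' p q'); rewrite // ?ep'q // -ep'q eq_sym.
have [ep'q'|np'q'] := eqVneq p' q'.
  by apply: (shared p' p q); rewrite // ?ep'q' // -?ep'q' eq_sym.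
(* Four distinct vertices p, p', q, q': if the first two are completely joined to the last two, they
   form a five-clique with a; otherwise a non-adjacent pair is excluded from the traces. *)
have /and3P[pB ap bp] := Pp; have /and3P[p'B ap' bp'] := Pp'.
have /and3P[qC aq cq] := Pq; have /and3P[q'C aq' cq'] := Pq'.
have apart u u' v v' : Pb u -> Pb u' -> Pc v -> Pc v' -> u != u' -> v != v' ->
    u != v -> u != v' -> ~~ adj u v ->
    #(fun S => [&& F S, a \in S, b \notin S & c \notin S]) <= 3 * k - 1.
  move=> Pu Pu' Pv Pv' uu vv uv uv' nuv.
  have /and3P[_ au _] := Pu; have /and3P[_ au' _] := Pu'; have /and3P[_ av' _] := Pv'.
  apply: (final u' u v') => //; first by rewrite /= !inE negb_or !(nadj a) //= uv'.
  move=> A hA hF haA hbA hcA; have [[s sA Ps] [t tA Pt]] := hit A hA hF haA hbA hcA.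
  have [es|es] := two_b u u' s Pu Pu' Ps uu; last by left; rewrite -es.
  have [et|et] := two_c v v' t Pv Pv' Pt vv; last by right; rewrite -es -et.
  by case/negP: nuv; rewrite -es -et; apply: (facet_adj hA) => //; rewrite es et.
have np'p : p' != p by rewrite eq_sym.
have nq'q : q' != q by rewrite eq_sym.
have [pq|npq_adj] := boolP (adj p q); last exact: (apart p p' q q').
have [pq'|npq_adj] := boolP (adj p q'); last exact: (apart p p' q' q).
have [p'q|npq_adj] := boolP (adj p' q); last exact: (apart p' p q q').
have [p'q'|npq_adj] := boolP (adj p' q'); last exact: (apart p' p q' q).
case: (@no_five a p p' q q').
by rewrite /= ap ap' aq aq' pq pq' p'q p'q' (facet_adj BF pB p'B) // (facet_adj CF qC q'C).
Qed.

(** If no triangle meets all members, they number at most 24. Otherwise fix such a triangle abc: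
at most k members contain it, and the others fall into three groups, each pairing a trace of one
vertex with the complementary trace of two, of size at most 3k - 1. *)
Lemma rank4_bound : 2 < k -> #F <= k ^ 3.
Proof.
move=> k3.
have [no3|] := EM (forall x y z, pairwise adj [:: x; y; z] ->
     exists S, [/\ F S, x \notin S, y \notin S & z \notin S]).
  apply: leq_trans (no_triple_bound no3) _.
  by apply: leq_trans (_ : 3 ^ 3 <= _); rewrite ?leq_exp2r.
move=> /existsNP[a /existsNP[b /existsNP[c /not_implyP[abc no]]]].
have trans S : F S -> [|| a \in S, b \in S | c \in S].
  move=> FS; apply/negPn/negP; rewrite !negb_or => /and3P[aS bS cS].
  by apply: no; exists S.
have /and3P[/and3P[ab ac _] /andP[bc _] _] := abc.
have bca : pairwise adj [:: b; c; a] by rewrite /= bc !(adj_sym _ a) ab ac.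
have cab : pairwise adj [:: c; a; b] by rewrite /= !(adj_sym c) ac bc ab.
have h1 := transversal_part abc trans.
have h2 : #(fun S => [&& F S, c \in S, a \in S & b \notin S]) +
  #(fun S => [&& F S, b \in S, c \notin S & a \notin S]) <= 3 * k - 1.
  by apply: transversal_part => // S FS; case/or3P: (trans S FS) => ->; rewrite ?orbT.
have h3 : #(fun S => [&& F S, a \in S, b \in S & c \notin S]) +
  #(fun S => [&& F S, c \in S, a \notin S & b \notin S]) <= 3 * k - 1.
  by apply: transversal_part => // S FS; case/or3P: (trans S FS) => ->; rewrite ?orbT.
have h0 := count_triple abc.
apply: leq_trans (cube_bound k3).
have : #F <= k + (#(fun S => [&& F S, b \in S, c \in S & a \notin S]) +
      #(fun S => [&& F S, a \in S, b \notin S & c \notin S])) +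
    (#(fun S => [&& F S, c \in S, a \in S & b \notin S]) +
      #(fun S => [&& F S, b \in S, c \notin S & a \notin S])) +
    (#(fun S => [&& F S, a \in S, b \in S & c \notin S]) +
      #(fun S => [&& F S, c \in S, a \notin S & b \notin S])).
  rewrite -h0 !facet_count_sum -!big_split /=; apply: leq_sum => S _.
  by case: (boolP (F S)) => // /trans; do 3!case: (_ \in S).
by move: k3 h1 h2 h3; clear; lia.
Qed.
End Rank4.
End Branching.

(** * Rank four and ridge degree two, by exhaustive search *)

(** For k = 2 the branching bounds are too weak, and the bound 8 on families met by no edge is
obtained by a computation. A state is a list of quadruples of natural numbers, the labels,
standing for members of the family. A state grows by one quadruple at a time: if a pair of labels
known to be adjacent meets all quadruples of the state, some member avoids that pair and is
taken; otherwise any new member is. Its known vertices form a set of labels meeting all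
quadruples, and its other vertices receive fresh labels. States are discarded in which five
labels would be pairwise adjacent, or a triangle would lie in three four-cliques, and they are
relabelled so that isomorphic states tend to coincide. No state with nine quadruples survives. *)
Module QuadrupleSearch.

Definition quads := seq (seq nat).

(* Lazy connectives: the virtual machine evaluates both arguments of || and &&. *)
Fixpoint lhas T (p : pred T) s := if s is x :: s' then if p x then true else lhas p s' else false.
Fixpoint lall T (p : pred T) s := if s is x :: s' then if p x then lall p s' else false else true.
Fixpoint lmem i (s : seq nat) :=
  if s is j :: s' then if eqn i j then true else lmem i s' else false.

Definition joined (st : quads) i j :=
  if eqn i j then false else lhas (fun q => if lmem i q then lmem j q else false) st.

Definition labels (st : quads) := undup (flatten st).

Definition fresh (st : quads) := foldr maxn 0 (map succn (flatten st)).

(** The relation [joined st] as a table, computed once for all extensions of a state. *)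
Definition joins (st : quads) : seq (seq bool) :=
  let m := fresh st in mkseq (fun i => mkseq (joined st i) m) m.

Definition add_quad (rows : seq (seq bool)) (q : seq nat) m :=
  mkseq (fun i => let r := nth [::] rows i in
    if lmem i q then
      mkseq (fun j => if nth false r j then true else if eqn j i then false else lmem j q) m
    else r) m.

Fixpoint meet (r s : seq bool) : seq bool :=
  if r is x :: r' then if s is y :: s' then (x && y) :: meet r' s' else [::] else [::].

(** Given a table of adjacent labels, detects a label adjacent to all of q, or a triangle in q
with three common neighbours. Such violations are looked for only around quadruples of the state.
*)
Definition crowded rows (q : seq nat) : bool :=
  if q is [:: a; b; c; d] then
    let ra := nth [::] rows a in let rb := nth [::] rows b in
    let rc := nth [::] rows c in let rd := nth [::] rows d in
    let ab := meet ra rb in let cd := meet rc rd in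
    if lhas id (meet ab cd) then true else if 2 < count id (meet ab rc) then true
    else if 2 < count id (meet ab rd) then true else if 2 < count id (meet ra cd) then true
    else 2 < count id (meet rb cd)
  else true.

Fixpoint small_subseqs k (s : seq nat) : seq (seq nat) :=
  if s is x :: s' then
    (if k is k'.+1 then map (cons x) (small_subseqs k' s') else [::]) ++ small_subseqs k s'
  else [:: [::]].

Definition hits t (q : seq nat) := lhas (fun i => lmem i q) t.

(** A new quadruple is determined by its labels already in use, which have to meet all others. *)
Definition candidates st (avoid : seq nat) :=
  let m := fresh st in
  [seq t ++ iota m (4 - size t) |
    t <- small_subseqs 4 [seq i <- labels st | ~~ lmem i avoid] & lall (hits t) st].

Definition transversal_pair st : seq nat :=
  let l := iota 0 (fresh st) in
  head [::] [seq [:: i; j] | i <- l,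
    j <- [seq j <- l | if i < j then
      if lall (hits [:: i; j]) st then joined st i j else false else false]].

Definition weights (st : quads) (w : seq N) : seq N :=
  mkseq (fun i => foldr (fun q acc => if lmem i q then
     foldr (fun u a => N.add (nth N0 w u) a) acc q else acc) N0 st) (fresh st).

Definition relabel (order : seq nat) (st : quads) : quads :=
  [seq sort leq [seq index i order | i <- q] | q <- st].

Fixpoint lexle (s t : seq nat) := match s, t with
  | x :: s', y :: t' => (x < y) || ((x == y) && lexle s' t') | [::], _ => true | _, _ => false end.

(** Every relabelling is sound. This one sorts labels by iterated incidence weights, in binary
arithmetic, which identifies enough isomorphic states to keep the search short. *)
Definition normal (st : quads) : quads :=
  let w := iter 3 (weights st) (nseq (fresh st) 1%num) in
  let heavier i j := N.leb (nth N0 w j) (nth N0 w i) in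
  sort lexle (relabel (sort heavier (sort leq (labels st))) st).

Definition children (st : quads) : seq quads :=
  let rows := joins st in
  let m := fresh st + 4 in
  let avoid := transversal_pair st in
  [seq q :: st | q <- candidates st avoid &
     if lhas (fun q' => lall (fun i => lmem i q') q) st then false
     else ~~ lhas (crowded (add_quad rows q m)) (q :: st)].

Definition step (L : seq quads) : seq quads :=
  undup (flatten [seq [seq normal st' | st' <- children st] | st <- L]).

Definition start : seq quads := [:: [:: [:: 0; 1; 2; 3]]].

Lemma search_empty : nilp (iter 8 step start).
Proof. vm_cast_no_check (erefl true). Qed.

Lemma lhasE T (p : pred T) s : lhas p s = has p s.
Proof. by elim: s => //= x s ->. Qed.

Lemma lallE T (p : pred T) s : lall p s = all p s.
Proof. by elim: s => //= x s ->. Qed.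

Lemma lmemE i s : lmem i s = (i \in s).
Proof. by elim: s => //= j s ->; rewrite in_cons. Qed.

Lemma lt_fresh st i : i \in flatten st -> i < fresh st.
Proof.
rewrite /fresh; elim: (flatten st) => //= j s IH; rewrite in_cons leq_max.
by case/orP=> [/eqP->|/IH ->]; rewrite ?leqnn ?orbT.
Qed.

Lemma in_labels st i : (i \in labels st) = (i \in flatten st).
Proof. exact: mem_undup. Qed.

Lemma joinedE st i j :
  joined st i j = (i != j) && has (fun q => (i \in q) && (j \in q)) st.
Proof.
rewrite /joined -[eqn i j]/(i == j); case: eqP => //= _; rewrite lhasE.
by apply: eq_has => q; rewrite !lmemE.
Qed.

Lemma joined_labels st i j : joined st i j -> (i \in flatten st) && (j \in flatten st).
Proof.
rewrite joinedE => /andP[_ /hasP[q qst /andP[iq jq]]].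
by apply/andP; split; apply/flattenP; exists q.
Qed.

Lemma nth_mkseq_true (f : nat -> bool) m j : nth false (mkseq f m) j -> f j.
Proof.
by have [jm|mj] := ltnP j m; [rewrite nth_mkseq | rewrite nth_default ?size_mkseq].
Qed.

Definition row_of (rows : seq (seq bool)) i j := nth false (nth [::] rows i) j.

Lemma joins_sound st i j : row_of (joins st) i j -> joined st i j.
Proof.
rewrite /row_of /joins; have [im|mi] := ltnP i (fresh st).
  by rewrite nth_mkseq // => /nth_mkseq_true.
by rewrite (nth_default [::]) ?size_mkseq // nth_nil.
Qed.

Lemma add_quad_sound st q m i j : row_of (add_quad (joins st) q m) i j -> joined (q :: st) i j.
Proof.
have old : row_of (joins st) i j -> joined (q :: st) i j.
  by move/joins_sound; rewrite !joinedE => /andP[-> /= ->]; rewrite orbT.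
rewrite /row_of /add_quad; have [im|mi] := ltnP i m; last first.
  by rewrite (nth_default [::]) ?size_mkseq // nth_nil.
rewrite nth_mkseq //; rewrite lmemE; case: ifP => [iq|_]; last exact: old.
move/nth_mkseq_true; case: ifP => [h _|_]; first exact: old.
rewrite -[eqn j i]/(j == i); case: eqP => // ji; rewrite lmemE => jq.
by rewrite joinedE /= iq jq eq_sym; move/eqP: ji => ->.
Qed.

Lemma nth_meet r s j : nth false (meet r s) j = nth false r j && nth false s j.
Proof.
elim: r s j => [|x r IH] [|y s] [|j] //=; rewrite ?andbF ?IH //.
Qed.

Lemma count3P (r : seq bool) : 2 < count id r ->
  exists l : seq nat, [/\ uniq l, size l = 3 & {in l, forall j, nth false r j}].
Proof.
move=> c3; pose l := [seq j <- iota 0 (size r) | nth false r j].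
have sl : size l = count id r.
  by rewrite size_filter -[in RHS](mkseq_nth false r) /mkseq count_map; apply: eq_count.
exists (take 3 l); split.
- by rewrite take_uniq // filter_uniq // iota_uniq.
- by rewrite size_takel ?sl.
- by move=> j /mem_take; rewrite mem_filter => /andP[].
Qed.

Lemma small_subseqsP k s t : subseq t s -> size t <= k -> t \in small_subseqs k s.
Proof.
elim: s k t => [|x s IH] k t; first by rewrite subseq0 => /eqP->; rewrite inE.
case: t => [|y t] /=; first by move=> _ _; rewrite mem_cat (IH k [::]) ?sub0seq ?orbT.
rewrite mem_cat; case: eqP => [->|_] sub sz; last by rewrite (IH k) ?orbT.
by case: k sz => // k sz; rewrite map_f // IH.
Qed.

Lemma crowdedE rows a b c d : let R := nth [::] rows in
  crowded rows [:: a; b; c; d] =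
  [|| has id (meet (meet (R a) (R b)) (meet (R c) (R d))),
      2 < count id (meet (meet (R a) (R b)) (R c)), 2 < count id (meet (meet (R a) (R b)) (R d)),
      2 < count id (meet (R a) (meet (R c) (R d))) | 2 < count id (meet (R b) (meet (R c) (R d)))].
Proof. by rewrite /crowded lhasE. Qed.

Section Realizations.
Context {K : choiceType} (adj : rel K).
Hypotheses (adj_sym : symmetric adj) (adj_irr : irreflexive adj).
Implicit Types (S T : {fset K}) (phi : nat -> K) (st : quads) (q : seq nat).
Variables (X : {fset K}).
Hypothesis (reg : regular adj 2 4 X).
Hypothesis adjX : forall x y, adj x y -> x \in X.
Local Notation facets := (cliques adj 4 X).
Variable (F : pred {fset K}).
Hypothesis FF : forall S, F S -> S \in facets.
Hypothesis Fint : forall S S', F S -> F S' -> exists2 x, x \in S & x \in S'.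
Hypothesis no_pair : forall a b, adj a b -> exists S, [/\ F S, a \notin S & b \notin S].

Definition image phi q : {fset K} := [fset x in map phi q].

Lemma in_image phi q x : (x \in image phi q) = (x \in map phi q).
Proof. by rewrite in_fset. Qed.

(** Injectivity on the labels in use makes equal labels equal vertices and distinct labels
distinct vertices. *)
Definition realizes phi st :=
  {in flatten st &, injective phi} /\
  forall q, q \in st -> [/\ uniq q, size q = 4 & F (image phi q)].

Definition realized st := exists phi, realizes phi st.

Lemma realizes_adj phi st i j : realizes phi st -> joined st i j -> adj (phi i) (phi j).
Proof.
move=> [inj real] ij; have /andP[ist jst] := joined_labels ij.
move: ij; rewrite joinedE => /andP[nij /hasP[q qst /andP[iq jq]]].
have [_ _ /FF qF] := real q qst.
apply: (facet_adj qF); rewrite ?in_image ?map_f //.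
by apply: contraNneq nij => /inj->.
Qed.

Lemma quad_joined st q i j : q \in st -> i \in q -> j \in q -> i != j -> joined st i j.
Proof.
by move=> qst iq jq nij; rewrite joinedE nij; apply/hasP; exists q; rewrite ?iq.
Qed.

(** The vertices adjacent to all of a, b, c complete the ridge abc, so they are two. *)
Lemma realizes_pages phi st a b c (l : seq nat) : realizes phi st ->
  joined st a b -> joined st a c -> joined st b c -> uniq l ->
  {in l, forall j, [&& joined st a j, joined st b j & joined st c j]} -> size l <= 2.
Proof.
move=> re ab ac bc ul pl; have [inj _] := re.
have jadj := realizes_adj re.
have ps : pairwise adj [:: phi a; phi b; phi c] by rewrite /= !jadj.
have TF := pairwise_cliques adj_sym adj_irr adjX ps erefl.
rewrite -(ridge_degree adj_sym reg TF) -(size_map phi).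
apply: uniq_leq_size.
  rewrite map_inj_in_uniq // => i j /pl/and3P[ai _ _] /pl/and3P[aj _ _].
  by apply: inj; have /andP[] := joined_labels ai; have /andP[] := joined_labels aj.
move=> x /mapP[j /pl/and3P[aj bj cj] ->].
rewrite -[_ \in enum_fset _]/(phi j \in common adj X _) in_common.
have sj i : joined st i j -> adj (phi j) (phi i) by rewrite adj_sym; apply: jadj.
apply/andP; split; first exact: adjX (sj _ aj).
apply/allP => y; rewrite in_fset /= !inE.
by case/or3P=> /eqP->; apply: sj.
Qed.

(** Soundness of the pruning: a table whose entries are adjacent in a realized state shows
neither a five-clique nor a ridge in three facets. *)
Lemma crowdedP phi st rows q : realizes phi st -> q \in st ->
  (forall i j, row_of rows i j -> joined st i j) -> ~~ crowded rows q.
Proof.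
move=> re qst sound; have [inj real] := re; have [uq sq _] := real q qst.
case: q qst uq sq => [|a [|b [|c [|d [|e q]]]]] // qst uq _.
have /and5P[nab nac nad nbc /andP[nbd ncd]] :
    [&& a != b, a != c, a != d, b != c, b != d & c != d].
  by move: uq; rewrite /= !inE !negb_or andbT -!andbA.
have jq i j : i \in [:: a; b; c; d] -> j \in [:: a; b; c; d] -> i != j -> joined st i j.
  exact: quad_joined qst.
pose q0 := [:: a; b; c; d].
have [ma mb mc md] : [/\ a \in q0, b \in q0, c \in q0 & d \in q0].
  by rewrite !inE !eqxx !orbT.
have jab := jq a b ma mb nab. have jac := jq a c ma mc nac. have jad := jq a d ma md nad.
have jbc := jq b c mb mc nbc. have jbd := jq b d mb md nbd. have jcd := jq c d mc md ncd.
have pages r1 r2 r3 : joined st r1 r2 -> joined st r1 r3 -> joined st r2 r3 ->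
    forall m, (forall j, nth false m j ->
      [&& row_of rows r1 j, row_of rows r2 j & row_of rows r3 j]) ->
    2 < count id m = false.
  move=> j12 j13 j23 m hm; apply/negP => /count3P[l [ul sl hl]].
  suff : size l <= 2 by rewrite sl.
  apply: (realizes_pages re j12 j13 j23 ul) => j /hl/hm/and3P[h1 h2 h3].
  by rewrite !sound.
pose R := nth [::] rows.
have h0 : has id (meet (meet (R a) (R b)) (meet (R c) (R d))) = false.
  apply/negP => /hasP[[] // /(nthP false)[v _ hv] _]; move: hv.
  rewrite !nth_meet => /andP[/andP[/sound av /sound bv] /andP[/sound cv /sound dv]].
  have jadj := realizes_adj re.
  have := pairwise_size adj_sym adj_irr reg adjX (s := map phi [:: a; b; c; d; v]).
  by rewrite /= !jadj // => /(_ erefl erefl).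
have h1 : (2 < count id (meet (meet (R a) (R b)) (R c))) = false.
  by apply: (pages a b c) => // v; rewrite !nth_meet -andbA.
have h2 : (2 < count id (meet (meet (R a) (R b)) (R d))) = false.
  by apply: (pages a b d) => // v; rewrite !nth_meet -andbA.
have h3 : (2 < count id (meet (R a) (meet (R c) (R d)))) = false.
  by apply: (pages a c d) => // v; rewrite !nth_meet.
have h4 : (2 < count id (meet (R b) (meet (R c) (R d)))) = false.
  by apply: (pages b c d) => // v; rewrite !nth_meet.
by apply: negbT; rewrite crowdedE h0 h1 h2 h3 h4.
Qed.

Lemma realizes_le phi st q q' : realizes phi st -> q \in st -> q' \in st -> {subset q <= q'} ->
  image phi q = image phi q'.
Proof.
move=> re qst q'st sub; have [_ real] := re.
have [_ _ /FF/facetP[_ _ s1]] := real q qst; have [_ _ /FF/facetP[_ _ s2]] := real q' q'st.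
apply/eqP; rewrite eqEfcard s1 s2 leqnn andbT; apply/fsubsetP => x.
by rewrite !in_image => /mapP[i /sub iq ->]; apply: map_f.
Qed.

(** Known vertices of S keep their labels and the others receive fresh ones; since S meets all
members of the state, its known labels meet all quadruples. *)
Lemma realizes_extend phi st S : realizes phi st -> F S ->
  let t := [seq i <- labels st | phi i \in S] in
  let q := t ++ iota (fresh st) (4 - size t) in
  [/\ size t <= 4, {in st, forall q', hits t q'} &
      exists psi, [/\ realizes psi (q :: st), image psi q = S &
                      {in st, forall q', image psi q' = image phi q'}]].
Proof.
move=> [inj real] FS t q.
have [_ _ sS] := facetP (FF FS).
have tl i : i \in t -> i \in flatten st by rewrite mem_filter in_labels => /andP[].
have ut : uniq (map phi t).
  rewrite map_inj_in_uniq ?filter_uniq ?undup_uniq // => i j /tl h /tl h'.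
  exact: inj.
have tS x : x \in map phi t -> x \in S.
  by case/mapP=> i; rewrite mem_filter => /andP[h _] ->.
have st4 : size t <= 4.
  by rewrite -sS -(size_map phi); apply: uniq_leq_size ut _ => x /tS.
pose rest := [seq x <- enum_fset S | x \notin map phi t].
have urest : uniq rest by rewrite filter_uniq ?fset_uniq.
have restS x : (x \in rest) = (x \notin map phi t) && (x \in S) by rewrite mem_filter.
have srest : size rest = 4 - size t.
  suff : size (map phi t ++ rest) = 4 by rewrite size_cat size_map => <-; rewrite addKn.
  rewrite -sS; apply/perm_size/uniq_perm.
  - by rewrite cat_uniq ut urest andbT -all_predC; apply/allP => x; rewrite restS => /andP[].
  - exact: fset_uniq.
  - move=> x; rewrite mem_cat restS -[RHS]/(x \in S).
    by case: (boolP (x \in map phi t)) => [/tS->|].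
pose m := fresh st.
pose psi i := if i < m then phi i else nth (phi 0) rest (i - m).
have psi_old i : i \in flatten st -> psi i = phi i by move=> h; rewrite /psi lt_fresh.
have psi_q : map psi q = map phi t ++ rest.
  rewrite map_cat; congr (_ ++ _).
    by apply/eq_in_map => i /tl; apply: psi_old.
  rewrite -[RHS](mkseq_nth (phi 0)) srest -[fresh st]addn0 iotaDl -map_comp.
  by apply: eq_map => i /=; rewrite /psi ltnNge leq_addr /= addKn.
have im_q : image psi q = S.
  apply/fsetP => x; rewrite in_image psi_q mem_cat restS.
  by case: (boolP (x \in map phi t)) => [/tS->|].
have im_old : {in st, forall q', image psi q' = image phi q'}.
  move=> q' q'st; apply/fsetP => x; rewrite !in_image.
  congr (_ \in _); apply/eq_in_map => i iq'; apply: psi_old.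
  by apply/flattenP; exists q'.
split=> // [q' q'st|].
  have [_ _ Fq'] := real q' q'st; have [x xS] := Fint FS Fq'.
  rewrite in_image => /mapP[i iq' ex]; rewrite /hits lhasE; apply/hasP; exists i.
    rewrite mem_filter -ex xS in_labels /=; apply/flattenP; by exists q'.
  by rewrite lmemE.
exists psi; split => //; split.
  have cases i : i \in flatten (q :: st) ->
      i \in flatten st \/ exists2 l, l < 4 - size t & i = m + l.
    rewrite /= mem_cat mem_cat => /orP[/orP[/tl|]|]; [by left| |by left].
    rewrite mem_iota => /andP[mi lt]; right; exists (i - m); last by rewrite subnKC.
    by rewrite ltn_subLR.
  have psi_new l : psi (m + l) = nth (phi 0) rest l.
    by rewrite /psi ltnNge leq_addr /= addKn.
  have diff i l : i \in flatten st -> l < 4 - size t -> psi i <> psi (m + l).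
    move=> ist lt; rewrite psi_old // psi_new => e.
    have : nth (phi 0) rest l \in rest by rewrite mem_nth // srest.
    by rewrite restS -e => /andP[/mapP + iS]; case; exists i; rewrite // mem_filter iS in_labels.
  move=> i j /cases[hi|[l hl ->]] /cases[hj|[l' hl' ->]].
  - by rewrite !psi_old //; apply: inj.
  - by move/(diff _ _ hi hl').
  - by move/esym/(diff _ _ hj hl).
  - rewrite !psi_new => /eqP; rewrite nth_uniq ?srest // => /eqP->.
    by [].
move=> q'; rewrite in_cons => /orP[/eqP->|q'st].
  split; last by rewrite im_q.
    rewrite cat_uniq iota_uniq andbT (map_uniq ut) /= -all_predC; apply/allP => i.
    rewrite mem_iota /= => /andP[mi _]; apply: contraL mi => /tl/lt_fresh.
    by rewrite ltnNge.
  by rewrite size_cat size_iota subnKC.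
by have [h1 h2 h3] := real q' q'st; split; rewrite ?im_old.
Qed.

Lemma in_candidates phi st S avoid : realizes phi st -> F S ->
  {in avoid, forall i, phi i \notin S} ->
  let t := [seq i <- labels st | phi i \in S] in
  t ++ iota (fresh st) (4 - size t) \in candidates st avoid.
Proof.
move=> re FS av; have [t4 ht _] := realizes_extend re FS.
set t := [seq i <- _ | _] => /=; apply/mapP; exists t => //; rewrite mem_filter lallE.
apply/andP; split; first exact/allP.
apply: small_subseqsP => //.
rewrite (_ : t = [seq i <- [seq i <- labels st | ~~ lmem i avoid] | phi i \in S]).
  exact: filter_subseq.
rewrite -filter_predI; apply: eq_in_filter => i _ /=; rewrite lmemE.
by case: (boolP (phi i \in S)) => //= iS; apply/esym; apply: contraTN iS => /av.
Qed.

Lemma realizes_normal phi st : realizes phi st -> realized (normal st).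
Proof.
move=> [inj real]; rewrite /normal; set le := (fun i j => _).
set order := sort le _.
have ord i : (i \in order) = (i \in flatten st) by rewrite !mem_sort in_labels.
have uord : uniq order by rewrite !sort_uniq undup_uniq.
pose psi i := phi (nth 0 order i).
have psiK i : i \in flatten st -> psi (index i order) = phi i.
  by move=> ist; rewrite /psi nth_index // ord.
exists psi; split.
  have sub i : i \in flatten (sort lexle (relabel order st)) -> i < size order.
    case/flattenP=> q'; rewrite mem_sort => /mapP[q qst ->]; rewrite mem_sort => /mapP[j jq ->].
    by rewrite index_mem ord; apply/flattenP; exists q.
  move=> i j /sub hi /sub hj /inj; rewrite -!ord !mem_nth // => /(_ erefl erefl)/eqP.
  by rewrite nth_uniq // => /eqP.
move=> q'; rewrite mem_sort => /mapP[q qst ->]; have [uq sq Fq] := real q qst.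
have qf i : i \in q -> i \in flatten st by move=> iq; apply/flattenP; exists q.
split.
- rewrite sort_uniq map_inj_in_uniq // => i j iq jq e.
  by rewrite -(nth_index 0 (_ : i \in order)) ?ord ?qf // e nth_index // ord qf.
- by rewrite size_sort size_map.
- rewrite (_ : image _ _ = image phi q) //; apply/fsetP => x; rewrite !in_image.
  have -> : map phi q = map psi [seq index i order | i <- q].
    by rewrite -map_comp; apply/eq_in_map => i /qf /psiK.
  by apply/mapP/mapP => -[i iq ->]; exists i; rewrite ?mem_sort // mem_sort in iq *.
Qed.

Lemma transversal_pairP st : transversal_pair st = [::] \/
  exists i j, [/\ transversal_pair st = [:: i; j], joined st i j &
    {in st, forall q, (i \in q) || (j \in q)}].
Proof.
rewrite /transversal_pair; set s := [seq _ | _ <- _, _ <- _].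
case E : s => [|p s'] /=; [by left | right].
have : p \in s by rewrite E mem_head.
case/allpairsPdep=> i [j [_ + ->]]; rewrite mem_filter => /andP[+ _].
case: ifP => // _; case: ifP => //; rewrite lallE => /allP h ij.
exists i, j; split=> // q /h; rewrite /hits lhasE /= !lmemE orbF.
by [].
Qed.

(** If the state has a transversal pair, take a member avoiding it; otherwise a member not listed
yet, which exists because the state is smaller than the family. *)
Lemma realized_child st : realized st -> size st < #|` [fset S in facets | F S]| ->
  exists2 st', st' \in children st & realized (normal st').
Proof.
move=> [phi re] lt; have [inj real] := re.
suff [S [FS new av]] : exists S, [/\ F S, {in st, forall q, image phi q != S} &
    {in transversal_pair st, forall i, phi i \notin S}].
  move: (realizes_extend re FS) (in_candidates re FS av) => /= [_ _ [psi [rpsi imq imold]]] qc.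
  set q := _ ++ _ in rpsi imq qc.
  exists (q :: st); last exact: realizes_normal rpsi.
  apply: map_f; rewrite mem_filter qc andbT lhasE ifN.
    apply/negP; rewrite lhasE => /hasP[q' q'in].
    by apply/negP; apply: (crowdedP rpsi q'in) => i j; apply: add_quad_sound.
  apply/hasPn => q' q'st; rewrite lallE; apply/negP => /allP sub.
  case/negP: (new q' q'st); rewrite -imold // -imq eq_sym; apply/eqP.
  apply: (realizes_le rpsi); rewrite ?mem_head ?in_cons ?q'st ?orbT // => i /sub.
  by rewrite lmemE.
case: (transversal_pairP st) => [->|[i [j [-> ij cover]]]].
  have [S SF nS] : exists2 S, S \in [fset S in facets | F S] & S \notin map (image phi) st.
    apply: contrapT => no; move: lt; rewrite ltnNge -(size_map (image phi)) => /negP; apply.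
    apply: uniq_leq_size => // S SF; apply: contrapT => nS; apply: no; exists S => //.
    exact/negP.
  move: SF; rewrite in_sep => /andP[_ FS]; exists S; split => // q qst.
  by apply: contraNneq nS => <-; apply: map_f.
have [S [FS iS jS]] := no_pair (realizes_adj re ij).
exists S; split => //.
  move=> q qst; apply: contraTneq (cover q qst) => e.
  have h l : phi l \notin S -> l \notin q.
    by apply: contra => lq; rewrite -e in_image map_f.
  by rewrite negb_or !h.
by move=> l; rewrite !inE => /orP[] /eqP->.
Qed.

Lemma size_normal st : size (normal st) = size st.
Proof. by rewrite size_sort size_map. Qed.

Lemma size_children st st' : st' \in children st -> size st' = (size st).+1.
Proof. by case/mapP=> q _ ->. Qed.

(** A family of nine members would be found by the search: realized states extend up to size
nine. *)
Lemma degree2_bound : #|` [fset S in facets | F S]| <= 8.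
Proof.
rewrite leqNgt; apply/negP => lt.
suff h l : l <= 8 -> exists2 st, st \in iter l step start & realized st /\ size st = l.+1.
  by have [st] := h 8 isT; rewrite (nilP search_empty).
elim: l => [|l IH] lt8.
  have : 0 < #|` [fset S in facets | F S]| by apply: leq_trans lt.
  rewrite cardfs_gt0 => /fset0Pn[S]; rewrite in_sep => /andP[SF FS].
  exists [:: [:: 0; 1; 2; 3]] => //; split=> //.
  have [_ _ sS] := facetP SF; case ES : (enum_fset S) => [|x0 s]; first by rewrite ES in sS.
  have e : map (nth x0 (enum_fset S)) [:: 0; 1; 2; 3] = enum_fset S.
    by rewrite -[RHS](mkseq_nth x0) sS.
  exists (nth x0 (enum_fset S)); split.
    move=> i j ist jst /eqP; rewrite nth_uniq ?fset_uniq // => [/eqP->//||].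
      by rewrite sS; move: ist; rewrite /= !inE => /or4P[] /eqP->.
    by rewrite sS; move: jst; rewrite /= !inE => /or4P[] /eqP->.
  move=> q; rewrite inE => /eqP->; split=> //; rewrite (_ : image _ _ = S) //.
  by apply/fsetP => x; rewrite in_image e.
have [st stl [re sz]] := IH (ltnW lt8).
have [|st' ch re'] := realized_child re; first by rewrite sz; apply: leq_trans lt.
exists (normal st'); last by rewrite size_normal (size_children ch) sz.
rewrite iterS mem_undup; apply/flattenP; exists [seq normal st' | st' <- children st].
  exact: map_f.
exact: map_f.
Qed.

End Realizations.

End QuadrupleSearch.

(** * The Erdos-Ko-Rado property of regular flag complexes *)

Section ErdosKoRado.
Context {K : choiceType} (adj : rel K).
Hypotheses (adj_sym : symmetric adj) (adj_irr : irreflexive adj).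
Implicit Types (X S T : {fset K}) (F : {fset {fset K}}).
Variables (k n : nat) (X : {fset K}).
Hypotheses (k2 : 1 < k) (n0 : 0 < n) (n4 : n <= 4) (reg : regular adj k n X).
Hypothesis adjX : forall x y, adj x y -> x \in X.
Local Notation facets := (cliques adj n X).
Local Notation "# P" := (facet_count adj n X P) (at level 10, P at level 8).

(** If an edge meets all members, [pair_star] applies: its link has no triangle since the rank is
at most four. Otherwise the family has at most k^(n-1) members, no more than any star. *)
Lemma intersecting_star (F : pred {fset K}) :
  (forall S, F S -> S \in facets) ->
  (forall S S', F S -> F S' -> exists2 x, x \in S & x \in S') ->
  exists v, #F <= #(fun S => v \in S).
Proof.
move=> FF Fint; move: reg n0 n4 FF; case: n => // n' regn _ n4' FF.
have Xv : exists v, v \in X by case: regn => /fset0Pn.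
have big m : facet_count adj n'.+1 X F <= m -> m <= k ^ n' ->
    exists v, facet_count adj n'.+1 X F <= facet_count adj n'.+1 X (fun S => v \in S).
  move=> h1 h2; case: Xv => v vX; exists v; apply: leq_trans h1 _.
  by apply: leq_trans h2 _; apply: star_ge.
have [[a [b [ab cover]]]|nopair] :=
    EM (exists a b, adj a b /\ forall S, F S -> (a \in S) || (b \in S)).
  apply: (pair_star adj_sym adj_irr k2 regn _ ab) => [S S' _ _ FS FS'|x y z|S _].
  - have [x xS xS'] := Fint S S' FS FS'; apply/fset0Pn; exists x.
    by rewrite in_fsetI xS.
  - case/andP=> ax bx /andP[ay by_] /andP[az bz] xy xz yz.
    have ps : pairwise adj [:: a; b; x; y; z] by rewrite /= ab ax ay az bx by_ bz xy xz yz.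
    by have := leq_trans (pairwise_size adj_sym adj_irr regn adjX ps erefl) n4'.
  - exact: cover.
have no_pair a b : adj a b -> exists S, [/\ F S, a \notin S & b \notin S].
  move=> ab; apply: contrapT => no; apply: nopair; exists a, b; split=> // S FS.
  by apply: contrapT => /negP; rewrite negb_or => /andP[aS bS]; apply: no; exists S.
have [[S FS]|noF] := EM (exists S, F S); last first.
  apply: (big 0); last by [].
  rewrite facet_count_sum big1_seq // => S _; case: (boolP (F S)) => // FS.
  by case: noF; exists S.
have SF := FF S FS; have [SX cS sS] := facetP SF.
case: n' n4' regn sS FF big {SF} => [|[|[|[|//]]]] n4' regn sS FF big.
- apply: (big 1) => //; rewrite facet_count_card.
  apply: leq_trans (_ : #|` [fset S]| <= 1); last by rewrite cardfs1.
  apply/fsubset_leq_card/fsubsetP => S'; rewrite in_sep in_fset1 => /andP[S'F FS'].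
  have [x xS xS'] := Fint S S' FS FS'; have [_ _ sS'] := facetP S'F.
  have one (T : {fset K}) : #|` T| = 1 -> x \in T -> T = [fset x].
    by move=> /eqP/cardfs1P[y ->]; rewrite in_fset1 => /eqP->.
  by rewrite (one S' sS' xS') (one S sS xS).
- have : 0 < #|` S| by rewrite sS.
  rewrite cardfs_gt0 => /fset0Pn[a aS].
  have : 0 < #|` S `\ a| by move: sS; rewrite (cardfsD1 a) aS add1n => -[->].
  rewrite cardfs_gt0 => /fset0Pn[b /fsetD1P[ba bS]].
  have ab : adj a b by move/cliqueP: cS; apply; rewrite // eq_sym.
  have sab : S = [fset a; b].
    apply/eqP; rewrite eq_sym eqEfcard fsubUset !fsub1set aS bS sS cardfs2.
    by rewrite eq_sym ba.
  have [S' [FS' aS' bS']] := no_pair a b ab.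
  have [x xS xS'] := Fint S S' FS FS'.
  move: xS; rewrite sab !inE => /orP[] /eqP ex; first by rewrite -ex xS' in aS'.
  by rewrite -ex xS' in bS'.
- apply: (big 4); first exact: (rank3_bound adj_sym adj_irr regn).
  by have := leq_exp2r 2 k (isT : 0 < 2); rewrite k2.
- have [k3|k3] := ltnP 2 k.
    by apply: (big (k ^ 3)) => //; apply: (rank4_bound adj_sym adj_irr k2 regn).
  have ek : k = 2 by apply/eqP; rewrite eqn_leq k3.
  apply: (big 8); last by rewrite ek.
  rewrite facet_count_card.
  apply: (QuadrupleSearch.degree2_bound adj_sym adj_irr _ adjX FF Fint no_pair).
  by rewrite ek in regn.
Qed.

(** The star of a vertex in the most facets dominates all other stars. *)
Theorem regular_EKR : exists2 v, v \in X & forall F, F `<=` facets ->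
  {in F &, forall S S', S `&` S' != fset0} -> #|` F| <= #(fun S => v \in S).
Proof.
have X0 : X != fset0 by case: n reg n0 => // n' [].
have [v0 v0X] := fset0Pn _ X0.
pose d v := #(fun S => v \in S).
have [v vX vmax] : exists2 v, v \in X & forall u, d u <= d v.
  have [[v vX] _ vmax] := arg_maxnP (fun u : X => d (val u)) (isT : xpredT [` v0X]).
  exists v => // u; have [uX|uX] := boolP (u \in X).
    by have := vmax [` uX] isT.
  rewrite {1}/d facet_count_sum big1_seq // => S /= /facetP[SX _ _].
  case: (boolP (u \in S)) => // uS; by rewrite (fsubsetP SX) in uX.
exists v => // F /fsubsetP FF Fint.
have [S|S S' FS FS'|u hu] := @intersecting_star (fun S => S \in F).
- exact: FF.
- by have /fset0Pn[x] := Fint S S' FS FS'; rewrite in_fsetI => /andP[? ?]; exists x.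
apply: leq_trans (vmax u); apply: leq_trans hu.
rewrite facet_count_card; apply/fsubset_leq_card/fsubsetP => S SF.
by rewrite in_sep FF.
Qed.

End ErdosKoRado.

Definition clique_complex (K : choiceType) (adj : rel K) (X : {fset K}) : {fset {fset K}} :=
  [fset S in fpowerset X | clique adj S].

Lemma in_clique_complex (K : choiceType) (adj : rel K) X S :
  (S \in clique_complex adj X) = (S `<=` X) && clique adj S.
Proof. by rewrite in_sep fpowersetE. Qed.

Section PureEKR.
Context {K : choiceType} (adj : rel K).
Hypotheses (adj_sym : symmetric adj) (adj_irr : irreflexive adj).
Variables (k n : nat) (X : {fset K}).
Hypotheses (reg : regular adj k n X).

Lemma facets_clique_complex : facets (clique_complex adj X) = cliques adj n X.
Proof.
apply/fsetP => S; rewrite in_sep in_clique_complex in_cliques -andbA.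
case SX: (S `<=` X) => //=; case cS: (clique adj S) => //=.
apply/allP/eqP => [maxS|sS T].
  have [T TF ST] := clique_extend adj_sym adj_irr reg SX cS.
  have [TX cT sT] := facetP TF; rewrite -sT.
  have := maxS T; rewrite in_clique_complex TX cT ST => /(_ erefl) /= /eqP->.
  by [].
rewrite in_clique_complex => /andP[TX cT]; apply/implyP => ST.
rewrite eq_sym eqEfcard ST sS; exact: clique_size reg TX cT.
Qed.

Lemma pure_clique_complex : pure_complex (clique_complex adj X).
Proof.
split=> [S T|S T].
  rewrite !in_clique_complex => /andP[SX cS] TS.
  by rewrite (fsubset_trans TS SX) (sub_clique TS cS).
by rewrite facets_clique_complex => /facetP[_ _ ->] /facetP[_ _ ->].
Qed.

Theorem pure_EKR_regular : 1 < k -> 0 < n <= 4 -> (forall x y, adj x y -> x \in X) ->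
  pure_EKR (clique_complex adj X).
Proof.
move=> k2 /andP[n0 n4] adjX; split; first exact: pure_clique_complex.
have [v vX star_v] := regular_EKR adj_sym adj_irr k2 n0 n4 reg adjX.
exists v.
  rewrite in_clique_complex fsub1set vX; apply/cliqueP => x y.
  by rewrite !in_fset1 => /eqP-> /eqP->; rewrite eqxx.
move=> F; rewrite /star facets_clique_complex => FF Fint.
apply: leq_trans (star_v F FF Fint) _.
by rewrite facet_count_card.
Qed.

End PureEKR.

Lemma regular_iso (K1 K2 : choiceType) (adj1 : rel K1) (adj2 : rel K2) (f : K1 -> K2) k n
    (X1 : {fset K1}) (X2 : {fset K2}) :
  {in X1 &, injective f} -> f @` X1 = X2 ->
  {in X1 &, forall x y, adj2 (f x) (f y) = adj1 x y} ->
  regular adj1 k n X1 <-> regular adj2 k n X2.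
Proof.
elim: n X1 X2 => [|n IH] X1 X2 finj <- fadj.
  have card_f : #|` f @` X1| = #|` X1| by rewrite card_in_imfset.
  rewrite /=; split=> [->|e]; first by rewrite imfset0.
  by apply: cardfs0_eq; rewrite -card_f e cardfs0.
have card_f : #|` f @` X1| = #|` X1| by rewrite card_in_imfset.
have nbr_f x : x \in X1 -> f @` nbr adj1 X1 x = nbr adj2 (f @` X1) (f x).
  move=> xX; apply/fsetP => z; apply/imfsetP/idP => [[u /= + ->]|].
    by rewrite !in_nbr => /andP[uX xu]; rewrite fadj // xu in_imfset.
  rewrite in_nbr => /andP[/imfsetP[u /= uX ->]]; rewrite fadj // => xu.
  by exists u; rewrite //= in_nbr uX.
have IHx x : x \in X1 ->
    regular adj1 k n (nbr adj1 X1 x) <-> regular adj2 k n (nbr adj2 (f @` X1) (f x)).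
  move=> xX; have sub := fsubsetP (nbr_sub adj1 X1 x); apply: IH; last 1 first.
  - by move=> u v /sub uX /sub vX; apply: fadj.
  - by move=> u v /sub uX /sub vX; apply: finj.
  - exact: nbr_f.
split=> -[X0 cX reg]; split.
- by rewrite -cardfs_gt0 card_f cardfs_gt0.
- by rewrite card_f.
- by move=> _ /imfsetP[x /= xX ->]; apply/IHx => //; apply: reg.
- by rewrite -cardfs_gt0 -card_f cardfs_gt0.
- by rewrite -card_f.
- by move=> x xX; apply/IHx => //; apply: reg; apply: in_imfset.
Qed.

Lemma eq_regular (K : choiceType) (adj1 adj2 : rel K) k n (X : {fset K}) :
  {in X &, forall x y, adj2 x y = adj1 x y} -> regular adj1 k n X <-> regular adj2 k n X.
Proof.
by move=> h; apply: (regular_iso (f := id)) => //; apply/fsetP => x; rewrite imfset_id.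
Qed.

(** The link of a vertex of X1 is the join of its link in X1 with X2, and symmetrically. *)
Lemma regular_join (K : choiceType) (adj : rel K) k n1 n2 (X1 X2 : {fset K}) :
  symmetric adj -> [disjoint X1 & X2]%fset ->
  {in X1 & X2, forall x y, adj x y} ->
  regular adj k n1 X1 -> regular adj k n2 X2 -> regular adj k (n1 + n2) (X1 `|` X2).
Proof.
move=> sym; move e : (n1 + n2) => n; elim: n n1 n2 X1 X2 e => [|n IH] n1 n2 X1 X2 e dis cross r1 r2.
  have [z1 z2] : n1 = 0 /\ n2 = 0 by lia.
  by move: r1 r2; rewrite z1 z2 /= => -> ->; rewrite fsetU0.
case: n1 e r1 => [|a] e r1; first by rewrite (r1 : X1 = fset0) fset0U -e.
case: n2 e r2 => [|b] e r2; first by rewrite (r2 : X2 = fset0) fsetU0 -e addn0.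
have [X10 _ reg1] := r1; have [_ _ reg2] := r2.
have [x1 x1X] := fset0Pn _ X10; split.
- by apply/fset0Pn; exists x1; rewrite in_fsetU x1X.
- by lia.
- move=> x; rewrite in_fsetU => /orP[xX|xX].
    have -> : nbr adj (X1 `|` X2) x = nbr adj X1 x `|` X2.
      apply/fsetP => y; rewrite in_nbr !in_fsetU in_nbr andb_orl.
      by case: (boolP (y \in X2)) => yX //=; rewrite cross.
    apply: (IH a b.+1) => //; first by lia.
    + exact: fdisjointWl (nbr_sub _ _ _) dis.
    + by move=> u v; rewrite in_nbr => /andP[uX _]; apply: cross.
    + exact: reg1.
  have -> : nbr adj (X1 `|` X2) x = X1 `|` nbr adj X2 x.
    apply/fsetP => y; rewrite in_nbr !in_fsetU in_nbr andb_orl.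
    by case: (boolP (y \in X1)) => yX //=; rewrite sym cross.
  apply: (IH a.+1 b) => //; first by lia.
  + by rewrite fdisjoint_sym; apply: fdisjointWl (nbr_sub _ _ _) _; rewrite fdisjoint_sym.
  + by move=> u v uX; rewrite in_nbr => /andP[vX _]; apply: cross.
  + exact: reg2.
Qed.

Lemma join_clique_complex (K : choiceType) (adj : rel K) (X1 X2 : {fset K}) :
  symmetric adj -> {in X1 & X2, forall x y, x != y -> adj x y} ->
  simplicial_join (clique_complex adj X1) (clique_complex adj X2) =
  clique_complex adj (X1 `|` X2).
Proof.
move=> sym cross; apply/fsetP => S; apply/imfset2P/idP => [[S1 /= + [S2 /= + ->]]|].
  rewrite !in_clique_complex => /andP[S1X /cliqueP c1] /andP[S2X /cliqueP c2].
  rewrite fsetUSS //=; apply/cliqueP => x y.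
  rewrite !in_fsetU => /orP[]xS /orP[]yS nxy; [exact: c1| | |exact: c2].
    by apply: cross; rewrite ?(fsubsetP S1X) ?(fsubsetP S2X).
  by rewrite sym cross ?(fsubsetP S1X) ?(fsubsetP S2X) // eq_sym.
rewrite in_clique_complex => /andP[SX cS].
exists (S `&` X1); rewrite ?in_clique_complex ?fsubsetIr ?(sub_clique (fsubsetIl _ _) cS) //.
exists (S `&` X2); rewrite ?in_clique_complex ?fsubsetIr ?(sub_clique (fsubsetIl _ _) cS) //.
by rewrite -fsetIUr; apply/esym/fsetIidPl.
Qed.

(** * Noncrossing diagonals of a polygon *)

Section Polygon.
Variable m : nat.
Implicit Types (e f : nat * nat).

Definition cross e f : bool :=
  (e.1 < f.1 < e.2) && (e.2 < f.2) || (f.1 < e.1 < f.2) && (f.2 < e.2).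

Definition uncrossed e f : bool := (e != f) && ~~ cross e f.

(** For N congruent to 2 modulo m, the diagonals that cut the N-gon into two polygons whose
numbers of vertices are again congruent to 2. Pairs of natural numbers make it easy to pass to
smaller polygons. *)
Definition mdiag N e := [&& e.1.+1 < e.2, e.2 < N, e.2 - e.1 < N.-1 & m %| (e.2 - e.1).-1].

Definition mdiags N : {fset nat * nat} :=
  [fset e in [seq (i, j) | i <- iota 0 N, j <- iota 0 N] | mdiag N e].

Lemma in_mdiags N e : (e \in mdiags N) = mdiag N e.
Proof.
rewrite !inE andb_idl // => /and4P[h1 h2 _ _].
by apply/allpairsP; exists e; rewrite !mem_iota; case: e h1 h2 => i j /=; split=> //; lia.
Qed.

Hypothesis m0 : 0 < m.

Lemma mdiagP N i j : reflect (exists q, [/\ 0 < q, j = i + q * m + 1, j < N & q * m + 1 < N.-1])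
  (mdiag N (i, j)).
Proof.
apply: (iffP and4P) => [[/= ij jN s /dvdnP[q e]]|[q [q0 -> jN s]]].
  exists q; split; try lia; case: q e => [|//]; lia.
have : 0 < q * m by rewrite muln_gt0 q0.
split=> /=; try lia; apply/dvdnP; exists q; lia.
Qed.

Lemma uncrossed_sym : symmetric uncrossed.
Proof. by move=> e f; rewrite /uncrossed /cross eq_sym orbC. Qed.

Lemma mdiags_small : mdiags (m + 2) = fset0.
Proof.
apply/fsetP => -[i j]; rewrite in_mdiags in_fset0; apply/mdiagP => -[q [q0 -> h s]].
have : m <= q * m by rewrite leq_pmull.
lia.
Qed.

(** In a (2m+2)-gon the diagonals in question join the vertices i and i + m + 1. *)
Lemma card_mdiags : #|` mdiags (2 * m + 2)| = m.+1.
Proof.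
pose L := [fset i in iota 0 m.+1]%fset.
have inL i : (i \in L) = (i <= m) by rewrite in_fset mem_iota.
have -> : mdiags (2 * m + 2) = [fset (i, i + m + 1) | i in L].
  apply/fsetP => -[i j]; rewrite in_mdiags; apply/mdiagP/imfsetP => [[q [q0 -> h s]]|[k /=]].
    have mq : m <= q * m by rewrite leq_pmull.
    exists i; rewrite /= ?inL; first by lia.
    have [|q1|->] := ltngtP q 1; [lia| |by rewrite mul1n].
    have := leq_mul q1 (leqnn m); lia.
  by rewrite inL => h [-> ->]; exists 1; rewrite mul1n; split; lia.
rewrite card_imfset /=; last by move=> i j [].
by rewrite [#|` L|]card_fseq undup_id ?iota_uniq // size_iota.
Qed.

(** Crossing depends only on the order of the end points, so a map that is increasing on the end
points in play transports the whole situation. *)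
Lemma regular_mdiags_map k n (A : pred nat) g (X Y : {fset nat * nat}) :
  {in A &, {mono g : x y / x < y}} ->
  (forall e, e \in X -> (e.1 \in A) && (e.2 \in A)) ->
  (forall f, f \in Y <-> exists2 e, e \in X & f = (g e.1, g e.2)) ->
  regular uncrossed k n Y -> regular uncrossed k n X.
Proof.
move=> mono XA XY; have inj : {in A &, injective g}.
  move=> x y xA yA gxy; apply/eqP; rewrite eqn_leq leqNgt -(mono y x) // gxy ltnn /=.
  by rewrite leqNgt -(mono x y) // gxy ltnn.
pose G (e : nat * nat) := (g e.1, g e.2).
apply: (proj2 (@regular_iso _ _ uncrossed uncrossed G _ _ _ Y _ _ _)).
- move=> [x y] [z t] /XA/andP[/= xA yA] /XA/andP[/= zA tA] [/(inj _ _ xA zA)-> e2].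
  by rewrite (inj _ _ yA tA e2).
- apply/fsetP => f; apply/imfsetP/idP => [[e /= eX ->]|/XY[e eX ->]]; last by exists e.
  by apply/XY; exists e.
- move=> [x y] [z t] /XA/andP[/= xA yA] /XA/andP[/= zA tA].
  rewrite /uncrossed /cross /= !mono //; congr (~~ _ && _).
  by rewrite !xpair_eqE !(inj_in_eq inj).
Qed.

Section Link.
Variables (N i q : nat).
Hypotheses (q0 : 0 < q) (jN : i + q * m + 1 < N) (s : q * m + 1 < N.-1).
Local Notation j := (i + q * m + 1).

(** [inner] and [outer] are the diagonals of the two polygons into which (i, j) cuts the N-gon,
for j = i + q * m + 1. *)
Definition inner := [fset f in mdiags N | [&& i <= f.1, f.2 <= j & f != (i, j)]].
Definition outer := [fset f in mdiags N | [&& ~~ (i < f.1 < j), ~~ (i < f.2 < j) & f != (i, j)]].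

Lemma in_inner f : (f \in inner) = mdiag N f && [&& i <= f.1, f.2 <= j & f != (i, j)].
Proof. by rewrite [LHS]in_sep in_mdiags. Qed.

Lemma in_outer f :
  (f \in outer) = mdiag N f && [&& ~~ (i < f.1 < j), ~~ (i < f.2 < j) & f != (i, j)].
Proof. by rewrite [LHS]in_sep in_mdiags. Qed.

Lemma mdiag_lt f : mdiag N f -> f.1 < f.2.
Proof. by move=> /and4P[/ltnW]. Qed.

Lemma link_split : nbr uncrossed (mdiags N) (i, j) = inner `|` outer.
Proof.
apply/fsetP => -[x y]; rewrite in_nbr in_fsetU in_inner in_outer in_mdiags -andb_orr.
case: (boolP (mdiag _ _)) => //= /mdiag_lt /= xy.
rewrite /uncrossed /cross eq_sym !xpair_eqE /=; set t := i + _ + 1.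
have it : i < t by rewrite /t; lia.
clear -xy it; have [xi|xi] := eqVneq x i; have [yt|yt] := eqVneq y t; lia.
Qed.

Lemma inner_outer_disjoint : [disjoint inner & outer]%fset.
Proof.
apply/fdisjointP => -[x y]; rewrite in_inner in_outer xpair_eqE => /andP[/mdiag_lt /= xy h].
apply/negP => /andP[_]; set t := i + _ + 1 in h *.
have it : i < t by rewrite /t; lia.
clear -xy it h; lia.
Qed.

Lemma inner_outer_uncrossed : {in inner & outer, forall e f, uncrossed e f}.
Proof.
move=> [x y] [z t]; rewrite in_inner in_outer.
move=> /andP[/mdiag_lt /= xy h] /andP[/mdiag_lt /= zt h'].
rewrite /uncrossed /cross !xpair_eqE /= in h h' *; set u := i + _ + 1 in h h' *.
have iu : i < u by rewrite /u; lia.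
clear -xy zt iu h h'; move: h h' => /and3P[h1 h2 h3] /and3P[h4 h5 h6].
apply/andP; split; last lia.
by apply: contraNN h3 => /andP[/eqP ? /eqP ?]; subst; lia.
Qed.

(** Translation by i. *)
Lemma regular_inner n : regular uncrossed m.+1 n (mdiags (q * m + 2)) ->
  regular uncrossed m.+1 n inner.
Proof.
apply: (regular_mdiags_map (A := fun x => i <= x) (g := fun x => x - i)).
- by move=> x y; rewrite -!topredE /= => ix iy; lia.
- by move=> [x y]; rewrite in_inner -!topredE => /andP[/mdiag_lt /= xy]; lia.
move=> [x y]; rewrite in_mdiags; split=> [/mdiagP[p [p0 e h1 h2]]|[[z t]]].
  exists (x + i, y + i); last by rewrite /= !addnK.
  rewrite in_inner xpair_eqE /=; apply/andP; split; last lia.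
  apply/mdiagP; exists p; split=> //; lia.
rewrite in_inner xpair_eqE => /andP[/mdiagP[p [p0 e h1 h2]] /= h] [-> ->].
by apply/mdiagP; exists p; split=> //; lia.
Qed.

(** The vertices strictly between i and j are collapsed. *)
Lemma regular_outer n : regular uncrossed m.+1 n (mdiags (N - q * m)) ->
  regular uncrossed m.+1 n outer.
Proof.
have qm : 0 < q * m by rewrite muln_gt0 q0.
pose g x := if x <= i then x else x - q * m.
apply: (regular_mdiags_map (A := fun x => ~~ (i < x < j)) (g := g)).
- move=> x y; rewrite -!topredE /g /= => ix iy.
  by case: (leqP x i); case: (leqP y i); lia.
- by move=> [x y]; rewrite in_outer => /andP[_ /and3P[h1 h2 _]]; apply/andP.
move=> [x y]; rewrite in_mdiags; split=> [/mdiagP[p [p0 e h1 h2]]|[[z t]]].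
  have pm : 0 < p * m by rewrite muln_gt0 p0.
  pose h x := if x <= i then x else x + q * m.
  exists (h x, h y).
    rewrite in_outer xpair_eqE /h /=; have [xi|xi] := leqP x i; have [yi|yi] := leqP y i.
    + by apply/andP; split; [apply/mdiagP; exists p; split=> //; lia | lia].
    + by apply/andP; split;
        [apply/mdiagP; exists (p + q); rewrite mulnDl; split=> //; lia | lia].
    + lia.
    + by apply/andP; split; [apply/mdiagP; exists p; split=> //; lia | lia].
  by rewrite /g /h /=; congr pair; [case: (leqP x i) | case: (leqP y i)]; case: ifP; lia.
rewrite in_outer xpair_eqE => /andP[/mdiagP[p [p0 e h1 h2]] /= h]; rewrite /g => -[-> ->].
have [zi|zi] := leqP z i; have [ti|ti] := leqP t i.
- by apply/mdiagP; exists p; split=> //=; lia.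
- apply/mdiagP; exists (p - q); rewrite mulnBl.
  have lt : q * m < p * m by lia.
  rewrite ltn_pmul2r // in lt.
  by split=> //=; lia.
- lia.
- by apply/mdiagP; exists p; split=> //=; lia.
Qed.

End Link.

(** The link of a diagonal is the join of the complexes of the two polygons that it cuts off. *)
Theorem regular_mdiags n : regular uncrossed m.+1 n (mdiags (n.+1 * m + 2)).
Proof.
have [k] := ubnP n; elim: k n => // k IH [|n] nk; first by rewrite mul1n; apply: mdiags_small.
have nm : m <= n.+1 * m by rewrite leq_pmull.
split.
- apply/fset0Pn; exists (0, 0 + 1 * m + 1); rewrite in_mdiags; apply/mdiagP; exists 1.
  rewrite mulSn; split=> //; lia.
- by move=> ->; rewrite card_mdiags.
- move=> [i j]; rewrite in_mdiags => /mdiagP[q [q0 -> jN s]].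
  have qn : q <= n.+1.
    have lt : q * m < n.+2 * m by lia.
    by rewrite ltn_pmul2r // in lt.
  have en : n = q.-1 + (n.+1 - q) by lia.
  rewrite link_split // [X in regular _ _ X]en.
  apply: regular_join.
  - exact: uncrossed_sym.
  - exact: inner_outer_disjoint.
  - exact: inner_outer_uncrossed.
  - by apply: regular_inner => //; have := IH q.-1; rewrite prednK //; apply; lia.
  apply: regular_outer => //; have -> : n.+2 * m + 2 - q * m = (n.+1 - q).+1 * m + 2.
    have -> : n.+2 = q + (n.+1 - q).+1 by lia.
    by rewrite mulnDl; lia.
  by apply: IH; lia.
Qed.

End Polygon.

Lemma in_diagonals N (e : 'I_N * 'I_N) : (e \in diagonals) = (e.1 < e.2) && ~~ side e.
Proof. by rewrite !inE. Qed.

Lemma gap N (P : {set 'I_N}) (a b : 'I_N) x : a \in P -> b \in P -> a <= x < b ->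
  exists u v, [/\ u \in P, v \in P, u <= x < v & forall k, k \in P -> ~~ (u < k < v)].
Proof.
move=> aP bP /andP[ax xb].
have Pa : (a \in P) && (a <= x) by rewrite aP.
have Pb : (b \in P) && (x < b) by rewrite bP.
case: (@arg_maxnP _ a (fun u => (u \in P) && (u <= x)) (@nat_of_ord N) Pa) => u /andP[uP ux] um.
case: (@arg_minnP _ b (fun u => (u \in P) && (x < u)) (@nat_of_ord N) Pb) => v /andP[vP xv] vm.
exists u, v; rewrite ux xv; split=> // k kP; apply/negP => /andP[uk kv].
case: (leqP k x) => kx.
  by have := um k; rewrite kP kx => /(_ isT); lia.
by have := vm k; rewrite kP kx => /(_ isT); lia.
Qed.

(** * Regions cut out by noncrossing diagonals *)

Section Regions.
Context {N : nat}.
Hypothesis N2 : 2 < N.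
Variable D : {fset 'I_N * 'I_N}.
Hypothesis DX : D `<=` diagonals.
Implicit Types (e f g : 'I_N * 'I_N) (P : {set 'I_N}).

Let N0 : 0 < N.
Proof. exact: ltn_trans N2. Qed.
Let N1 : N.-1 < N.
Proof. by rewrite ltn_predL. Qed.

(** The outermost edge of the polygon: each region lies just under one edge, a member of D or
this one, so that [edge] indexes the regions. *)
Definition rim : 'I_N * 'I_N := (Ordinal N0, Ordinal N1).

Definition edge e := (e == rim) || (e \in D).

Lemma D_diagonal e : e \in D -> e.1.+1 < e.2 /\ e.2 - e.1 < N.-1.
Proof.
move/(fsubsetP DX); rewrite in_diagonals /side => h.
have := ltn_ord e.2; lia.
Qed.

Lemma edge_long e : edge e -> e.1.+1 < e.2.
Proof. by case/orP => [/eqP->/=|/D_diagonal[]//]; lia. Qed.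

Lemma rim_notin : rim \notin D.
Proof. by apply/negP => /D_diagonal[/= _]; lia. Qed.

Definition under e f := [&& f \in D, f != e, e.1 <= f.1 & f.2 <= e.2].

(** The vertices of the region just below e, that is, those visible from e. *)
Definition cell e : {set 'I_N} :=
  [set k : 'I_N | (e.1 <= k <= e.2) && [forall f, under e f ==> ~~ (f.1 < k < f.2)]].

Lemma cellP e (k : 'I_N) :
  reflect (e.1 <= k <= e.2 /\ forall f, under e f -> ~~ (f.1 < k < f.2)) (k \in cell e).
Proof.
rewrite inE; apply: (iffP andP) => -[-> h]; split=> //.
  by move=> f; apply/implyP; apply: (forallP h).
by apply/forallP => f; apply/implyP; apply: h.
Qed.

Lemma cell_fst e : edge e -> e.1 \in cell e.
Proof.
move=> /edge_long el; apply/cellP; split; first lia.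
by move=> f /and4P[_ _ h _]; lia.
Qed.

Lemma cell_snd e : edge e -> e.2 \in cell e.
Proof.
move=> /edge_long el; apply/cellP; split; first lia.
by move=> f /and4P[_ _ _ h]; lia.
Qed.

Lemma edge_eq e f : e.1 = f.1 :> nat -> e.2 = f.2 :> nat -> e = f.
Proof. by case: e f => a b [c d] /= /ord_inj-> /ord_inj->. Qed.

Hypothesis nc : noncrossing D.

Lemma edge_cross e f : edge e -> f \in D -> ~~ crossing e f.
Proof.
case/orP => [/eqP-> _|eD fD]; last by move/allP: nc => /(_ e eD)/allP/(_ f fD).
by rewrite /crossing /=; have := ltn_ord f.2; lia.
Qed.

(** If u + 1 is not the next visible vertex, some member of D under e hides it, and starts at u
since u is visible. The longest such member ends at v: its end is visible, as a member of D
hiding it would either cross it or be longer. *)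
Lemma cell_gap e (u v : 'I_N) : edge e -> u \in cell e -> v \in cell e -> u < v ->
  (forall k, k \in cell e -> ~~ (u < k < v)) -> v = u.+1 :> nat \/ under e (u, v).
Proof.
move=> ee /cellP[ue uc] /cellP[ve vc] uv empty.
have [->|long] := eqVneq (v : nat) u.+1; [by left|right].
have u1N : u.+1 < N by have := ltn_ord v; lia.
have [f0 /andP[uf0 f0u]] : exists f, under e f && (f.1 < u.+1 < f.2).
  have : Ordinal u1N \notin cell e by apply/negP => /empty /=; lia.
  rewrite inE negb_and => /orP[/=|]; first lia.
  by rewrite negb_forall => /existsP[f]; rewrite negb_imply negbK /=; exists f.
have f0P : under e f0 && (f0.1 == u) by have := uc f0 uf0; rewrite uf0 -val_eqE /=; lia.
have [f [uf fu fmax]] : exists f, [/\ under e f, f.1 = u &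
    forall g, under e g -> g.1 = u :> nat -> g.2 <= f.2].
  case: (@arg_maxnP _ f0 (fun f => under e f && (f.1 == u)) (fun f => f.2) f0P) => f.
  move=> /andP[uf /eqP fu] fmax; exists f; split=> // g ug gu.
  by apply: fmax; rewrite ug; apply/eqP/ord_inj.
have f0f : f0.2 <= f.2 by apply: fmax => //; case/andP: f0P => _ /eqP->.
have fv : f.2 <= v by have := vc f uf; rewrite fu; lia.
case: (eqVneq f.2 v) => [<-|ne]; first by rewrite -fu -surjective_pairing.
have fv' : f.2 < v by rewrite ltn_neqAle fv andbT val_eqE.
have [g /andP[ug gf]] : exists g, under e g && (g.1 < f.2 < g.2).
  have fin : e.1 <= f.2 <= e.2 by case/and4P: uf => _ _; lia.
  have : f.2 \notin cell e by apply/negP => /empty; lia.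
  rewrite inE fin /= negb_forall => /existsP[g]; rewrite negb_imply negbK; exists g => //.
have fD : f \in D by case/and4P: uf.
have gD : g \in D by case/and4P: ug.
have fe : edge f by rewrite /edge fD orbT.
have := edge_cross fe gD; rewrite /crossing negb_or fu => /andP[ncfg _].
have uf2 : u < f.2 by move: f0u f0f; clear; lia.
have gu : g.1 = u :> nat by have := uc g ug; move: uf2 gf ncfg; clear; lia.
by have := fmax g ug gu; move: gf; clear; lia.
Qed.

(** Consecutive vertices of a cell are joined by sides or members of D ([cell_gap]), and the two
extreme ones by e. Conversely, a member of D between two vertices of the cell is e or hides what
is under it. *)
Lemma region_cell e : edge e -> region D (cell e).
Proof.
move=> ee; have el := edge_long ee; have e1 := cell_fst ee; have e2 := cell_snd ee.
apply/andP; split.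
  have [k ke /andP[k1 k2]] : exists2 k, k \in cell e & e.1 < k < e.2.
    have [/exists_inP//|] := boolP [exists k in cell e, e.1 < k < e.2].
    rewrite negb_exists_in => /forall_inP empty.
    have [h|/and4P[_]] := cell_gap ee e1 e2 (ltnW el) empty; first lia.
    by rewrite -surjective_pairing eqxx.
  apply/card_gt2P; exists e.1, k, e.2; split=> //.
  by rewrite -!val_eqE /=; split; lia.
apply/forall_inP => i iP; apply/forall_inP => j jP; apply/implyP => ij; apply/eqP.
have [ie ic] := cellP _ _ iP; have [je jc] := cellP _ _ jP.
apply/orP/orP => [[/forall_inP h|/forall_inP h]|].
- case: (cell_gap ee iP jP ij h) => [e_j|/and4P[ijD _ _ _]]; last by right.
  by left; rewrite /side /= e_j eqxx.
- have -> : (i, j) = e.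
    have := h _ e1; have := h _ e2; move=> h1 h2.
    by apply: edge_eq => /=; lia.
  by case/orP: ee => [/eqP->|->]; [left; rewrite /side /= !eqxx orbT | right].
case=> [/orP[/=/eqP e_j|/= h]|ijD].
- by left; apply/forall_inP => k _; rewrite e_j; lia.
- by right; apply/forall_inP => k _; have := ltn_ord k; lia.
have [eij|ne] := eqVneq (i, j) e.
  by right; apply/forall_inP => k /cellP[+ _]; rewrite -eij.
left; apply/forall_inP => k /cellP[_ h]; apply: (h (i, j)).
by rewrite /under ijD ne /=; move: ie je; clear; lia.
Qed.

Lemma cell_inj e f : edge e -> edge f -> cell e = cell f -> e = f.
Proof.
move=> ee ef c; have := cell_fst ee; have := cell_snd ee; have := cell_fst ef; have := cell_snd ef.
rewrite c => _ _ /cellP[h1 _] /cellP[h2 _].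
have := cell_fst ef; have := cell_snd ef; rewrite -c => /cellP[h3 _] /cellP[h4 _].
by apply: edge_eq; lia.
Qed.

(** The smallest and the largest vertex of a region P are joined by an edge e, for they are
neighbours on its hull. The other pairs of neighbours are sides or members of D, which do not
cross members of D under e; so a vertex is hidden under e exactly when it is outside P. *)
Lemma region_edge P : region D P -> exists2 e, edge e & P = cell e.
Proof.
move=> /andP[P3 /forall_inP rP].
have [a0 aP0] : exists a, a \in P by apply/card_gt0P; lia.
case: (@arg_minnP _ a0 (fun u => u \in P) (@nat_of_ord N) aP0) => a aP amin.
case: (@arg_maxnP _ a0 (fun u => u \in P) (@nat_of_ord N) aP0) => b bP bmax.
have key i j : i \in P -> j \in P -> i < j -> consecutive P i j = (side (i, j) || ((i, j) \in D)).
  by move=> iP jP ij; have /forall_inP/(_ j jP) := rP i iP; rewrite ij => /eqP.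
have [c cP /andP[ac cb]] : exists2 c, c \in P & a < c < b.
  case/card_gt2P: P3 => x [y [z [[xP yP zP] [xy yz zx]]]].
  have ha := amin x xP; have hb := amin y yP; have hc := amin z zP.
  have hx := bmax x xP; have hy := bmax y yP; have hz := bmax z zP.
  move: xy yz zx; rewrite -!val_eqE /= => xy yz zx.
  have [hx'|hx'] := boolP (a < x < b); first by exists x.
  have [hy'|hy'] := boolP (a < y < b); first by exists y.
  exists z => //; move: xy yz zx ha hb hc hx hy hz hx' hy'; clear; rewrite /geq /=; lia.
have gap_edge u v : u \in P -> v \in P -> u < v -> (forall k, k \in P -> ~~ (u < k < v)) ->
    v = u.+1 :> nat \/ (u, v) \in D /\ (u, v) != (a, b).
  move=> uP vP uv empty; have : consecutive P u v by apply/orP; left; apply/forall_inP.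
  have nab : (u, v) != (a, b).
    by apply/negP => /eqP[ua vb]; have := empty c cP; rewrite ua vb ac cb.
  rewrite key // => /orP[/orP[/= /eqP->|/= h]|]; [by left| |by right].
  case/negP: nab; apply/eqP/edge_eq => /=.
    by have := amin u uP; move: h; clear; lia.
  by have := bmax v vP; have := ltn_ord b; move: h; rewrite /geq /=; clear; lia.
have ab : a < b by lia.
have ee : edge (a, b).
  have : consecutive P a b.
    by apply/orP; right; apply/forall_inP => k kP; have := amin k kP; have := bmax k kP; lia.
  rewrite key // => /orP[/orP[/=/eqP h|/= h]|h]; [lia| |by rewrite /edge h orbT].
  by apply/orP; left; apply/eqP/edge_eq => /=; lia.
exists (a, b) => //; apply/setP => k; apply/idP/cellP => /= [kP|[kab kc]].
  split; first by have := amin k kP; have := bmax k kP; lia.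
  move=> f /and4P[fD ne /= af fb]; apply/negP => /andP[fk kf].
  have fe : edge f by rewrite /edge fD orbT.
  have f1P : f.1 \in P.
    have [|u [v [uP vP /andP[uf fv] empty]]] := @gap _ P a k f.1 aP kP; first by rewrite af fk.
    have [<-//|ne1] := eqVneq u f.1.
    have uf1 : u < f.1 by rewrite ltn_neqAle val_eqE ne1.
    have ek := empty k kP.
    have [|[uvD _]] := gap_edge u v uP vP (ltn_trans uf1 fv) empty.
      by move: uf1 fv; clear; lia.
    have := edge_cross fe uvD; rewrite /crossing negb_or => /andP[_].
    by move: uf1 fv fk kf ek; clear; rewrite /=; lia.
  have f2P : f.2 \in P.
    have [|u [v [uP vP /andP[uf fv] empty]]] := @gap _ P k b f.2.-1 kP bP.
      by move: kf fb; clear; lia.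
    have [<-//|ne1] := eqVneq v f.2.
    have uf1 : f.2 < v.
      by rewrite ltn_neqAle eq_sym val_eqE ne1; move: fv; clear; lia.
    have ek := empty k kP.
    have uf2 : u < f.2 by move: uf kf; clear; lia.
    have [|[uvD _]] := gap_edge u v uP vP (ltn_trans uf2 uf1) empty.
      by move: uf1 uf2; clear; lia.
    have := edge_cross fe uvD; rewrite /crossing negb_or => /andP[+ _].
    by move: uf1 uf2 fk kf ek; clear; rewrite /=; lia.
  have f12 : f.1 < f.2 := ltnW (edge_long fe).
  have := key f.1 f.2 f1P f2P f12; rewrite -surjective_pairing fD orbT.
  move=> /orP[/forall_inP/(_ k kP)|/forall_inP h]; first by rewrite fk kf.
  have := h a aP; have := h b bP => hb ha.
  by case/eqP: ne; apply: edge_eq => /=; move: ha hb af fb; clear; lia.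
apply: contraT => kP.
have kb : k < b.
  by rewrite ltn_neqAle; case/andP: kab => _ ->; rewrite andbT val_eqE; apply: contraNneq kP => ->.
have [|u [v [uP vP /andP[uk kv] empty]]] := @gap _ P a b k aP bP; first lia.
have uk' : u < k by rewrite ltn_neqAle uk andbT val_eqE; apply: contraNneq kP => <-.
have [|[uvD ne]] := gap_edge u v uP vP (ltn_trans uk' kv) empty.
  by move: uk' kv; clear; lia.
have := kc (u, v); rewrite /under uvD ne /= uk' kv.
by rewrite (amin u uP) (bmax v vP : v <= b) => /(_ isT).
Qed.

(** Regions correspond to members of D and the rim. *)
Lemma card_regions : #|region D| = (#|` D|).+1.
Proof.
have -> : #|region D| = #|[set cell e | e in rim |` D]|.
  apply: eq_card => P; rewrite unfold_in.
  apply/idP/imsetP => [/region_edge[e ee ->]|[e eE ->]].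
    by exists e => //; rewrite in_fset1U.
  by apply: region_cell; rewrite /edge -in_fset1U.
rewrite card_in_imset; last first.
  by move=> e f; rewrite !in_fset1U; apply: cell_inj.
by rewrite (card_uniqP (fset_uniq _)) -[size _]/(#|` rim |` D|) cardfsU1 rim_notin.
Qed.

End Regions.

Lemma in_set_sep (T : finType) (A : {set T}) (P : pred T) x :
  (x \in [set y in A | P y]) = (x \in A) && P x.
Proof. by rewrite inE. Qed.

(** * Angulations as maximal sets of diagonals *)

Section Steps.
Context {N : nat}.
Hypothesis N2 : 2 < N.
Variable D : {fset 'I_N * 'I_N}.
Hypotheses (DX : D `<=` diagonals) (nc : noncrossing D).
Implicit Types (e f g : 'I_N * 'I_N).

(** The number of gaps of the cell between e.1 and x. *)
Definition steps e x := #|[set k in cell D e | e.1 < k <= x]|.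

Lemma steps_fst e : steps e e.1 = 0.
Proof.
apply/eqP; rewrite cards_eq0; apply/eqP/setP => k; rewrite in_set_sep in_set0.
by rewrite ltnNge andNb andbF.
Qed.

Lemma steps_gap e (u v : 'I_N) : u \in cell D e -> v \in cell D e -> u < v ->
  (forall k, k \in cell D e -> ~~ (u < k < v)) -> steps e v = (steps e u).+1.
Proof.
move=> uc vc uv empty; have [ue _] := cellP _ _ _ uc; rewrite /steps.
have -> : [set k in cell D e | e.1 < k <= v] = v |: [set k in cell D e | e.1 < k <= u].
  apply/setP => k; rewrite in_setU1 !in_set_sep.
  have [->|kv] := eqVneq k v; first by rewrite vc; move: ue uv; clear; lia.
  case kc : (k \in cell D e) => //=; have := empty k kc.
  by move: kv ue uv; rewrite -val_eqE /=; clear; lia.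
rewrite cardsU1 in_set_sep; suff -> : (e.1 < v <= u) = false by rewrite andbF.
by move: uv; clear; lia.
Qed.

Lemma steps_snd e : edge N2 D e -> (steps e e.2).+1 = #|cell D e|.
Proof.
move=> ee; have e1 := cell_fst DX ee.
rewrite (cardsD1 e.1) e1 add1n; congr _.+1; apply: eq_card => k.
rewrite in_setD1 in_set_sep.
case: (boolP (k \in cell D e)) => [/cellP[h _]|]; last by rewrite andbF.
by rewrite -val_eqE /=; move: h; clear; lia.
Qed.

(** Every gap of a cell is a side or a member of D, so its length is congruent to 1 modulo m. *)
Lemma steps_mod m e (v : 'I_N) : edge N2 D e -> (forall f, under D e f -> m %| (f.2 - f.1).-1) ->
  v \in cell D e -> exists q, v = e.1 + steps e v + q * m :> nat.
Proof.
move=> ee dvd; have [k] := ubnP (v : nat); elim: k v => // k IH v vk vc.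
have [ev _] := cellP _ _ _ vc.
have [->|ne] := eqVneq v e.1; first by exists 0; rewrite steps_fst; lia.
have e1v : e.1 < v by rewrite ltn_neqAle eq_sym val_eqE ne; case/andP: ev.
have [|u [w [uc wc uw empty]]] := @gap _ (cell D e) e.1 v v.-1 (cell_fst DX ee) vc.
  by move: e1v; clear; lia.
have wv : w = v.
  by apply: ord_inj; have := empty v vc; move: uw e1v; clear; lia.
rewrite {w wc}wv in uw empty.
have uv : u < v by move: uw; clear; lia.
have [|q uE] := IH u _ uc; first by move: uv vk; clear; lia.
have sE := steps_gap uc vc uv empty.
case: (cell_gap DX nc ee uc vc uv empty) => [vE|/dvd/= /dvdnP[q' e']].
  by exists q; rewrite sE; move: vE uE; clear; lia.
by exists (q + q'); rewrite sE mulnDl; move: e' uE uv; clear; lia.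
Qed.

(** As x grows, the number of steps grows by at most one at a time. *)
Lemma steps_value e s : 0 < s <= steps e e.2 ->
  exists2 v, v \in cell D e & steps e v = s.
Proof.
move=> /andP[s0 se]; have ex : exists x, s <= steps e x by exists e.2.
case: (ex_minnP ex) => x sx xmin.
have x0 : 0 < x.
  rewrite lt0n; apply: contraTneq sx => ->; rewrite -ltnNge.
  by rewrite [steps e 0](_ : _ = 0) //; apply/eqP; rewrite cards_eq0; apply/eqP/setP => k;
  rewrite in_set_sep in_set0 leqn0 andbC; case: eqP => [->|_]; rewrite ?andbF.
have prev : steps e x.-1 < s by rewrite ltnNge; apply/negP => /xmin; rewrite leqNgt prednK // leqnn.
have [/exists_inP[v vc /eqP vx]|none] := boolP [exists v in cell D e, v == x :> nat].
  exists v => //; apply/eqP; rewrite eqn_leq vx sx andbT.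
  apply: leq_trans prev; rewrite /steps.
  apply: leq_trans (subset_leq_card (_ : _ \subset v |: [set k in cell D e | e.1 < k <= x.-1])) _.
    apply/subsetP => k; rewrite in_setU1 !in_set_sep => /andP[-> h].
    by rewrite -val_eqE /= vx; move: h; clear; lia.
  by rewrite cardsU1; case: (_ \notin _).
suff : steps e x = steps e x.-1 by move: sx prev; clear; lia.
apply: eq_card => k; rewrite !in_set_sep.
case kc : (k \in cell D e) => //=.
have : k != x :> nat by apply: contra none => kx; apply/exists_inP; exists k.
by move: x0; clear; lia.
Qed.

End Steps.

Section Angulations.
Variables m n : nat.
Hypotheses (m0 : 0 < m) (n1 : 1 < n).
Local Notation N := (m * n + 2).
Implicit Types (e f g : 'I_N * 'I_N) (D : {fset 'I_N * 'I_N}).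

Definition polygon_mdiags : {fset 'I_N * 'I_N} := [fset e in diagonals | m %| (e.2 - e.1).-1].
Local Notation X := polygon_mdiags.

Definition polygon_adj : rel ('I_N * 'I_N) :=
  fun e f => [&& e \in X, f \in X, e != f & ~~ crossing e f].
Local Notation adj := polygon_adj.

Lemma polygon_adj_sym : symmetric adj.
Proof. by move=> e f; rewrite /polygon_adj /crossing andbCA eq_sym orbC. Qed.

Lemma polygon_adj_irr : irreflexive adj.
Proof. by move=> e; rewrite /polygon_adj eqxx !andbF. Qed.

Lemma in_polygon_mdiags e : (e \in X) = mdiag m N (e.1 : nat, e.2 : nat).
Proof.
rewrite [LHS]in_sep in_diagonals /mdiag /side /=; have h1 := ltn_ord e.1; have h2 := ltn_ord e.2.
case: (m %| _); rewrite ?andbF ?andbT //.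
by move: (nat_of_ord e.1) (nat_of_ord e.2) h1 h2 => a b; clear; lia.
Qed.

Lemma polygon_size : 2 < N.
Proof. by rewrite addn2 !ltnS muln_gt0 m0 ltnW. Qed.

Lemma regular_polygon : regular adj m.+1 n.-1 X.
Proof.
pose v (e : 'I_N * 'I_N) := (e.1 : nat, e.2 : nat).
have vinj : injective v by move=> e f [h1 h2]; apply: edge_eq.
apply: (proj2 (@regular_iso _ _ adj uncrossed v _ _ _ (mdiags m N) _ _ _)).
- by move=> e f _ _ /vinj.
- apply/fsetP => -[i j]; rewrite [RHS]in_mdiags; apply/imfsetP/idP => /= [[e eX ->]|h].
    by rewrite in_polygon_mdiags in eX.
  have [/= h1 h2 _ _] := and4P h; have iN : i < N by move: h1 h2; clear; lia.
  by exists (Ordinal iN, Ordinal h2); rewrite ?in_polygon_mdiags.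
- by move=> e f eX fX; rewrite /polygon_adj eX fX /uncrossed (inj_eq vinj).
by have := regular_mdiags m0 n.-1; rewrite mulnC prednK // ltnW.
Qed.

Section Clique.
Variable D : {fset 'I_N * 'I_N}.
Hypotheses (DX : D `<=` diagonals) (nc : noncrossing D).
Local Notation N2 := polygon_size.

(** All cells have m + 1 gaps, whose lengths are congruent to 1 modulo m by induction; so the
length of e is congruent to m + 1, that is, to 1. *)
Lemma angulation_mdiags : (forall P, region D P -> #|P| = m.+2) -> D `<=` X.
Proof.
move=> size_cell; suff H k e : e.2 - e.1 < k -> e \in D -> m %| (e.2 - e.1).-1.
  by apply/fsubsetP => e eD; rewrite [e \in X]in_sep (fsubsetP DX _ eD) (H _ e (ltnSn _)).
elim: k e => // k IH e ek eD.
have ee : edge N2 D e by rewrite /edge eD orbT.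
have dvd f : under D e f -> m %| (f.2 - f.1).-1.
  case/and4P => fD ne f1 f2; have [fl _] := D_diagonal N2 DX fD.
  have ne' : ~ (e.1 = f.1 :> nat /\ e.2 = f.2 :> nat).
    by case=> h1 h2; case/eqP: ne; apply/esym/edge_eq.
  by apply: IH => //; move: ne' f1 f2 fl ek; clear; lia.
have [q e2] := steps_mod DX nc ee dvd (cell_snd DX ee).
have := steps_snd DX ee; rewrite (size_cell _ (region_cell DX nc ee)) => -[s].
rewrite {}s in e2; apply/dvdnP; exists q.+1; rewrite mulSn.
by move: e2; clear; lia.
Qed.

(** By [steps_mod] the number of gaps is congruent to 1 modulo m, and it exceeds 1, so it is at
least m + 1. If it is larger, cutting off m + 1 gaps with the diagonal from e.1 to the vertex
after m + 1 steps enlarges D, which contradicts the rank of the complex. *)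
Lemma cell_size e : D `<=` X -> #|` D| = n.-1 -> edge N2 D e -> #|cell D e| = m.+2.
Proof.
move=> subX cardD ee; have dvdD f : f \in D -> m %| (f.2 - f.1).-1.
  by move=> /(fsubsetP subX); rewrite [f \in X]in_sep => /andP[].
have el := edge_long DX ee.
have dvd f : under D e f -> m %| (f.2 - f.1).-1 by case/and4P => /dvdD.
have size3 : 2 < #|cell D e| by case/andP: (region_cell DX nc ee).
have [q e2] := steps_mod DX nc ee dvd (cell_snd DX ee).
have se := steps_snd DX ee; rewrite -se in size3 *; congr _.+1.
have [q' e2'] : exists q', e.2 = e.1 + 1 + q' * m :> nat.
  have : m %| (e.2 - e.1).-1.
    by case/orP: ee => [/eqP-> /=|/dvdD //]; rewrite subn0 addn2 /= dvdn_mulr.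
  by case/dvdnP => q' h; exists q'; move: h el; clear; lia.
have ge : m < steps D e e.2.
  have qq : q < q' by rewrite -(ltn_pmul2r m0); move: e2 e2' size3; clear; lia.
  have := leq_mul qq (leqnn m); rewrite mulSn; move: e2 e2'; clear; lia.
apply/eqP; rewrite eqn_leq ge andbT leqNgt; apply/negP => large.
have [|v vc vs] := @steps_value _ D e m.+1; first by rewrite ltnW.
have [ve vu] := cellP _ _ _ vc.
have v1 : e.1 < v.
  rewrite ltn_neqAle; case/andP: ve => -> _; rewrite andbT; apply/negP => /eqP/ord_inj h.
  by move: vs; rewrite -h steps_fst.
have v2 : v < e.2.
  rewrite ltn_neqAle; case/andP: ve => _ ->; rewrite andbT; apply/negP => /eqP h.
  by move: large; rewrite -h vs ltnn.
have [p vE] := steps_mod DX nc ee dvd vc; rewrite vs in vE.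
pose g := (e.1, v).
have gD : g \notin D.
  have ge' : g != e by apply/eqP => h; move: v2; rewrite -h ltnn.
  apply/negP => gD; have ug : under D e g by rewrite /under gD ge' leqnn ltnW.
  have : steps D e v = (steps D e e.1).+1.
    by apply: (steps_gap (cell_fst DX ee) vc v1) => k /cellP[_ /(_ g ug)].
  by rewrite vs steps_fst => -[m_0]; move: m0; rewrite m_0.
have gX : g \in X.
  rewrite in_polygon_mdiags; apply/(mdiagP m0); exists p.+1; rewrite mulSn; split=> //.
    by move: vE; clear; rewrite /=; lia.
  by have := ltn_ord e.2; move: vE v2; clear; rewrite /=; lia.
have cross f : f \in D -> ~~ crossing g f.
  move=> fD; have c1 := edge_cross DX nc ee fD; apply/negP; rewrite /crossing /= => /orP[|] h.
    have uf : under D e f.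
      rewrite /under fD /=; apply/and3P; split.
      - by apply/negP => /eqP fe; move: h; rewrite fe ltnn.
      - by move: h; clear; lia.
      - by move: c1 h v2; rewrite /crossing; clear; lia.
    by have := vu f uf; move: h; clear; lia.
  by move: c1 h v2 v1; rewrite /crossing; clear; lia.
have : clique adj (g |` D).
  apply/cliqueP => x y; rewrite !in_fset1U.
  case/orP => [/eqP->|xD]; case/orP => [/eqP->|yD] nxy.
  - by case/eqP: nxy.
  - by rewrite /polygon_adj gX (fsubsetP subX _ yD) nxy cross.
  - by rewrite polygon_adj_sym /polygon_adj gX (fsubsetP subX _ xD) eq_sym nxy cross.
  - rewrite /polygon_adj (fsubsetP subX _ xD) (fsubsetP subX _ yD) nxy.
    by move/allP: nc => /(_ x xD)/allP/(_ y yD).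
move/(clique_size regular_polygon); rewrite fsubUset fsub1set gX => /(_ subX).
by rewrite cardfsU1 gD cardD add1n ltnn.
Qed.

End Clique.

Lemma angulationsE : angulations m n = cliques adj n.-1 X.
Proof.
apply/fsetP => D; rewrite [LHS]in_sep fpowersetE in_cliques.
apply/andP/and3P => [[DX /and4P[cD nc _ /forallP sz]]|[subX cD sz]].
  have DX' : D `<=` X.
    by apply: angulation_mdiags => // P rP; apply/eqP; apply: implyP (sz P) rP.
  split=> //; apply/cliqueP => x y xD yD nxy.
  rewrite /polygon_adj !(fsubsetP DX') // nxy.
  by move/allP: nc => /(_ x xD)/allP/(_ y yD).
have DX : D `<=` diagonals.
  by apply/fsubsetP => e /(fsubsetP subX); rewrite [e \in X]in_sep => /andP[].
have nc : noncrossing D.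
  apply/allP => x xD; apply/allP => y yD; have [<-|nxy] := eqVneq x y.
    by rewrite /crossing !ltnn andbF.
  by have /and4P[] := cliqueP _ _ cD x y xD yD nxy.
split=> //; apply/and4P; split=> //.
  by rewrite (card_regions polygon_size DX nc) (eqP sz) prednK // ltnW.
apply/forallP => P; apply/implyP => /(region_edge polygon_size DX nc)[e ee ->].
by rewrite (cell_size DX nc subX (eqP sz) ee).
Qed.

Lemma angulation_complexE : angulation_complex m n = clique_complex adj X.
Proof.
apply/fsetP => S; rewrite in_clique_complex /angulation_complex angulationsE.
apply/bigfcupP/andP => [[D]|[SX cS]].
  rewrite andbT in_cliques fpowersetE => /and3P[DX cD _] SD.
  by rewrite (fsubset_trans SD DX) (sub_clique SD cD).
have [D DF SD] := clique_extend polygon_adj_sym polygon_adj_irr regular_polygon SX cS.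
by exists D; rewrite ?andbT ?fpowersetE.
Qed.

Theorem angulation_pure_EKR : n <= 5 -> pure_EKR (angulation_complex m n).
Proof.
move=> n5; rewrite angulation_complexE.
apply: (@pure_EKR_regular _ _ polygon_adj_sym polygon_adj_irr m.+1 n.-1) => //.
- exact: regular_polygon.
- by move: n1 n5; clear; lia.
- by move=> e f /andP[].
Qed.

End Angulations.

(** * Root systems, the bipartite Coxeter element and its Euler form *)

Import Order.TTheory GRing.Theory Num.Theory.
Local Open Scope ring_scope.

Section Dot.
Context {R : realType} {d : nat}.
Implicit Types (a b c : 'rV[R]_d).

Lemma dotE a b : dot a b = \sum_j a 0 j * b 0 j.
Proof. by rewrite /dot mxE; apply: eq_bigr => j _; rewrite mxE. Qed.

Lemma dotC a b : dot a b = dot b a.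
Proof. by rewrite !dotE; apply: eq_bigr => j _; rewrite mulrC. Qed.

Lemma dotDr a b c : dot a (b + c) = dot a b + dot a c.
Proof. by rewrite /dot linearD /= mulmxDr mxE. Qed.

Lemma dotZr a k b : dot a (k *: b) = k * dot a b.
Proof. by rewrite /dot linearZ /= -scalemxAr mxE. Qed.

Lemma dotNr a b : dot a (- b) = - dot a b.
Proof. by rewrite -scaleN1r dotZr mulN1r. Qed.

Lemma dot0r a : dot a 0 = 0.
Proof. by rewrite -(scale0r 0) dotZr mul0r. Qed.

Lemma dotDl a b c : dot (a + b) c = dot a c + dot b c.
Proof. by rewrite dotC dotDr !(dotC c). Qed.

Lemma dotZl a k b : dot (k *: a) b = k * dot a b.
Proof. by rewrite dotC dotZr dotC. Qed.

Lemma dotNl a b : dot (- a) b = - dot a b.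
Proof. by rewrite dotC dotNr dotC. Qed.

Lemma dot0l a : dot 0 a = 0.
Proof. by rewrite dotC dot0r. Qed.

Lemma dot_sumr (I : Type) (s : seq I) (P : pred I) a (F : I -> 'rV[R]_d) :
  dot a (\sum_(i <- s | P i) F i) = \sum_(i <- s | P i) dot a (F i).
Proof. by apply: (big_morph (dot a)) => [b c|]; rewrite ?dotDr ?dot0r. Qed.

Lemma dot_suml (I : Type) (s : seq I) (P : pred I) a (F : I -> 'rV[R]_d) :
  dot (\sum_(i <- s | P i) F i) a = \sum_(i <- s | P i) dot (F i) a.
Proof. by rewrite dotC dot_sumr; apply: eq_bigr => i _; rewrite dotC. Qed.

Lemma dot_eq0 a : (dot a a == 0) = (a == 0).
Proof.
apply/eqP/eqP => [|->]; last by rewrite dot0l.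
rewrite dotE => h; apply/rowP => j; rewrite [RHS]mxE.
have := psumr_eq0P (fun i _ => sqr_ge0 (a 0 i)) h (i := j) isT.
by move/eqP; rewrite mulf_eq0 orbb => /eqP.
Qed.

Lemma dot_gt0 a : a != 0 -> 0 < dot a a.
Proof.
move=> a0; rewrite lt_neqAle eq_sym dot_eq0 a0 dotE.
by apply: sumr_ge0 => i _; apply: sqr_ge0.
Qed.

Lemma reflectionE a b : reflection a b = b - (2 * dot b a / dot a a) *: a.
Proof. by []. Qed.

Lemma reflection_self a : a != 0 -> reflection a a = - a.
Proof.
move=> a0; rewrite reflectionE mulfK ?dot_eq0 // -{1}[a]scale1r -scalerBl.
by rewrite (_ : 1 - 2 = -1) ?scaleN1r //; ring.
Qed.

End Dot.

Section SimpleSystem.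
Context {R : realType} {d r : nat}.
Local Notation V := 'rV[R]_d.
Variables (Phi : {fset V}) (alpha : r.-tuple V).
Hypotheses (root : root_system Phi) (simp : simple_system Phi alpha).
Local Notation s i := (tnth alpha i).
Local Notation co i b := (coord alpha i b).
Local Notation span := <<alpha>>%VS.
Local Notation pos := (positive_roots Phi alpha).
Implicit Types (b x y : V) (i j : 'I_r) (J : {set 'I_r}).

Let free_alpha : free alpha.
Proof. by case: simp. Qed.

Lemma simple_root i : s i \in Phi.
Proof. by case: simp. Qed.

Lemma root_neq0 b : b \in Phi -> b != 0.
Proof. by case: root => n0 _ _ bP; apply: contraNneq n0 => <-. Qed.

Lemma root_span b : b \in Phi -> b \in span.
Proof. by case: simp => _ _ h /h[]. Qed.

Lemma reflection_root a b : a \in Phi -> b \in Phi -> reflection a b \in Phi.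
Proof. by case: root => _ h _; apply: h. Qed.

Lemma opp_root b : b \in Phi -> - b \in Phi.
Proof. by move=> bP; rewrite -(reflection_self (root_neq0 bP)) reflection_root. Qed.

Lemma simple_neq0 i : s i != 0.
Proof. exact/root_neq0/simple_root. Qed.

Lemma norm_gt0 i : 0 < dot (s i) (s i).
Proof. exact/dot_gt0/simple_neq0. Qed.

Lemma norm_neq0 i : dot (s i) (s i) != 0.
Proof. exact/lt0r_neq0/norm_gt0. Qed.

Lemma simple_span i : s i \in span.
Proof. exact/root_span/simple_root. Qed.

Lemma co_simple i j : co i (s j) = (i == j)%:R.
Proof. by rewrite (tnth_nth 0) coord_free // eq_sym. Qed.

Lemma spanE b : b \in span -> b = \sum_i co i b *: s i.
Proof. by move=> /coord_span {1}->; apply: eq_bigr => i _; rewrite (tnth_nth 0). Qed.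

Lemma co_inj x y : x \in span -> y \in span -> (forall i, co i x = co i y) -> x = y.
Proof.
by move=> xs ys h; rewrite (spanE xs) [RHS](spanE ys); apply: eq_bigr => i _; rewrite h.
Qed.

Lemma posE b : (b \in pos) = (b \in Phi) && [forall i, 0 <= co i b].
Proof. by rewrite !inE. Qed.

Lemma pos_root b : b \in pos -> b \in Phi.
Proof. by rewrite posE => /andP[]. Qed.

Lemma pos_co b i : b \in pos -> 0 <= co i b.
Proof. by rewrite posE => /andP[_ /forallP]. Qed.

Lemma root_sign b : b \in Phi -> b \in pos \/ - b \in pos.
Proof.
move=> bP; case: simp => _ _ /(_ b bP)[_ [h|h]]; [left|right]; rewrite posE.
  by rewrite bP; apply/forallP.
by rewrite opp_root //; apply/forallP => i; rewrite linearN oppr_ge0 h.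
Qed.

Lemma root_pos_co b i : b \in Phi -> 0 < co i b -> b \in pos.
Proof.
move=> bP h; case: (root_sign bP) => // /(pos_co i).
by rewrite linearN oppr_ge0 leNgt h.
Qed.

Lemma pos_opp b : b \in pos -> - b \in pos = false.
Proof.
move=> bp; apply/negP => nbp; case/negP: (root_neq0 (pos_root bp)).
apply/eqP/co_inj; rewrite ?mem0v ?root_span ?pos_root // => i.
apply/eqP; rewrite linear0 eq_le (pos_co i bp) andbT.
by have := pos_co i nbp; rewrite linearN oppr_ge0.
Qed.

Lemma simple_pos i : s i \in pos.
Proof. by apply: (@root_pos_co _ i); rewrite ?simple_root // co_simple eqxx. Qed.

Lemma simple_inj : injective (fun i => s i).
Proof.
move=> i j e; apply/eqP; have := co_simple i j; rewrite -e co_simple eqxx.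
by case: eqP => // _ /eqP; rewrite oner_eq0.
Qed.

Lemma pos_not_neg b i : b \in pos -> (b == - s i) = false.
Proof.
move=> bp; apply/eqP => e; have := simple_pos i.
by rewrite -[s i]opprK -e pos_opp.
Qed.

Lemma pos_coP b : b \in pos -> exists i, 0 < co i b.
Proof.
move=> bp; apply/existsP; apply: contraT; rewrite negb_exists => /forallP h.
case/negP: (root_neq0 (pos_root bp)); apply/eqP/co_inj; rewrite ?mem0v ?root_span ?pos_root // => i.
by apply/eqP; rewrite linear0 eq_le (pos_co i bp) andbT leNgt h.
Qed.

Definition orthogonal J := {in J &, forall i j, i != j -> dot (s i) (s j) = 0}.

Definition sref J b := foldr (fun i => reflection (s i)) b (enum J).

Definition mult i b := 2 * dot b (s i) / dot (s i) (s i).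

Lemma multD i x y : mult i (x + y) = mult i x + mult i y.
Proof. by rewrite /mult dotDl mulrDr mulrDl. Qed.

Lemma multN i x : mult i (- x) = - mult i x.
Proof. by rewrite /mult dotNl mulrN mulNr. Qed.

Section Sref.
Variable J : {set 'I_r}.
Hypothesis oJ : orthogonal J.

(** Orthogonal reflections act simultaneously. *)
Lemma srefE b : sref J b = b - \sum_(i in J) mult i b *: s i.
Proof.
rewrite -big_enum /=.
rewrite /sref; have : {subset enum J <= J} by move=> i; rewrite mem_enum.
have : uniq (enum J) := enum_uniq _.
elim: (enum J) => [|i t IH] /=; first by rewrite big_nil subr0.
move=> /andP[it ut] sub; rewrite IH //; last by move=> j jt; apply: sub; rewrite in_cons jt orbT.
rewrite big_cons reflectionE -/(mult i _) [mult i _](_ : _ = mult i b).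
  by rewrite opprD addrA addrAC.
rewrite multD multN [X in _ - X](_ : _ = 0) ?subr0 //.
rewrite /mult dot_suml big1_seq ?mulr0 ?mul0r // => j /= jt.
rewrite dotZl; have -> : dot (s j) (s i) = 0; last by rewrite mulr0.
apply: oJ.
- by apply: sub; rewrite in_cons jt orbT.
- by apply: sub; rewrite mem_head.
- by apply: contraNneq it => <-.
Qed.

Lemma dot_sref i b : i \in J -> dot (s i) (sref J b) = - dot (s i) b.
Proof.
move=> iJ; rewrite srefE dotDr dotNr dot_sumr (bigD1 i) //= big1 => [|j /andP[jJ ji]].
  rewrite addr0 dotZr /mult divfK ?norm_neq0 // (dotC b); ring.
by rewrite dotZr oJ ?mulr0 // eq_sym.
Qed.

Lemma co_sref i b : i \notin J -> co i (sref J b) = co i b.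
Proof.
move=> iJ; rewrite srefE linearB /= linear_sum big1 ?subr0 // => j jJ.
rewrite linearZ /= co_simple (_ : i == j = false) ?mulr0 //.
by apply: contraNF iJ => /eqP->.
Qed.

Lemma mult_sref i b : i \in J -> mult i (sref J b) = - mult i b.
Proof. by move=> iJ; rewrite /mult dotC dot_sref // dotC mulrN mulNr. Qed.

Lemma srefK : involutive (sref J).
Proof.
move=> b; rewrite srefE (eq_bigr (fun i => - (mult i b *: s i))); last first.
  by move=> i iJ; rewrite mult_sref // scaleNr.
by rewrite sumrN opprK srefE subrK.
Qed.

Lemma srefD x y : sref J (x + y) = sref J x + sref J y.
Proof.
rewrite !srefE addrACA -opprD -big_split /=; congr (_ - _).
by apply: eq_bigr => i _; rewrite multD scalerDl.
Qed.

Lemma srefN x : sref J (- x) = - sref J x.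
Proof.
rewrite !srefE opprB addrC; congr (_ + _).
by rewrite -sumrN; apply: eq_bigr => i _; rewrite multN scaleNr opprK.
Qed.

Lemma sref_root b : b \in Phi -> sref J b \in Phi.
Proof.
rewrite /sref; elim: (enum J) => //= i t IH bP; apply: reflection_root; last exact: IH.
exact: simple_root.
Qed.

Lemma sref_span b : b \in span -> sref J b \in span.
Proof.
move=> bs; rewrite srefE memvB // memv_suml // => i _.
by rewrite memvZ // simple_span.
Qed.

Lemma sref_simple i : i \in J -> sref J (s i) = - s i.
Proof.
move=> iJ; rewrite srefE (bigD1 i) //= big1 => [|j /andP[jJ ji]].
  rewrite addr0 /mult mulfK ?norm_neq0 // -{1}[s i]scale1r -scalerBl.
  by rewrite (_ : 1 - 2 = -1) ?scaleN1r //; ring.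
by rewrite /mult oJ ?mulr0 ?mul0r ?scale0r // eq_sym.
Qed.

(** Coordinates outside J do not change, so a positive root with a nonzero one stays positive. A
positive root b supported in J is simple: reflecting it in a simple root s i of its support
changes only the sign of the coordinate i, hence by sign coherence the support is i. *)
Lemma sref_pos b : b \in pos -> (exists2 i, i \in J & b = s i) \/ sref J b \in pos.
Proof.
move=> bp; have bP := pos_root bp.
have [/existsP[i /andP[iJ bi]]|out] := boolP [exists i, (i \notin J) && (0 < co i b)].
  right; apply: (@root_pos_co _ i); first exact: sref_root.
  by rewrite co_sref.
have co0 i : i \notin J -> co i b = 0.
  move=> iJ; apply/eqP; rewrite eq_le (pos_co i bp) andbT leNgt; apply/negP => h.
  by case/existsP: out; exists i; rewrite iJ.
have [i bi] := pos_coP bp.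
have iJ : i \in J by apply: contraT => /co0 e; rewrite e ltxx in bi.
left; exists i => //.
have bE : b = \sum_(j in J) co j b *: s j.
  rewrite {1}(spanE (root_span bP)) [RHS]big_mkcond /=; apply: eq_bigr => j _.
  by case: ifPn => // /co0 ->; rewrite scale0r.
have mul_i : mult i b = 2 * co i b.
  rewrite /mult {1}bE dot_suml (bigD1 i) //= big1 => [|j /andP[jJ ji]].
    by rewrite addr0 dotZl mulrA mulfK ?norm_neq0.
  by rewrite dotZl oJ ?mulr0.
have only j : j != i -> co j b = 0.
  move=> ji; apply/eqP; rewrite eq_le (pos_co j bp) andbT leNgt; apply/negP => bj.
  have refl : reflection (s i) b \in Phi by rewrite reflection_root ?simple_root.
  have := root_pos_co (i := j) refl; rewrite reflectionE -/(mult i b) mul_i.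
  rewrite linearB linearZ /= co_simple (negPf ji) mulr0 subr0 => /(_ bj) /(pos_co i).
  rewrite linearB linearZ /= co_simple eqxx mulr1; lra.
have bE' : b = co i b *: s i.
  by rewrite {1}(spanE (root_span bP)) (bigD1 i) //= big1 ?addr0 // => j /only ->; rewrite scale0r.
case: root => _ _ /(_ (s i) (simple_root i) (co i b)); rewrite -bE' => /(_ bP) [] e.
  by rewrite bE' e scale1r.
by suff : False by []; move: bi; rewrite e; lra.
Qed.

End Sref.

Lemma tau_neg_out J i : i \notin J -> tau alpha J (- s i) = - s i.
Proof.
move=> iJ; rewrite /tau ifT //; apply/existsP; exists i.
by rewrite inE iJ eqxx.
Qed.

Lemma tau_neg_in J i : orthogonal J -> i \in J -> tau alpha J (- s i) = s i.
Proof.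
move=> oJ iJ; rewrite /tau ifF; last first.
  apply/negbTE/negP => /existsP[j /andP[+ /eqP/oppr_inj/simple_inj e]].
  by rewrite -e inE iJ.
by rewrite -[foldr _ _ _]/(sref J _) srefN // sref_simple // opprK.
Qed.

Lemma tau_pos J b : b \in pos -> tau alpha J b = sref J b.
Proof.
by move=> bp; rewrite /tau ifF //; apply/negbTE/negP => /existsP[j /andP[_]]; rewrite pos_not_neg.
Qed.

Definition negs b := negative_simple alpha b.

Lemma negsP b : reflect (exists i, b = - s i) (negs b).
Proof. by apply: (iffP existsP) => -[i /eqP]; exists i => //; apply/eqP. Qed.

Lemma negs_simple i : negs (- s i).
Proof. by apply/negsP; exists i. Qed.

Lemma pos_negs b : b \in pos -> negs b = false.
Proof. by move=> bp; apply/negsP => -[i e]; have := pos_not_neg i bp; rewrite e eqxx. Qed.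

Definition almost b := (b \in pos) || negs b.

Lemma tau_almost J b : orthogonal J -> almost b -> almost (tau alpha J b) /\
  tau alpha J (tau alpha J b) = b.
Proof.
move=> oJ /orP[bp|/negsP[i ->]]; last first.
  have [iJ|iJ] := boolP (i \in J).
    rewrite tau_neg_in // tau_pos ?simple_pos // sref_simple //.
    by rewrite /almost simple_pos.
  by rewrite !tau_neg_out // /almost negs_simple orbT.
rewrite tau_pos //; case: (sref_pos oJ bp) => [[i iJ ->]|sp].
  by rewrite sref_simple // tau_neg_in // /almost negs_simple orbT.
by rewrite tau_pos // srefK // /almost sp.
Qed.

Section Rotation.
Variable Ip : {set 'I_r}.
Hypothesis bip : is_bipartition alpha Ip.

Lemma orthogonal_plus : orthogonal Ip.
Proof.
move=> i j iI jI ij; apply/eqP; apply: contraT => d0.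
by have := bip (i := i) (j := j); rewrite /adjacent ij d0 iI jI => /(_ isT).
Qed.

Lemma orthogonal_minus : orthogonal (~: Ip).
Proof.
move=> i j; rewrite !inE => iI jI ij; apply/eqP; apply: contraT => d0.
by have := bip (i := i) (j := j); rewrite /adjacent ij d0 (negPf iI) (negPf jI) => /(_ isT).
Qed.

Local Notation oP := orthogonal_plus.
Local Notation oM := orthogonal_minus.

Definition coxeter b := sref (~: Ip) (sref Ip b).

Lemma coxeterN b : coxeter (- b) = - coxeter b.
Proof. by rewrite /coxeter !srefN //; [apply: oM | apply: oP]. Qed.

Lemma coxeterD x y : coxeter (x + y) = coxeter x + coxeter y.
Proof. by rewrite /coxeter !srefD //; [apply: oM | apply: oP]. Qed.

Lemma coxeter_span b : b \in span -> coxeter b \in span.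
Proof. by move=> bs; apply: (sref_span oM); apply: (sref_span oP). Qed.

Lemma coxeter_inj : injective coxeter.
Proof. by move=> x y /(can_inj (srefK oM)) /(can_inj (srefK oP)). Qed.

Definition part J b := \sum_(i in J) co i b *: s i.

Lemma part_sum b : b \in span -> b = part Ip b + part (~: Ip) b.
Proof.
move=> bs; rewrite {1}(spanE bs) (bigID (mem Ip)) /=; congr (_ + _).
by apply: eq_bigl => i; rewrite inE.
Qed.

Lemma part_sref J b : orthogonal J -> part (~: J) (sref J b) = part (~: J) b.
Proof. by move=> oJ; apply: eq_bigr => i; rewrite inE => iJ; rewrite co_sref. Qed.

Lemma part_srefC J b : orthogonal (~: J) -> part J (sref (~: J) b) = part J b.
Proof. by move=> oJ; apply: eq_bigr => i iJ; rewrite co_sref // inE negbK. Qed.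

Lemma dot_part_sref J y x : orthogonal J -> dot (part J y) (sref J x) = - dot (part J y) x.
Proof.
move=> oJ; rewrite !dot_suml -sumrN; apply: eq_bigr => i iJ.
by rewrite !dotZl dot_sref // mulrN.
Qed.

(** The Euler form of the bipartite orientation of the diagram: on the span of the simple roots,
euler x y + euler y x = dot x y, and a simple root in Ip and one outside Ip pair in one order
only. *)
Definition euler x y := dot (part Ip x) (part Ip y) / 2 +
  dot (part (~: Ip) x) (part (~: Ip) y) / 2 + dot (part (~: Ip) x) (part Ip y).

(** Serre duality. The reflection in each part negates the pairing with the simple roots of that
part; applying this to both factors of the Coxeter element gives the four terms. *)
Lemma euler_serre x y : x \in span -> y \in span -> euler y (coxeter x) = - euler x y.
Proof.
move=> xs ys; set u := sref Ip x.
have us : u \in span by apply: (sref_span oP).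
have cs := coxeter_span xs.
have k1 : dot (part Ip y) (part Ip u) =
    - dot (part Ip y) (part Ip x) - 2 * dot (part Ip y) (part (~: Ip) x).
  have := dot_part_sref y x oP; rewrite -/u {1}(part_sum us) {1}(part_sum xs).
  rewrite !dotDr (part_sref _ oP); lra.
have k2 : dot (part (~: Ip) y) (part (~: Ip) (coxeter x)) =
    - dot (part (~: Ip) y) (part (~: Ip) u) - 2 * dot (part (~: Ip) y) (part Ip u).
  have := dot_part_sref y u oM; rewrite -/(coxeter x) {1}(part_sum cs) {1}(part_sum us).
  rewrite !dotDr (part_srefC _ oM); lra.
rewrite /euler k2 (part_srefC _ oM) -/u (part_sref _ oP) k1.
rewrite ![dot (part _ x) (part _ y)]dotC; lra.
Qed.

Lemma euler_self x : x \in span -> euler x x = dot x x / 2.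
Proof.
move=> xs.
have -> : dot x x = dot (part Ip x + part (~: Ip) x) (part Ip x + part (~: Ip) x).
  by rewrite -part_sum.
rewrite /euler !dotDr !dotDl.
rewrite (dotC (part Ip x) (part (~: Ip) x)); lra.
Qed.

(** By Serre duality a fixed vector satisfies euler x x = - euler x x, and euler x x is half the
squared norm. *)
Lemma coxeter_fixed x : x \in span -> coxeter x = x -> x = 0.
Proof.
move=> xs cx; have := euler_serre xs xs; rewrite cx euler_self // => h.
by apply/eqP; rewrite -dot_eq0; apply/eqP; lra.
Qed.

Lemma part_simple J i : part J (s i) = if i \in J then s i else 0.
Proof.
case: ifPn => iJ.
  rewrite /part (bigD1 i) //= co_simple eqxx scale1r big1 ?addr0 // => j /andP[_ ji].
  by rewrite co_simple (negPf ji) scale0r.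
rewrite /part big1 // => j jJ; rewrite co_simple (_ : j == i = false) ?scale0r //.
by apply: contraNF iJ => /eqP<-.
Qed.

Lemma dot_part J b i : orthogonal J -> i \in J ->
  dot (part J b) (s i) = co i b * dot (s i) (s i).
Proof.
move=> oJ iJ; rewrite dot_suml (bigD1 i) //= dotZl big1 ?addr0 // => j /andP[jJ ji].
by rewrite dotZl oJ ?mulr0.
Qed.

(** The root into which the rotation turns - s i. In the language of quivers it is a projective:
its Euler pairing reads off the coordinate i ([euler_proj]). *)
Definition proj i := rotation alpha Ip (- s i).

Lemma projE i : proj i = if i \in Ip then - coxeter (s i) else s i.
Proof.
rewrite /proj /rotation; case: ifPn => iI; last first.
  by rewrite tau_neg_out // tau_neg_in ?inE //; apply: oM.
rewrite (tau_neg_in oP) // tau_pos ?simple_pos //.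
by rewrite /coxeter (sref_simple oP) // (srefN oM) opprK.
Qed.

Lemma partN J b : part J (- b) = - part J b.
Proof. by rewrite /part -sumrN; apply: eq_bigr => i _; rewrite linearN scaleNr. Qed.

Lemma eulerNr x y : euler x (- y) = - euler x y.
Proof. rewrite /euler !partN !dotNr; lra. Qed.

Lemma eulerNl x y : euler (- x) y = - euler x y.
Proof. rewrite /euler !partN !dotNl; lra. Qed.

Lemma euler_proj b i : b \in span -> euler b (proj i) = co i b * dot (s i) (s i) / 2.
Proof.
move=> bs; rewrite projE; case: ifPn => iI.
  rewrite eulerNr euler_serre ?simple_span // opprK /euler !part_simple iI inE iI /=.
  by rewrite !dot0l dotC dot_part ?mul0r ?addr0 //; apply: oP.
rewrite /euler !part_simple inE (negPf iI) /= !dot0r mul0r add0r addr0.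
by rewrite dot_part ?inE //; apply: oM.
Qed.

Lemma proj_pos i : proj i \in pos.
Proof.
rewrite projE; case: ifPn => iI; last exact: simple_pos.
rewrite /coxeter (sref_simple oP) // (srefN oM) opprK.
case: (sref_pos oM (simple_pos i)) => // -[j + /simple_inj ij].
by rewrite inE -ij iI.
Qed.

Lemma euler_proj_ge0 b i : b \in pos -> 0 <= euler b (proj i).
Proof.
move=> bp; rewrite euler_proj ?root_span ?pos_root //.
by rewrite divr_ge0 ?mulr_ge0 ?(pos_co i bp) ?ltW ?norm_gt0.
Qed.

Lemma euler_coxeter x y : x \in span -> y \in span ->
  euler (coxeter x) (coxeter y) = euler x y.
Proof. by move=> xs ys; rewrite euler_serre ?coxeter_span // euler_serre // opprK. Qed.

(** On positive roots the rotation is the Coxeter element until the result would be negative;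
then the rotation yields a negative simple root. *)
Lemma rotation_pos b : b \in pos ->
  (rotation alpha Ip b = coxeter b /\ coxeter b \in pos) \/
  (exists2 i, rotation alpha Ip b = - s i & proj i = - coxeter b).
Proof.
move=> bp; rewrite /rotation (tau_pos Ip bp).
case: (sref_pos oP bp) => [[i iI ->]|sp].
  right; exists i; last by rewrite projE iI.
  by rewrite (sref_simple oP) // tau_neg_out // inE iI.
rewrite tau_pos // -/(coxeter b).
case: (sref_pos oM sp) => [[i iI e]|cp]; last by left.
right; exists i; rewrite /coxeter e (sref_simple oM iI) // projE opprK.
by move: iI; rewrite inE => /negPf->.
Qed.

Lemma rotation_almost b : almost b -> almost (rotation alpha Ip b).
Proof.
by move=> h; have [h1 _] := tau_almost oP h; have [] := tau_almost oM h1.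
Qed.

Lemma rotation_inj b b' : almost b -> almost b' -> rotation alpha Ip b = rotation alpha Ip b' ->
  b = b'.
Proof.
move=> h h' e; have [h1 h2] := tau_almost oP h; have [h1' h2'] := tau_almost oP h'.
have [_ h3] := tau_almost oM h1; have [_ h3'] := tau_almost oM h1'.
by rewrite -h2 -h2' -h3 -h3' -/(rotation alpha Ip b) -/(rotation alpha Ip b') e.
Qed.

(** * An explicit compatibility relation *)

Section Colors.
Variable m : nat.
Hypothesis m0 : (0 < m)%N.
Local Notation X := (colored_roots Phi alpha m).
Local Notation rotate := (colored_rotation Phi alpha m Ip).

Lemma in_colored_roots (x : V * nat) :
  (x \in X) = (x.1 \in pos) && (0 < x.2 <= m)%N || negs x.1 && (x.2 == 1)%N.
Proof.
rewrite in_fsetU; congr (_ || _).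
  apply/imfset2P/andP => [[b bp [k kp ->]]|[xp xk]] /=.
    by move: kp; rewrite mem_iota add1n ltnS.
  by exists x.1 => //; exists x.2; rewrite ?mem_iota ?add1n ?ltnS //; case: x {xp xk}.
apply/imfsetP/andP => [[i _ ->]|[/negsP[i e] /eqP k]] /=; first by rewrite negs_simple.
by exists i => //; case: x e k => /= b k -> ->.
Qed.

Lemma colored_root_almost (x : V * nat) : x \in X -> almost x.1.
Proof. by rewrite in_colored_roots => /orP[/andP[h _]|/andP[h _]]; rewrite /almost h ?orbT. Qed.

Lemma rotate_X (x : V * nat) : x \in X -> rotate x \in X.
Proof.
rewrite in_colored_roots /colored_rotation => /orP[/andP[xp /andP[k0 km]]|/andP[xn /eqP k1]].
  rewrite xp /=; case: ltnP => [lt|_]; first by rewrite in_colored_roots /= xp lt.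
  have := rotation_almost (b := x.1); rewrite /almost xp => /(_ isT)/orP[h|h].
    by rewrite in_colored_roots /= h m0.
  by rewrite in_colored_roots /= h eqxx orbT.
have xnp : x.1 \in pos = false by apply/negP => /pos_negs; rewrite xn.
rewrite xnp /=; have := rotation_almost (b := x.1); rewrite /almost xn orbT => /(_ isT)/orP[h|h].
  by rewrite in_colored_roots /= h m0.
by rewrite in_colored_roots /= h eqxx orbT.
Qed.

Lemma rotate_inj : {in X &, injective rotate}.
Proof.
move=> x y xX yX; have hx := colored_root_almost xX; have hy := colored_root_almost yX.
move: xX yX; rewrite !in_colored_roots /colored_rotation.
case: x hx => b k /= hb; case: y hy => b' k' /= hb'.
case: ifPn => h; case: ifPn => h' + + [].
- by move=> _ _ -> ->.
- move=> h1 _ _ k0; move: h1; rewrite k0 /=; case/andP: h => bp _; rewrite bp (pos_negs bp).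
  by rewrite orbF.
- move=> _ h1 _ k0; move: h1; rewrite -k0 /=; case/andP: h' => bp _; rewrite bp (pos_negs bp).
  by rewrite orbF.
move=> h1 h2 /(rotation_inj hb hb') e; move: h1 h2 h h'; rewrite -e.
case: (boolP (b \in pos)) => [bp|_] /=.
  rewrite (pos_negs bp) !orbF -!leqNgt => /andP[_ h1] /andP[_ h2] h3 h4.
  by have -> : k = k' by apply/eqP; rewrite eqn_leq (leq_trans h1 h4) (leq_trans h2 h3).
by move=> /andP[_ /eqP->] /andP[_ /eqP->].
Qed.

(** The negative simple roots are read as positive roots of color 0, so that raising the color is
the rotation for them as well. *)
Definition lift_neg (x : V * nat) : V * nat :=
  if negs x.1 then (rotation alpha Ip x.1, 0%N) else x.

(** Compatibility in terms of the Euler form: for different colors the form has to vanish in the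
direction from the larger color to the smaller one; for equal colors both values have to be
nonnegative. *)
Definition compat0 (y z : V * nat) : bool :=
  if (z.2 < y.2)%N then euler y.1 z.1 == 0
  else if (y.2 < z.2)%N then euler z.1 y.1 == 0
  else (0 <= euler y.1 z.1) && (0 <= euler z.1 y.1).

Definition compat (x y : V * nat) := compat0 (lift_neg x) (lift_neg y).

Lemma compat0_sym : symmetric compat0.
Proof.
move=> y z; rewrite /compat0; case: (ltngtP y.2 z.2) => // _; exact: andbC.
Qed.

Lemma compat_sym : symmetric compat.
Proof. by move=> x y; apply: compat0_sym. Qed.

Definition lifted (y : V * nat) := [/\ y.1 \in pos, (y.2 <= m)%N &
  y.2 = 0%N -> exists i, y.1 = proj i].

Lemma lift_negP (x : V * nat) : x \in X -> lifted (lift_neg x).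
Proof.
rewrite in_colored_roots /lift_neg => /orP[/andP[xp /andP[k0 km]]|/andP[xn _]].
  by rewrite pos_negs //; split=> // e; rewrite e in k0.
rewrite xn; case/negsP: xn => i ->; split=> //; first exact: proj_pos.
by exists i.
Qed.

(** The rotation of colored roots, read on lifted roots. *)
Definition rotate0 (y : V * nat) : V * nat :=
  if (y.2 < m)%N then (y.1, y.2.+1)
  else if coxeter y.1 \in pos then (coxeter y.1, 1%N) else (- coxeter y.1, 0%N).

Lemma lift_rotate (x : V * nat) : x \in X -> lift_neg (rotate x) = rotate0 (lift_neg x).
Proof.
rewrite in_colored_roots /lift_neg /colored_rotation.
case/orP=> [/andP[xp /andP[k0 km]]|/andP[xn /eqP k1]].
  rewrite xp (pos_negs xp) /=; case: ltnP => [lt|ge] /=; rewrite /rotate0.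
    by rewrite (pos_negs xp) lt.
  rewrite ltnNge ge /=; case: (rotation_pos xp) => [[-> cp]|[i -> e]].
    by rewrite cp (pos_negs cp).
  rewrite negs_simple -/(proj i) e ifF //.
  by have := pos_opp (proj_pos i); rewrite e opprK.
have xnp : x.1 \in pos = false by apply/negP => /pos_negs; rewrite xn.
rewrite xnp xn /= /rotate0 /= m0; case/negsP: xn => i ->.
by rewrite (pos_negs (proj_pos i)).
Qed.

Lemma coxeter_proj b : b \in pos -> coxeter b \notin pos -> exists i, - coxeter b = proj i.
Proof.
by move=> bp cb; case: (rotation_pos bp) => [[_ h]|[i _ e]]; [rewrite h in cb | exists i].
Qed.

Lemma lt0_ge0 (t : R) : 0 <= t -> (0 <= - t) = (t == 0).
Proof. by move=> h; rewrite oppr_ge0 eq_le h andbT. Qed.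

(** Only the colors that wrap around matter. If both do, the Coxeter element preserves the form;
if one does, Serre duality exchanges the two directions. A root of color 0, before or after the
rotation, is some [proj i], and pairings of positive roots with it are nonnegative
([euler_proj_ge0]). *)
Lemma compat0_rotate (y z : V * nat) : lifted y -> lifted z ->
  compat0 (rotate0 y) (rotate0 z) = compat0 y z.
Proof.
(* The case split is on the larger color, which may be assumed to be that of y. *)
wlog le : y z / (z.2 <= y.2)%N.
  move=> h hy hz; case: (leqP z.2 y.2) => [le|/ltnW le]; first exact: h.
  by rewrite compat0_sym (compat0_sym y); apply: h.
case: y le => b k /= lk; case: z lk => g l /= lk [/= bp km bproj] [/= gp lm gproj].
have bs := root_span (pos_root bp); have gs := root_span (pos_root gp).
rewrite /rotate0 /=; case: (ltnP k m) => [ltk|gek].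
  by rewrite (leq_ltn_trans lk ltk) /compat0 /= !ltnS.
have ek : k = m by apply/eqP; rewrite eqn_leq km.
rewrite {}ek {k km gek bproj} in lk *.
case: (ltnP l m) => [ltl|gel].
  rewrite [RHS]/compat0 /= ltl.
  have serre := euler_serre bs gs.
  case: ifPn => [cp|cn]; last first.
    by rewrite /compat0 /= eulerNr serre opprK.
  rewrite /compat0 /= ltnS; case: posnP => [l0|lpos].
    have [i ei] := gproj l0; rewrite /= serre ei.
    rewrite (euler_proj_ge0 _ cp) /= lt0_ge0 //; exact: euler_proj_ge0.
  by rewrite serre oppr_eq0.
have -> : l = m by apply/eqP; rewrite eqn_leq lm.
rewrite [RHS]/compat0 /= ltnn.
have bg := euler_serre bs gs; have gb := euler_serre gs bs.
have inv1 := euler_coxeter bs gs; have inv2 := euler_coxeter gs bs.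
have key u v : u \in pos -> v \in pos -> coxeter u \notin pos -> coxeter v \in pos ->
    (euler (coxeter v) (- coxeter u) == 0) = (0 <= euler u v) && (0 <= euler v u).
  move=> up vp cu cv; have us := root_span (pos_root up); have vs := root_span (pos_root vp).
  have [i ei] := coxeter_proj up cu.
  have h1 : 0 <= euler u v.
    by have := euler_proj_ge0 i vp; rewrite -ei eulerNr euler_serre // opprK.
  have h2 := euler_proj_ge0 i cv; rewrite -ei in h2.
  by rewrite h1 /= -(euler_coxeter vs us) -lt0_ge0 // eulerNr opprK.
case: ifPn => cb; case: ifPn => cg; rewrite /compat0 /=.
- by rewrite inv1 inv2.
- by rewrite (key g b) // andbC.
- by rewrite (key b g).
- by rewrite -!coxeterN !euler_coxeter ?memvN // !eulerNr !eulerNl !opprK.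
Qed.

Theorem compat_rotate : {in X &, forall u v, compat (rotate u) (rotate v) = compat u v}.
Proof.
move=> x y xX yX; rewrite /compat !lift_rotate //.
by apply: compat0_rotate; apply: lift_negP.
Qed.

(** Pairing with [proj] is a positive multiple of the coordinate. *)
Lemma compat_neg i (x : V * nat) : x \in X -> compat (- s i, 1%N) x = (co i x.1 == 0) || negs x.1.
Proof.
rewrite in_colored_roots /compat {1}/lift_neg negs_simple -/(proj i).
case/orP=> [/andP[xp /andP[k0 _]]|/andP[xn _]]; rewrite /lift_neg /compat0.
  rewrite (pos_negs xp) /= k0 orbF euler_proj ?root_span ?pos_root //.
  by rewrite !mulf_eq0 (negPf (norm_neq0 i)) invr_eq0 (pnatr_eq0 _ 2) !orbF.
rewrite xn /= orbT; case/negsP: xn => j ->; rewrite -/(proj j).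
by rewrite !euler_proj_ge0 ?proj_pos.
Qed.

End Colors.
End Rotation.
End SimpleSystem.

(** * Uniqueness of compatibility, and links as parabolic subsystems *)

Section Orbits.
Context {R : realType} {d r : nat}.
Local Notation V := 'rV[R]_d.
Variables (Phi : {fset V}) (alpha : r.-tuple V).
Hypotheses (root : root_system Phi) (simp : simple_system Phi alpha).
Variable Ip : {set 'I_r}.
Hypothesis bip : is_bipartition alpha Ip.
Local Notation s i := (tnth alpha i).
Local Notation co i b := (coord alpha i b).
Local Notation span := <<alpha>>%VS.
Local Notation pos := (positive_roots Phi alpha).
Local Notation negs := (negs alpha).
Local Notation rot := (rotation alpha Ip).
Local Notation coxeter := (coxeter alpha Ip).
Local Notation compat := (compat alpha Ip).

(** Otherwise the rotation acts on the orbit of b as the Coxeter element, and the orbit sum is a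
fixed vector, hence zero; but it is a sum of nonzero vectors with nonnegative coordinates. *)
Lemma orbit_neg b : b \in pos -> exists t, negs (iter t rot b).
Proof.
move=> bp; apply: contrapT => no.
have ip t : iter t rot b \in pos /\ iter t rot b = iter t coxeter b.
  elim: t => [|t [IHp IHe]] //=.
  case: (rotation_pos root simp bip IHp) => [[e h]|[i e _]].
    by rewrite e h -IHe.
  by case: no; exists t.+1; rewrite iterS e negs_simple.
have cp t : iter t coxeter b \in pos by have [h <-] := ip t.
pose l := [seq iter t coxeter b | t <- iota 0 (#|` pos|).+1].
have /(uniqPn 0)[i [j [ij js]]] : ~~ uniq l.
  apply/negP => ul; have := uniq_leq_size (s2 := enum_fset pos) ul.
  rewrite size_map size_iota ltnn => h; suff : false by []; apply: h.
  by move=> x /mapP[t _ ->]; apply: cp.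
rewrite size_map size_iota in js.
rewrite !(nth_map 0%N) ?size_iota ?(ltn_trans ij) // !nth_iota ?(ltn_trans ij) // !add0n => e.
have inj t x y : iter t coxeter x = iter t coxeter y -> x = y.
  by elim: t => //= t IH /(coxeter_inj root simp bip); apply: IH.
have per : iter (j - i) coxeter b = b.
  by apply: (inj i); rewrite -iterD subnKC ?(ltnW ij).
pose S := \sum_(t < (j - i)%N) iter t coxeter b.
have cS : coxeter S = S.
  have -> : coxeter S = \sum_(t < (j - i)%N) iter t.+1 coxeter b.
    apply: (big_morph coxeter) => [x y|]; first exact: (coxeterD bip).
    by apply: (addrI (coxeter 0)); rewrite -(coxeterD bip) !addr0.
  rewrite /S; move: per; have : (0 < j - i)%N by rewrite subn_gt0.
  case: (j - i)%N => // p _ per.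
  by rewrite big_ord_recr big_ord_recl /= -iterS per addrC.
have Ss : S \in span by apply: memv_suml => t _; apply: (root_span simp); apply: pos_root (cp t).
have S0 := coxeter_fixed root simp bip Ss cS.
have [i0 bi] := pos_coP root simp bp.
suff : 0 < co i0 S by rewrite S0 linear0 ltxx.
rewrite linear_sum; have : (0 < j - i)%N by rewrite subn_gt0.
case: (j - i)%N => // p _; rewrite big_ord_recl /=.
by apply: ltr_wpDr bi; apply: sumr_ge0 => t _; exact: (pos_co i0 (cp t.+1)).
Qed.

Section Colored.
Variable m : nat.
Hypothesis m0 : (0 < m)%N.
Local Notation X := (colored_roots Phi alpha m).
Local Notation rotate := (colored_rotation Phi alpha m Ip).

Lemma rotate_color b k t : b \in pos -> (k + t <= m)%N -> iter t rotate (b, k) = (b, (k + t)%N).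
Proof.
move=> bp; elim: t => [|t IH] le; first by rewrite addn0.
rewrite iterS IH ?(leq_trans _ le) ?leq_add2l // /colored_rotation /= bp /=.
by rewrite (leq_trans _ le) ?addnS // ltnS.
Qed.

Lemma orbit_X (x : V * nat) : x \in X -> exists t i, iter t rotate x = (- s i, 1%N).
Proof.
case: x => b k; rewrite in_colored_roots /= => /orP[|/andP[/negsP[i ->] /eqP->]]; last first.
  by exists 0%N, i.
move=> /andP[bp /andP[k0 km]].
have [t] := orbit_neg bp; elim: t b bp k k0 km => [|t IH] b bp k k0 km.
  by move=> /= h; rewrite (pos_negs root simp bp) in h.
rewrite iterSr => h.
have e : iter (m - k).+1 rotate (b, k) = (rot b, 1%N).
  by rewrite iterS rotate_color ?subnKC // /colored_rotation /= ltnn andbF.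
suff [t' [i e']] : exists t' i, iter t' rotate (rot b, 1%N) = (- s i, 1%N).
  by exists (t' + (m - k).+1)%N, i; rewrite iterD e.
have /orP[rp|/negsP[i ->]] : almost Phi alpha (rot b).
  by apply: (rotation_almost root simp bip); rewrite /almost bp.
  exact: (IH _ rp).
by exists 0%N, i.
Qed.

Lemma iter_rotate_X t (x : V * nat) : x \in X -> iter t rotate x \in X.
Proof. by move=> xX; elim: t => //= t; apply: (rotate_X root simp bip m0). Qed.

Lemma iter_rotate_inj t : {in X &, injective (iter t rotate)}.
Proof.
elim: t => [|t IH] x y xX yX //= e; apply: IH => //.
by apply: (rotate_inj root simp bip _ _ e); apply: iter_rotate_X.
Qed.

(** Rotating both roots until the first is a negative simple root leads to a pair on which
compatibility is prescribed. *)
Theorem compat_unique c : compatibility Phi alpha m Ip c ->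
  {in X &, forall x y, x != y -> c x y = compat x y}.
Proof.
move=> [_ cR cn] x y xX yX nxy; have [t [i e]] := orbit_X xX.
have -> : c x y = c (iter t rotate x) (iter t rotate y).
  by elim: t {e} => //= t ->; apply: cR; apply: iter_rotate_X.
have -> : compat x y = compat (iter t rotate x) (iter t rotate y).
  elim: t {e} => //= t ->; rewrite (compat_rotate root simp bip m0) //; exact: iter_rotate_X.
rewrite e cn ?(compat_neg root simp bip (m := m)) //; try exact: iter_rotate_X.
by rewrite -e; apply: contraNneq nxy => /iter_rotate_inj->.
Qed.

Definition cadj : rel (V * nat) := fun x y => [&& x \in X, y \in X, x != y & compat x y].

Lemma cadj_sym : symmetric cadj.
Proof.
by move=> x y; rewrite /cadj andbCA eq_sym compat_sym.
Qed.

Lemma cadj_irr : irreflexive cadj.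
Proof. by move=> x; rewrite /cadj eqxx !andbF. Qed.

Lemma cadj_colored_root x y : cadj x y -> x \in X.
Proof. by case/andP. Qed.

Lemma imfset_rotate t : iter t rotate @` X = X.
Proof.
apply/eqP; rewrite eqEfcard; apply/andP; split.
  by apply/fsubsetP => y /imfsetP[x /= xX ->]; apply: iter_rotate_X.
suff -> : #|` iter t rotate @` X| = #|` X| by rewrite leqnn.
by apply: card_in_imfset => x y xX yX; apply: iter_rotate_inj.
Qed.

Lemma cadj_rotate t : {in X &, forall x y, cadj (iter t rotate x) (iter t rotate y) = cadj x y}.
Proof.
move=> x y xX yX; rewrite /cadj !iter_rotate_X // xX yX /=.
have -> : (iter t rotate x != iter t rotate y) = (x != y).
  by congr (~~ _); apply/eqP/eqP => [/iter_rotate_inj->|->].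
congr (_ && _); elim: t => //= t <-.
by apply: (compat_rotate root simp bip m0); apply: iter_rotate_X.
Qed.

(** The rotation is an automorphism, and a power of it takes a given vertex to a negative simple
root. *)
Lemma regular_links k n :
  (forall i, regular cadj k n (nbr cadj X (- s i, 1%N))) ->
  {in X, forall x, regular cadj k n (nbr cadj X x)}.
Proof.
move=> h x xX; have [t [i e]] := orbit_X xX.
apply: (proj2 (@regular_iso _ _ cadj cadj (iter t rotate) k n _ (nbr cadj X (- s i, 1%N)) _ _ _)
  (h i)).
- by move=> u v; rewrite !in_nbr => /andP[uX _] /andP[vX _]; apply: iter_rotate_inj.
- rewrite -e; apply/fsetP => z; apply/imfsetP/idP => [[u /= + ->]|].
    by rewrite !in_nbr => /andP[uX xu]; rewrite cadj_rotate // xu iter_rotate_X.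
  rewrite in_nbr -{1}(imfset_rotate t) => /andP[/imfsetP[u /= uX ->]].
  by rewrite cadj_rotate // => xu; exists u; rewrite //= in_nbr uX.
- by move=> u v; rewrite !in_nbr => /andP[uX _] /andP[vX _]; apply: cadj_rotate.
Qed.

End Colored.
End Orbits.

Section Subsystem.
Context {R : realType} {d r : nat}.
Local Notation V := 'rV[R]_d.
Variables (Phi : {fset V}) (alpha : r.-tuple V).
Hypotheses (root : root_system Phi) (simp : simple_system Phi alpha).
Variable J : {set 'I_r}.
Local Notation s i := (tnth alpha i).
Local Notation co i b := (coord alpha i b).
Local Notation span := <<alpha>>%VS.
Local Notation sub := (sub_simple alpha J).
Local Notation PhiJ := (sub_roots Phi alpha J).

Lemma tnth_sub k : tnth sub k = s (enum_val k).
Proof. by rewrite tnth_mktuple. Qed.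

Lemma sub_span : (<<sub>> <= span)%VS.
Proof.
apply/span_subvP => x /tnthP[k ->]; rewrite tnth_sub.
by apply: memv_span; apply: mem_tnth.
Qed.

Lemma free_sub : free sub.
Proof.
apply/freeP => k h l; have h' : \sum_i k i *: tnth sub i = 0.
  by rewrite -[RHS]h; apply: eq_bigr => i _; rewrite (tnth_nth 0).
have := congr1 (coord alpha (enum_val l)) h'.
rewrite linear0 linear_sum (bigD1 l) // big1 => [|l' ne];
  rewrite tnth_sub linearZ /= (co_simple simp).
  by rewrite eqxx mulr1 addr0.
by rewrite (inj_eq enum_val_inj) eq_sym (negPf ne) mulr0.
Qed.

Lemma co_sub b k : b \in <<sub>>%VS -> coord sub k b = co (enum_val k) b.
Proof.
move=> /spanE {2}->; rewrite linear_sum (bigD1 k) // big1 => [|l ne];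
  rewrite tnth_sub linearZ /= (co_simple simp).
  by rewrite eqxx mulr1 addr0.
by rewrite (inj_eq enum_val_inj) eq_sym (negPf ne) mulr0.
Qed.

Lemma sub_spanP b : reflect (b \in span /\ forall i, i \notin J -> co i b = 0) (b \in <<sub>>%VS).
Proof.
apply: (iffP idP) => [bs|[bs b0]].
  split=> [|i iJ]; first exact: (subvP sub_span).
  rewrite (spanE bs) linear_sum big1 // => l _.
  rewrite tnth_sub linearZ /= (co_simple simp) (_ : i == _ = false) ?mulr0 //.
  by apply: contraNF iJ => /eqP->; apply: enum_valP.
rewrite (spanE bs); apply: memv_suml => i _.
have [iJ|/b0->] := boolP (i \in J); last by rewrite scale0r mem0v.
apply/memvZ/memv_span; apply/tnthP; exists (enum_rank_in iJ i).
by rewrite tnth_sub enum_rankK_in.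
Qed.

Lemma sub_rootsE b : (b \in PhiJ) = (b \in Phi) && (b \in <<sub>>%VS).
Proof. by rewrite in_sep. Qed.

Lemma sub_root_system : root_system PhiJ.
Proof.
have [n0 refl scal] := root; split.
- by rewrite sub_rootsE (negPf n0).
- move=> a b; rewrite !sub_rootsE => /andP[aP aS] /andP[bP bS].
  by rewrite refl //= reflectionE memvB // memvZ.
- move=> a; rewrite sub_rootsE => /andP[aP _] t; rewrite sub_rootsE => /andP[tP _].
  exact: scal tP.
Qed.

Lemma sub_simple_system : simple_system PhiJ sub.
Proof.
split; first exact: free_sub.
- move=> k; rewrite sub_rootsE tnth_sub (simple_root simp) /= -tnth_sub.
  by apply: memv_span; apply: mem_tnth.
- move=> b; rewrite sub_rootsE => /andP[bP bS]; split=> //.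
  have [_ _ /(_ b bP)[_ [h|h]]] := simp; [left|right] => k; rewrite co_sub //.
Qed.

Lemma sub_pos b : (b \in positive_roots PhiJ sub) =
  (b \in positive_roots Phi alpha) && (b \in <<sub>>%VS).
Proof.
rewrite !posE sub_rootsE -!andbA; congr (_ && _); rewrite andbC.
case bS: (b \in <<sub>>%VS); last by rewrite !andbF.
rewrite !andbT; apply/forallP/forallP => h k; last by rewrite co_sub.
have [kJ|kJ] := boolP (k \in J).
  by have := h (enum_rank_in kJ k); rewrite co_sub // enum_rankK_in.
by have [_ ->] := sub_spanP _ bS.
Qed.

Lemma sub_negs b : negs sub b = negs alpha b && (b \in <<sub>>%VS).
Proof.
apply/negsP/andP => [[k ->]|[/negsP[i ->] bS]].
  rewrite tnth_sub negs_simple memvN -tnth_sub.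
  by split=> //; apply: memv_span; apply: mem_tnth.
have [_ h] := sub_spanP _ bS; have [iJ|/h] := boolP (i \in J).
  by exists (enum_rank_in iJ i); rewrite tnth_sub enum_rankK_in.
by move/eqP; rewrite linearN /= (co_simple simp) eqxx oppr_eq0 oner_eq0.
Qed.

Lemma in_sub_colored_roots m (x : V * nat) : (x \in colored_roots PhiJ sub m) =
  (x \in colored_roots Phi alpha m) && (x.1 \in <<sub>>%VS).
Proof.
rewrite !in_colored_roots sub_pos sub_negs; case: (_ \in <<_>>%VS); rewrite ?andbF //.
by rewrite !andbT.
Qed.

Lemma sub_colored_roots m : {subset colored_roots PhiJ sub m <= colored_roots Phi alpha m}.
Proof. by move=> x; rewrite in_sub_colored_roots => /andP[]. Qed.

Variables (Ip : {set 'I_r}) (IpJ : {set 'I_#|J|}).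
Hypothesis IpE : forall k, (k \in IpJ) = (enum_val k \in Ip).

Lemma sub_bipartition : is_bipartition alpha Ip -> is_bipartition sub IpJ.
Proof.
move=> bip k l; rewrite /adjacent !tnth_sub !IpE => /andP[kl kl0].
by apply: bip; rewrite /adjacent kl0 (inj_eq enum_val_inj) kl.
Qed.

Lemma sub_part b (A : {set 'I_r}) (AJ : {set 'I_#|J|}) :
  (forall k, (k \in AJ) = (enum_val k \in A)) -> b \in <<sub>>%VS -> part sub AJ b = part alpha A b.
Proof.
move=> AE bS; have [_ b0] := sub_spanP _ bS.
rewrite /part (eq_bigr (fun k => co (enum_val k) b *: s (enum_val k))); last first.
  by move=> k _; rewrite co_sub // tnth_sub.
rewrite (eq_bigl (fun k => enum_val k \in A)) //.
rewrite -(big_enum_val_cond (fun i => i \in A) (fun i => co i b *: s i)) [RHS](bigID (mem J)) /=.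
rewrite [X in _ = _ + X]big1 ?addr0 => [|i /andP[_ /b0->]]; last by rewrite scale0r.
by apply: eq_bigl => i; rewrite andbC.
Qed.

Lemma sub_euler b c : b \in <<sub>>%VS -> c \in <<sub>>%VS ->
  euler sub IpJ b c = euler alpha Ip b c.
Proof.
move=> bS cS; have CE k : (k \in ~: IpJ) = (enum_val k \in ~: Ip) by rewrite !inE IpE.
by rewrite /euler !(sub_part IpE) // !(sub_part CE).
Qed.

(** The Euler form of a subsystem is the restriction of the Euler form, and pairs with a negative
simple root are decided by [compat_neg] in both systems. *)
Lemma sub_compat m : (0 < m)%N -> is_bipartition alpha Ip ->
  {in colored_roots PhiJ sub m &, forall x y, compat sub IpJ x y = compat alpha Ip x y}.
Proof.
move=> m0 bip.
have bipJ := sub_bipartition bip.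
have neg_case x y : x \in colored_roots PhiJ sub m -> y \in colored_roots PhiJ sub m ->
    negs sub x.1 -> compat sub IpJ x y = compat alpha Ip x y.
  move=> xX yX xn; have x1 : x.2 = 1%N.
    move: xX; rewrite in_colored_roots => /orP[/andP[xp _]|/andP[_ /eqP//]].
    by rewrite (pos_negs sub_root_system sub_simple_system xp) in xn.
  case/negsP: xn => k e; have -> : x = (- tnth sub k, 1%N) by case: x e x1 {xX} => /= b l -> ->.
  rewrite (compat_neg sub_root_system sub_simple_system bipJ (m := m)) // tnth_sub.
  move: yX; rewrite in_sub_colored_roots => /andP[yX yS].
  by rewrite (compat_neg root simp bip (m := m)) // co_sub // sub_negs yS andbT.
move=> x y xX yX; case xn : (negs sub x.1); first exact: neg_case.
case yn : (negs sub y.1); first by rewrite compat_sym [RHS]compat_sym; apply: neg_case.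
move: xX yX; rewrite !in_sub_colored_roots => /andP[_ xS] /andP[_ yS].
move: (xn) (yn); rewrite !sub_negs xS yS !andbT => xn' yn'.
by rewrite /compat /lift_neg xn yn xn' yn' /compat0 !sub_euler.
Qed.

End Subsystem.

(** Induction on the rank. The link of a negative simple root - s i consists of the colored roots
with coordinate i equal to zero, that is, of the complex of the subsystem without s i. In rank
one there are one positive root, in m colors, and one negative simple root. *)
Theorem regular_colored_roots (R : realType) (d m : nat) (hm : (0 < m)%N) n r
    (Phi : {fset 'rV[R]_d}) (alpha : r.-tuple 'rV[R]_d) (Ip : {set 'I_r}) :
  r = n -> root_system Phi -> simple_system Phi alpha -> is_bipartition alpha Ip ->
  regular (cadj Phi alpha Ip m) m.+1 n (colored_roots Phi alpha m).
Proof.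
elim: n r Phi alpha Ip => [|n IH] r Phi alpha Ip rn root simp bip.
  apply/eqP; rewrite -cardfs_eq0; apply: contraT; rewrite -lt0n cardfs_gt0 => /fset0Pn[x].
  rewrite in_colored_roots => /orP[/andP[/(pos_coP root simp)[i _] _]|/andP[/negsP[i _] _]];
  by case: i => i; rewrite rn.
have i0 : 'I_r by rewrite rn; apply: ord0.
have negX i : (- tnth alpha i, 1%N) \in colored_roots Phi alpha m.
  by rewrite in_colored_roots /= negs_simple eqxx orbT.
split.
- by apply/fset0Pn; exists (- tnth alpha i0, 1%N).
- move=> n0; have only i : i = i0.
    apply: ord_inj; case: i i0 => [i hi] [j hj] /=.
    by move: hi hj; rewrite rn n0 !ltnS !leqn0 => /eqP-> /eqP->.
  have posE b : (b \in positive_roots Phi alpha) = (b == tnth alpha i0).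
    apply/idP/eqP => [bp|->]; last exact: (simple_pos root simp).
    have bE : b = coord alpha i0 b *: tnth alpha i0.
      rewrite {1}(spanE (root_span simp (pos_root bp))) (bigD1 i0) //= big1 ?addr0 // => j.
      by rewrite (only j) eqxx.
    have [_ _ /(_ _ (simple_root simp i0) (coord alpha i0 b))] := root.
    rewrite -bE => /(_ (pos_root bp))[e|e]; first by rewrite bE e scale1r.
    by have := pos_co i0 bp; rewrite e lerNr oppr0 ler10.
  pose L := [fset k in iota 1 m]%fset.
  have inL k : (k \in L) = (0 < k <= m)%N by rewrite in_fset mem_iota add1n ltnS.
  have -> : colored_roots Phi alpha m =
      (- tnth alpha i0, 1%N) |` [fset (tnth alpha i0, k) | k in L].
    apply/fsetP => -[b k]; rewrite in_colored_roots in_fset1U orbC xpair_eqE /=; congr (_ || _).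
      congr (_ && _); apply/negsP/eqP => [[i ->]|->]; last by exists i0.
      by rewrite (only i).
    rewrite posE; apply/andP/imfsetP => [[/eqP-> h]|[k' /= + [-> ->]]].
      by exists k => //=; rewrite inL.
    by rewrite inL eqxx.
  rewrite cardfsU1 card_imfset /=; last by move=> k k' [].
  rewrite [#|` L|]card_fseq undup_id ?iota_uniq // size_iota.
  case: imfsetP => // -[k /= _ [e _]].
  have := pos_not_neg root simp i0 (simple_pos root simp i0).
  by rewrite e eqxx.
apply: (regular_links root simp bip hm) => i.
pose J := [set~ i]; pose IpJ := [set k : 'I_#|J| | enum_val k \in Ip].
have IpE k : (k \in IpJ) = (enum_val k \in Ip) by rewrite inE.
have bipJ := sub_bipartition IpE bip.
have cardJ : #|J| = n by rewrite cardsC1 card_ord rn.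
have reg := IH _ _ _ IpJ cardJ (sub_root_system alpha root J) (sub_simple_system simp J) bipJ.
have -> : nbr (cadj Phi alpha Ip m) (colored_roots Phi alpha m) (- tnth alpha i, 1%N) =
    colored_roots (sub_roots Phi alpha J) (sub_simple alpha J) m.
  apply/fsetP => x; rewrite in_nbr [RHS](in_sub_colored_roots simp) /cadj negX /=.
  case xX : (x \in _) => //=; rewrite (compat_neg root simp bip (m := m)) //.
  have xs : x.1 \in <<alpha>>%VS.
    case/orP: (colored_root_almost xX) => [/pos_root/(root_span simp)//|/negsP[j ->]].
    by rewrite memvN (simple_span simp).
  apply/andP/(sub_spanP simp) => [[ne h]|[_ h]].
    split=> // j; rewrite !inE negbK => /eqP->; case/orP: h => [/eqP//|/negsP[j' e]].
    rewrite e linearN /= (co_simple simp); case: eqP => [ij|]; last by rewrite oppr0.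
    case/eqP: ne; case: x xX e {xs} => b k; rewrite in_colored_roots /= => h e; rewrite e ij.
    move: h; rewrite e => /orP[/andP[]|/andP[_ /eqP->]//].
    by move=> /(pos_negs root simp); rewrite negs_simple.
  have -> : coord alpha i x.1 = 0 by apply: h; rewrite !inE eqxx.
  rewrite eqxx; split=> //; apply/negP => /eqP e; have := h i; rewrite -e /=.
  rewrite !inE eqxx => /(_ isT)/eqP; rewrite linearN /= (co_simple simp) eqxx.
  by rewrite oppr_eq0 oner_eq0.
apply/(eq_regular (adj1 := cadj (sub_roots Phi alpha J) (sub_simple alpha J) IpJ m)) => //.
move=> x y xX yX; rewrite /cadj xX yX (sub_compat root simp IpE hm bip) //.
by rewrite !(sub_colored_roots simp (J := J)).
Qed.

(** * Joins over the irreducible components *)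

Lemma clique_complex0 (K : choiceType) (adj : rel K) : clique_complex adj fset0 = [fset fset0].
Proof.
apply/fsetP => S; rewrite in_clique_complex fsubset0 in_fset1.
by case: eqP => // ->; rewrite clique0.
Qed.

Lemma big_join_clique_complex (K : choiceType) (adj : rel K) (I : eqType) (X : I -> {fset K})
    (l : seq I) :
  symmetric adj -> uniq l ->
  {in l &, forall i j, i != j -> {in X i & X j, forall x y, x != y -> adj x y}} ->
  \big[simplicial_join/[fset fset0]]_(i <- l) clique_complex adj (X i) =
  clique_complex adj (\bigcup_(i <- l) X i).
Proof.
move=> sym; elim: l => [|i l IH] /=; first by rewrite !big_nil clique_complex0.
move=> /andP[il ul] cross; rewrite !big_cons IH //; last first.
  by move=> j k jl kl; apply: cross; rewrite in_cons ?jl ?kl orbT.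
apply: join_clique_complex => // x y xX /bigfcupP[j]; rewrite andbT => jl yX.
apply: (cross i j) => //; first exact: mem_head.
  by rewrite in_cons jl orbT.
by apply: contraNneq il => ->.
Qed.

Section Components.
Context {R : realType} {d r : nat}.
Local Notation V := 'rV[R]_d.
Variables (Phi : {fset V}) (alpha : r.-tuple V).
Hypotheses (root : root_system Phi) (simp : simple_system Phi alpha).
Local Notation s i := (tnth alpha i).
Local Notation co i b := (coord alpha i b).
Local Notation comp i := [set j | connect (adjacent alpha) i j].
Local Notation sub J := (sub_simple alpha J).
Implicit Types (J : {set 'I_r}) (b : V).

Lemma adjacent_connect_sym : connect_sym (adjacent alpha).
Proof. by apply: sym_connect_sym => i j; rewrite /adjacent eq_sym dotC. Qed.

Lemma component_of i J : J \in components alpha -> i \in J -> comp i = J.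
Proof.
case/imsetP => j _ ->; rewrite inE => ji; apply/setP => k; rewrite !inE.
by rewrite (same_connect adjacent_connect_sym ji).
Qed.

Lemma comp_component i : comp i \in components alpha.
Proof. exact: imset_f. Qed.

Lemma component_orthogonal J i j : J \in components alpha -> i \in J -> j \notin J ->
  dot (s i) (s j) = 0.
Proof.
move=> Jc iJ jJ; apply/eqP; apply: contraNT jJ => ij.
rewrite -(component_of Jc iJ) inE; have [->|ne] := eqVneq i j; first exact: connect0.
by apply: connect1; rewrite /adjacent ne.
Qed.

Lemma mem_sub J i : i \in J -> s i \in <<sub J>>%VS.
Proof.
by move=> iJ; rewrite -(enum_rankK_in iJ iJ) -tnth_sub; apply: memv_span; apply: mem_tnth.
Qed.

Lemma sub_combination J b : b \in <<sub J>>%VS -> b = \sum_(i in J) co i b *: s i.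
Proof.
move=> /(sub_spanP simp)[bs b0]; rewrite {1}(spanE bs) (bigID (mem J)) /=.
by rewrite [X in _ + X]big1 ?addr0 // => i /b0->; rewrite scale0r.
Qed.

Lemma sub_dot0 J b j :
  J \in components alpha -> b \in <<sub J>>%VS -> j \notin J -> dot b (s j) = 0.
Proof.
move=> Jc bJ jJ; rewrite (sub_combination bJ) dot_suml big1 // => i iJ.
by rewrite dotZl (component_orthogonal Jc iJ jJ) mulr0.
Qed.

Lemma sub_tau J A b :
  J \in components alpha -> b \in <<sub J>>%VS -> tau alpha A b \in <<sub J>>%VS.
Proof.
move=> Jc bJ; rewrite /tau; case: ifP => // _; elim: (enum A) => //= i l IH.
rewrite reflectionE; have [iJ|iJ] := boolP (i \in J); first by rewrite memvB ?memvZ ?mem_sub.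
by rewrite (sub_dot0 Jc IH iJ) mulr0 mul0r scale0r subr0.
Qed.

Lemma part_sub J A b : b \in <<sub J>>%VS -> part alpha A b \in <<sub J>>%VS.
Proof.
move=> /(sub_spanP simp)[bs b0]; apply: memv_suml => i _.
by have [iJ|/b0->] := boolP (i \in J); [rewrite memvZ ?mem_sub | rewrite scale0r mem0v].
Qed.

Variable Ip : {set 'I_r}.
Hypothesis bip : is_bipartition alpha Ip.

Lemma sub_rotation J b :
  J \in components alpha -> b \in <<sub J>>%VS -> rotation alpha Ip b \in <<sub J>>%VS.
Proof. by move=> Jc bJ; do 2!apply: (sub_tau _ Jc). Qed.

Lemma sub_rotation_inv J b : J \in components alpha -> almost Phi alpha b ->
  rotation alpha Ip b \in <<sub J>>%VS -> b \in <<sub J>>%VS.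
Proof.
move=> Jc ab h; have [a1 <-] := tau_almost root simp (orthogonal_plus bip) ab.
have [_ <-] := tau_almost root simp (orthogonal_minus bip) a1.
by do 2!apply: (sub_tau _ Jc).
Qed.

(** Simple reflections preserve the span of a component, so the rotation and its inverse do. The
orbit of a root meets a negative simple root, which lies in such a span. *)
Lemma root_component b : b \in positive_roots Phi alpha ->
  exists2 J, J \in components alpha & b \in <<sub J>>%VS.
Proof.
move=> bp; have [t /negsP[i e]] := orbit_neg root simp bip bp.
exists (comp i); first exact: comp_component.
have : almost Phi alpha b by rewrite /almost bp.
have : iter t (rotation alpha Ip) b \in <<sub (comp i)>>%VS.
  by rewrite e memvN mem_sub // inE connect0.
elim: t b {bp e} => //= t IH b h ab.
apply: (sub_rotation_inv (comp_component i) ab).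
by apply: IH; [rewrite -iterSr | apply: (rotation_almost root simp bip)].
Qed.

Section Colored.
Variable m : nat.
Hypothesis m0 : (0 < m)%N.
Local Notation X := (colored_roots Phi alpha m).
Local Notation XJ J := (colored_roots (sub_roots Phi alpha J) (sub J) m).

Lemma colored_roots_components (l : seq {set 'I_r}) :
  l =i components alpha -> \bigcup_(J <- l) XJ J = X.
Proof.
move=> lE; apply/fsetP => x; apply/bigfcupP/idP => [[J _ /(sub_colored_roots simp)//]|xX].
suff [J Jc xJ] : exists2 J, J \in components alpha & x.1 \in <<sub J>>%VS.
  by exists J; rewrite ?andbT ?lE // (in_sub_colored_roots simp J m x) xX.
case/orP: (colored_root_almost xX) => [/root_component//|/negsP[i ->]].
by exists (comp i); [apply: comp_component | rewrite memvN mem_sub // inE connect0].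
Qed.

(** Different components are orthogonal, so the Euler form vanishes between them. *)
Lemma cross_component J J' : J \in components alpha -> J' \in components alpha -> J != J' ->
  {in XJ J & XJ J', forall x y, x != y -> cadj Phi alpha Ip m x y}.
Proof.
move=> Jc Jc' ne x y xX yX xy.
rewrite /cadj (sub_colored_roots simp xX) (sub_colored_roots simp yX) xy /=.
have disj i : i \in J' -> i \notin J.
  by move=> iJ'; apply: contraNN ne => iJ; rewrite -(component_of Jc iJ) (component_of Jc' iJ').
have dot0 b b' : b \in <<sub J>>%VS -> b' \in <<sub J'>>%VS -> dot b b' = 0.
  move=> bJ bJ'; rewrite (sub_combination bJ') dot_sumr big1 // => i iJ'.
  by rewrite dotZr (sub_dot0 Jc bJ (disj i iJ')) mulr0.
have lift K u : K \in components alpha -> u \in XJ K -> (lift_neg alpha Ip u).1 \in <<sub K>>%VS.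
  move=> Kc; rewrite (in_sub_colored_roots simp K m u) /lift_neg => /andP[_ uK].
  by case: ifP => //= _; apply: sub_rotation.
have euler0 b b' : b \in <<sub J>>%VS -> b' \in <<sub J'>>%VS ->
    euler alpha Ip b b' = 0 /\ euler alpha Ip b' b = 0.
  move=> bJ bJ'; rewrite /euler !(dotC (part _ _ b')) !dot0 ?part_sub //.
  by rewrite mul0r !addr0.
have [e1 e2] := euler0 _ _ (lift J x Jc xX) (lift J' y Jc' yX).
by rewrite /compat /compat0 e1 e2 eqxx lexx; case: ifP => //; case: ifP.
Qed.

Lemma irreducible_clique_complex J (IpJ : {set 'I_#|J|}) c :
  (forall k, (k \in IpJ) = (enum_val k \in Ip)) ->
  compatibility (sub_roots Phi alpha J) (sub J) m IpJ c ->
  irreducible_cluster_complex m (sub_roots Phi alpha J) (sub J) c =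
  clique_complex (cadj Phi alpha Ip m) (XJ J).
Proof.
move=> IpE hc; have bipJ := sub_bipartition IpE bip.
have cE := compat_unique (sub_root_system alpha root J) (sub_simple_system simp J) bipJ m0 hc.
apply/fsetP => S; rewrite [RHS]in_clique_complex [LHS]in_sep fpowersetE.
case: (boolP (S `<=` _)) => //= /fsubsetP SX.
have eqc x y : x \in S -> y \in S -> x != y -> c x y = cadj Phi alpha Ip m x y.
  move=> /SX xX /SX yX xy; rewrite cE // (sub_compat root simp IpE m0 bip xX yX).
  by rewrite /cadj (sub_colored_roots simp xX) (sub_colored_roots simp yX) xy.
apply/allP/cliqueP => [h x y xS yS xy|h x xS].
  by rewrite -eqc //; move/allP: (h x xS) => /(_ y yS); rewrite xy.
by apply/allP => y yS; apply/implyP => xy; rewrite eqc // h.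
Qed.

End Colored.
End Components.

(** The bipartition of the whole diagram that restricts to the given ones of the components. *)
Definition glue (R : realType) (d r : nat) (alpha : r.-tuple 'rV[R]_d)
    (Ip : forall J : {set 'I_r}, {set 'I_#|J|}) : {set 'I_r} :=
  [set i | [exists k in Ip [set j | connect (adjacent alpha) i j], enum_val k == i]].

Lemma glueE (R : realType) (d r : nat) (alpha : r.-tuple 'rV[R]_d)
    (Ip : forall J : {set 'I_r}, {set 'I_#|J|}) (J : {set 'I_r}) (k : 'I_#|J|) :
  J \in components alpha -> (k \in Ip J) = (enum_val k \in glue alpha Ip).
Proof.
move=> Jc; rewrite inE (component_of Jc (enum_valP k)); apply/idP/exists_inP => [kI|[l lI]].
  by exists k.
by move=> /eqP/enum_val_inj <-.
Qed.

Lemma glue_bipartition (R : realType) (d r : nat) (alpha : r.-tuple 'rV[R]_d)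
    (Ip : forall J : {set 'I_r}, {set 'I_#|J|}) :
  (forall J, J \in components alpha -> is_bipartition (sub_simple alpha J) (Ip J)) ->
  is_bipartition alpha (glue alpha Ip).
Proof.
move=> bip i j ij; set J := [set j | connect (adjacent alpha) i j].
have Jc : J \in components alpha by apply: comp_component.
have iJ : i \in J by rewrite inE connect0.
have jJ : j \in J by rewrite inE connect1.
rewrite -(enum_rankK_in iJ iJ) -(enum_rankK_in iJ jJ) -!glueE //.
apply: bip => //; rewrite /adjacent !tnth_sub -(inj_eq enum_val_inj) !enum_rankK_in //.
Qed.

Theorem cluster_pure_EKR (R : realType) (d r m : nat) (Phi : {fset 'rV[R]_d})
    (alpha : r.-tuple 'rV[R]_d) (Ip : forall J : {set 'I_r}, {set 'I_#|J|})
    (c : {set 'I_r} -> rel ('rV[R]_d * nat)) :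
  (0 < m)%N -> root_system Phi -> simple_system Phi alpha -> (0 < r <= 4)%N ->
  (forall J : {set 'I_r}, J \in components alpha ->
     is_bipartition (sub_simple alpha J) (Ip J) /\
     compatibility (sub_roots Phi alpha J) (sub_simple alpha J) m (Ip J) (c J)) ->
  pure_EKR (cluster_complex m Phi alpha c).
Proof.
move=> m0 root simp r4 hc; set G := glue alpha Ip.
have bip : is_bipartition alpha G by apply: glue_bipartition => J /hc[].
suff -> : cluster_complex m Phi alpha c =
    clique_complex (cadj Phi alpha G m) (colored_roots Phi alpha m).
  apply: (@pure_EKR_regular _ _ (cadj_sym _ _ _ _) (cadj_irr _ _ _ _) m.+1 r) => //; last first.
    exact: cadj_colored_root.
  exact: regular_colored_roots.
rewrite /cluster_complex; have [l big_l [ul lE] _] := big_enumP (mem (components alpha)).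
rewrite -big_l.
rewrite (eq_big_seq (fun J => clique_complex (cadj Phi alpha G m)
    (colored_roots (sub_roots Phi alpha J) (sub_simple alpha J) m))); last first.
  move=> J; rewrite lE => Jc; have [_ cJ] := hc J Jc.
  by apply: (irreducible_clique_complex root simp bip m0 _ cJ) => k; apply: glueE.
rewrite big_join_clique_complex //; last 2 first.
- exact: cadj_sym.
- move=> J J'; rewrite !lE; apply: cross_component => //.
by rewrite (colored_roots_components root simp bip).
Qed.

Local Open Scope nat_scope.

Theorem corollary1p9 (m : nat) (hm : 0 < m) :
  (forall (R : realType) (d r : nat) (Phi : {fset 'rV[R]_d})
      (alpha : r.-tuple 'rV[R]_d)
      (Ip : forall J : {set 'I_r}, {set 'I_#|J|})
      (c : {set 'I_r} -> rel ('rV[R]_d * nat)),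
    root_system Phi ->
    simple_system Phi alpha ->
    0 < r <= 4 ->
    (forall J : {set 'I_r}, J \in components alpha ->
       is_bipartition (sub_simple alpha J) (Ip J) /\
       compatibility (sub_roots Phi alpha J) (sub_simple alpha J) m
         (Ip J) (c J)) ->
    pure_EKR (cluster_complex m Phi alpha c)) /\
  (forall n : nat, 2 <= n <= 5 -> pure_EKR (angulation_complex m n)).
Proof.
split=> [R d r Phi alpha Ip c root simp r4 hc|n /andP[n1 n5]].
  exact: (cluster_pure_EKR hm root simp r4 hc).
exact: angulation_pure_EKR.
Qed.
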